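(* Let $\alpha\in\mathbb R$. The generalized Proudman--Johnson equation with parameter $\alpha$, $$u_{txx}+(2-\alpha)u_xu_{xx}+uu_{xxx}=0,$$ is the Euler--Arnold equation of the Riemannian metric $G^{\alpha\dot H^1}$ on $\widetilde{\operatorname{Diff}}(\mathbb R)$. Consequently, the generalized Proudman--Johnson equation with parameter $\alpha$ is globally well-posed on $\mathfrak g$ if and only if $\alpha=1$.
   Context: $W^{\infty,1}(\mathbb R)=\bigcap_{k\in\mathbb N}W^{k,1}(\mathbb R)$ is the intersection of all $L^1$-based Sobolev spaces. The group $$\widetilde{\operatorname{Diff}}(\mathbb R)=\Big\{\varphi=x+f(x): f'\in W^{\infty,1}(\mathbb R),\ f'>-1,\ \lim_{x\to-\infty}f(x)=0\Big\}$$ is an infinite-dimensional Lie group with Lie algebra $$\mathfrak g=\Big\{u: u'\in W^{\infty,1}(\mathbb R),\ \lim_{x\to-\infty}u(x)=0\Big\}.$$ Tangent vectors at $\varphi$ are written $u\circ\varphi$ with $u\in\mathfrak g$. The $\alpha\dot H^1$-metric on $\widetilde{\operatorname{Diff}}(\mathbb R)$ is $$G^{\alpha\dot H^1}_\varphi(u\circ\varphi,v\circ\varphi)=\int_{\mathbb R}\varphi_x^{-\alpha-1}(u\circ\varphi)_x(v\circ\varphi)_x\,dx=\int_{\mathbb R}\varphi_x^{-\alpha+1}(u_x\circ\varphi)(v_x\circ\varphi)\,dx,$$ where $dx$ is the Lebesgue measure. (This metric is right-invariant only for $\alpha=0$.) That an equation for $u$ is the Euler--Arnold equation of a Riemannian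 metric on $\widetilde{\operatorname{Diff}}(\mathbb R)$ means: a curve $\varphi(t)$ in $\widetilde{\operatorname{Diff}}(\mathbb R)$ is a geodesic of the metric if and only if its Eulerian velocity $u(t)=\varphi_t(t)\circ\varphi(t)^{-1}\in\mathfrak g$ solves the equation. Globally well-posed on $\mathfrak g$ means that for every initial condition $u_0\in\mathfrak g$ there is a unique solution $u(t)\in\mathfrak g$ with $u(0)=u_0$ existing for all times $t\ge 0$. *)

(* Defs.v *)
From HB Require Import structures.
From mathcomp Require Import all_boot all_order all_algebra.
From mathcomp Require Import all_classical all_reals all_analysis.
Import Order.TTheory GRing.Theory Num.Theory.
Import numFieldNormedType.Exports.

Set Implicit Arguments.
Unset Strict Implicit.
Unset Printing Implicit Defensive.

Local Open Scope ring_scope.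
Local Open Scope classical_set_scope.

(* In [ring_scope] these notations otherwise denote derivatives of polynomials. *)
Local Notation "f ^` ()" := (derive1 f) : ring_scope.
Local Notation "f ^` ( n )" := (derive1n n f) : ring_scope.

(* Time-dependent functions [U : R -> R -> R] take the time first:
   [U t x] is U(t,x), and [(U t)^`(k)] is the k-th derivative in x. *)

Definition smooth {R : realType} (f : R -> R) : Prop :=
  forall n x, derivable (f^`(n)) x 1.

(* Test functions of class C^1 with compact support; by mollification they
   give the same weak derivatives as C^oo test functions. *)
Definition test_function {R : realType} (psi : R -> R) : Prop :=
  [/\ forall x, derivable psi x 1,
      continuous (psi^`()) &
      exists M : R, forall x, M < `|x| -> psi x = 0].

Definition weak_derivative {R : realType} (f g : R -> R) : Prop :=
  forall psi : R -> R, test_function psi ->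
    Rintegral (@lebesgue_measure R) setT (fun x => f x * psi^`() x) =
    - Rintegral (@lebesgue_measure R) setT (fun x => g x * psi x).

Fixpoint sobolev_W1 {R : realType} (k : nat) (f : R -> R) : Prop :=
  (@lebesgue_measure R).-integrable setT (EFin \o f) /\
  if k is k'.+1 then exists g, weak_derivative f g /\ sobolev_W1 k' g
  else True.

Definition sobolev_Woo1 {R : realType} (f : R -> R) : Prop :=
  forall k, sobolev_W1 k f.

(* A function whose derivative is in W^{oo,1} has a unique C^oo
   representative, by Sobolev embedding; it is the one used here. *)
Definition in_g {R : realType} (u : R -> R) : Prop :=
  [/\ smooth u, sobolev_Woo1 (u^`()) & u x @[x --> -oo%R] --> (0 : R)].

Definition in_Diff {R : realType} (phi : R -> R) : Prop :=
  exists f : R -> R,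
    [/\ in_g f, forall x, -1 < f^`() x & forall x, phi x = x + f x].

(* Convergence in the Frechet topology of g, whose seminorms are the L^1 norms
   of the derivatives of u'. The integral is extended-real valued: it is +oo,
   not a default value, on non-integrable functions. Diff is open in the affine
   space id + g, so the same notion, applied to differences, serves for both. *)
Definition g_cvg {R : realType} {T : Type} (F : set_system T)
    (U : T -> R -> R) (V : R -> R) : Prop :=
  forall k : nat,
    (\int[@lebesgue_measure R]_x
       (`| (fun y => U p y - V y)^`(k.+1) x |)%:E)%E @[p --> F] --> 0%E.

Definition g_continuous_on {R : realType} {T : topologicalType} (D : set T)
    (U : T -> R -> R) : Prop :=
  forall p, D p -> g_cvg (within D (nbhs p)) U (U p).

(* [V] is the time derivative, with values in g, of the curve [U] on the
   interval [D]; it is one-sided at an endpoint belonging to [D]. *)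
Definition g_derivative_on {R : realType} (D : set R) (U V : R -> R -> R) :
    Prop :=
  forall t, D t -> in_g (V t) /\
    g_cvg (within D (t^')) (fun s x => (U s x - U t x) / (s - t)) (V t).

Definition C1_curve_g {R : realType} (I : set R) (u ut : R -> R -> R) : Prop :=
  [/\ forall t, I t -> in_g (u t),
      g_derivative_on I u ut &
      g_continuous_on I ut].

Definition C2_curve_Diff {R : realType} (I : set R) (phi phit : R -> R -> R) :
    Prop :=
  (forall t, I t -> in_Diff (phi t)) /\
  g_derivative_on I phi phit /\ (exists phitt, C1_curve_g I phit phitt).

(* C^n regularity on the rectangle [J `*` I] of a two-parameter family
   [Phi s t], through jointly continuous partial derivatives in g. *)
Fixpoint C_family {R : realType} (n : nat) (J I : set R)
    (Phi : R -> R -> R -> R) : Prop :=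
  g_continuous_on (J `*` I) (fun p : R * R => Phi p.1 p.2) /\
  if n is n'.+1 then
    exists Phis Phit : R -> R -> R -> R,
      [/\ forall t, I t ->
            g_derivative_on J (fun s => Phi s t) (fun s => Phis s t),
          forall s, J s -> g_derivative_on I (Phi s) (Phit s),
          C_family n' J I Phis &
          C_family n' J I Phit]
  else True.

(* A metric [G phi U V] takes tangent vectors U = u \o phi, V = v \o phi at phi
   as functions on R, without pulling them back to u and v. *)
Definition metric (R : realType) := (R -> R) -> (R -> R) -> (R -> R) -> R.

Definition alpha_H1dot {R : realType} (alpha : R) : metric R :=
  fun phi U V =>
    Rintegral (@lebesgue_measure R) setT
      (fun x => (phi^`() x) `^ (- alpha - 1) * U^`() x * V^`() x).

Definition energy {R : realType} (G : metric R) (a b : R)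
    (phi phit : R -> R -> R) : R :=
  2^-1 * Rintegral (@lebesgue_measure R) `[a, b]
           (fun t => G (phi t) (phit t) (phit t)).

(* [Phi s] is a variation of [phi] on [a, b] through paths in Diff with the same
   endpoints, and [Phit s] is the velocity of the path [Phi s]. *)
Definition proper_variation {R : realType} (a b e : R) (phi : R -> R -> R)
    (Phi Phit : R -> R -> R -> R) : Prop :=
  [/\ forall s t, `]-e, e[ s -> `[a, b] t -> in_Diff (Phi s t),
      C_family 2 `]-e, e[ `[a, b] Phi,
      forall s, `]-e, e[ s -> g_derivative_on `[a, b] (Phi s) (Phit s),
      forall t, `[a, b] t -> Phi 0 t = phi t &
      forall s, `]-e, e[ s -> Phi s a = phi a /\ Phi s b = phi b].

Definition geodesic {R : realType} (G : metric R) (I : set R)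
    (phi : R -> R -> R) : Prop :=
  forall a b : R, a < b -> `[a, b] `<=` I ->
  forall (e : R) (Phi Phit : R -> R -> R -> R),
    0 < e -> proper_variation a b e phi Phi Phit ->
    is_derive (0 : R) (1 : R) (fun s => energy G a b (Phi s) (Phit s)) (0 : R).

(* An evolution equation, as a relation between u and its time derivative. *)
Definition evolution_eqn (R : realType) := (R -> R) -> (R -> R) -> Prop.

Definition solution {R : realType} (eqn : evolution_eqn R) (I : set R)
    (u : R -> R -> R) : Prop :=
  exists ut : R -> R -> R,
    C1_curve_g I u ut /\ forall t, I t -> eqn (u t) (ut t).

(* u = phi_t \o phi^-1, the maps phi(t) being bijections of R. *)
Definition eulerian_velocity {R : realType} (I : set R)
    (phit phi u : R -> R -> R) : Prop :=
  forall t, I t -> u t \o phi t = phit t.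

(* The time interval is any interval with nonempty interior. *)
Definition euler_arnold {R : realType} (G : metric R) (eqn : evolution_eqn R) :
    Prop :=
  forall (I : interval R) (phi phit u : R -> R -> R),
    ([set` I]° !=set0) ->
    C2_curve_Diff [set` I] phi phit ->
    eulerian_velocity [set` I] phit phi u ->
    (geodesic G [set` I] phi <-> solution eqn [set` I] u).

Definition globally_well_posed {R : realType} (eqn : evolution_eqn R) : Prop :=
  forall u0 : R -> R, in_g u0 ->
  exists u : R -> R -> R,
    [/\ solution eqn `[0, +oo[ u,
        u 0 = u0 &
        forall v : R -> R -> R, solution eqn `[0, +oo[ v -> v 0 = u0 ->
          forall t, 0 <= t -> v t = u t].

Definition proudman_johnson {R : realType} (alpha : R) : evolution_eqn R :=
  fun u ut => forall x,
    ut^`(2) x + (2 - alpha) * u^`() x * u^`(2) x + u x * u^`(3) x = 0.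

(* Main.v *)
Require Import Defs.
From mathcomp Require Import all_boot all_order all_algebra.
From mathcomp Require Import all_classical all_reals all_analysis.
From mathcomp Require Import measurable_realfun ring lra.
Import Order.TTheory GRing.Theory Num.Theory.
Import numFieldNormedType.Exports.

(** Everything rests on elementary estimates for curves of functions, which take
the place of flows of differential equations.

Let [phi] be a [C^2] curve in [Diff], [u] its Eulerian velocity and
  [EL = phi_x phi_ttx - (alpha + 1) / 2 phi_tx ^ 2].
Comparing the energies of two neighbouring paths to second order and
integrating by parts in time ([energy_compare], [energy_var]) shows that the
first variation of the energy in a direction [q] is
  [- int int phi_x ^ (- alpha - 2) EL q_x dx dt].
Hence [EL = 0] makes [phi] a geodesic ([EL0_geodesic]).  Conversely, if [EL] does
not vanish at time [t0], let [rho] be the element of [g] with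
[rho_x = EL (t0)]: the variation [phi + s (t - a) (b - t) rho], on a short
interval around [t0], has a non-zero first variation ([geodesic_EL0]).

Differentiating [phi_t = u o phi] in [t] and [x] gives
  [EL = phi_x ^ 2 (u_tx + (1 - alpha) / 2 u_x ^ 2 + u u_xx) o phi]
([lagrangian_residual]), and the bracket is the integrable primitive of the
left-hand side of the Proudman-Johnson equation ([PJ_integrated]), so that the
geodesic equation is the Proudman-Johnson equation.  This uses that [u] is a
[C^1] curve in [g] ([eulerian_C1]).

For [alpha = 1], [EL = 0] means [(log phi_x)_tt = 0], that is
[phi_x = exp (t u0_x)] for the geodesic issued from the identity; it exists for
all times ([PJ1_existence]).  The difference of two solutions satisfies a
transport equation with a zero order right-hand side, and a Gronwall
inequality for its supremum gives uniqueness ([PJ1_unique_segment]).  For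
[alpha <> 1], [p = - sgn (1 - alpha) u_x] satisfies
[p_t + u p_x = |1 - alpha| / 2 p ^ 2], so that its supremum, once positive,
becomes infinite in finite time ([PJ_blowup]).

Concerning function spaces, [tame true] is the space [W^{oo,1}], described by
bounds on classical derivatives, and [tame false] is the space of smooth
functions with bounded derivatives.  Weak derivatives and the topology of [g]
are translated into these bounds once and for all ([smooth_tame],
[tame_sobolev], [g_cvgP]); afterwards all limits are limits of difference
quotients in the norms [bdk].  Gronwall, Riccati and mean value inequalities
are proved by continuous induction ([real_induction]) on explicit Euler
steps. *)

Set Implicit Arguments.
Unset Strict Implicit.
Unset Printing Implicit Defensive.

Local Open Scope ring_scope.
Local Open Scope classical_set_scope.

Local Notation "f ^` ()" := (derive1 f) : ring_scope.
Local Notation "f ^` ( n )" := (derive1n n f) : ring_scope.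

(** * Classical derivatives *)

(** Having the derivative as an argument lets the rules below compute it; [D1E]
turns the outcome into an equation for [derive1]. *)
Definition D1 {R : realType} (f f' : R -> R) : Prop :=
  forall x : R, is_derive x (1 : R) f (f' x).

Section D1.
Context {R : realType}.
Implicit Types (f g h : R -> R).

Lemma D1E f f' : D1 f f' -> f^`() = f'.
Proof. by move=> H; apply/funext => x; rewrite derive1E; have [_ ->] := H x. Qed.

Lemma D1_derivable f f' : D1 f f' -> forall x, derivable f x 1.
Proof. by move=> H x; have [] := H x. Qed.

Lemma derivable_D1 f : (forall x, derivable f x 1) -> D1 f (f^`()).
Proof. by move=> H x; rewrite derive1E; apply/derivableP/H. Qed.

Lemma D1_continuous f f' : D1 f f' -> continuous f.
Proof.
by move=> H x; apply/differentiable_continuous/derivable1_diffP; have [] := H x.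
Qed.

Lemma D1_cst c : D1 (fun _ : R => c) (fun=> 0).
Proof. by move=> x; exact: is_derive_cst. Qed.

Lemma D1_id : D1 (fun x : R => x) (fun=> 1).
Proof. by move=> x; exact: is_derive_id. Qed.

Lemma D1D f g f' g' : D1 f f' -> D1 g g' ->
  D1 (fun x => f x + g x) (fun x => f' x + g' x).
Proof. by move=> F G x; have ? := F x; have ? := G x; exact: is_deriveD. Qed.

Lemma D1N f f' : D1 f f' -> D1 (fun x => - f x) (fun x => - f' x).
Proof. by move=> F x; have ? := F x; exact: is_deriveN. Qed.

Lemma D1B f g f' g' : D1 f f' -> D1 g g' ->
  D1 (fun x => f x - g x) (fun x => f' x - g' x).
Proof. by move=> F G x; have ? := F x; have ? := G x; exact: is_deriveB. Qed.

Lemma D1M f g f' g' : D1 f f' -> D1 g g' ->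
  D1 (fun x => f x * g x) (fun x => f' x * g x + f x * g' x).
Proof.
move=> F G x; apply: is_derive_eq (is_deriveM (F x) (G x)) _.
by rewrite /GRing.scale /=; ring.
Qed.

Lemma D1Z c f f' : D1 f f' -> D1 (fun x => c * f x) (fun x => c * f' x).
Proof.
by move=> F x; apply: is_derive_eq (is_deriveZ c (F x)) _.
Qed.

Lemma D1V f f' : (forall x, f x != 0) -> D1 f f' ->
  D1 (fun x => (f x)^-1) (fun x => - f' x * ((f x)^-1 * (f x)^-1)).
Proof.
move=> f0 F x; have [df dfE] := F x.
split; first exact: derivableV.
by rewrite deriveV // dfE /GRing.scale /= expr2 invfM; ring.
Qed.

Lemma D1_comp f g f' g' : D1 f f' -> D1 g g' ->
  D1 (fun x => f (g x)) (fun x => f' (g x) * g' x).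
Proof. by move=> F G x; exact: (is_derive1_comp (F (g x)) (G x)). Qed.

Lemma D1_eq f f' f'' : D1 f f' -> (forall x, f' x = f'' x) -> D1 f f''.
Proof. by move=> H e x; rewrite -e. Qed.

Lemma D1_MVT f f' (a b : R) : D1 f f' ->
  exists c, (Num.min a b <= c <= Num.max a b) /\ f b - f a = f' c * (b - a).
Proof.
move=> F; wlog ab : a b / a <= b.
  move=> W; have /orP[|ba] := le_total a b; first exact: W.
  have [c [cab E]] := W _ _ ba; exists c; split; first by rewrite minC maxC.
  by rewrite -opprB E -mulrN opprB.
have cf : {within `[a, b], continuous f}.
  by apply: continuous_subspaceT; exact: (D1_continuous F).
have [c /[!in_itv]/= cab E] := MVT_segment ab (fun x _ => F x) cf.
by exists c; split=> //; rewrite (min_idPl ab) (max_idPr ab).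
Qed.

Lemma D1_lip f f' M : D1 f f' -> (forall x, `|f' x| <= M) ->
  forall a b, `|f b - f a| <= M * `|b - a|.
Proof.
move=> F B a b; have [c [_ ->]] := D1_MVT a b F.
by rewrite normrM ler_wpM2r.
Qed.

(** The factor [1 / 2] is dropped: two uses of the mean value theorem suffice. *)
Lemma D1_taylor f f' f'' M : D1 f f' -> D1 f' f'' -> (forall x, `|f'' x| <= M) ->
  forall a b, `|f b - f a - f' a * (b - a)| <= M * (b - a) ^+ 2.
Proof.
move=> F F' B a b; have [c [/andP[ca cb] ->]] := D1_MVT a b F.
rewrite -mulrBl normrM -(@real_normK _ (b - a)) ?num_real // expr2 mulrA.
apply: ler_wpM2r => //; apply: le_trans (D1_lip F' B a c) _.
apply: ler_wpM2l; first by apply: le_trans (B 0).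
move: ca cb; rewrite /Num.min /Num.max; case: ltP => ab ca cb.
  by rewrite !ger0_norm ?subr_ge0; lra.
by rewrite !ler0_norm ?subr_le0; lra.
Qed.

Lemma D1_inj_cst f c : D1 f (fun=> c) -> forall x, f x = f 0 + c * x.
Proof.
by move=> F x; have [d [_ E]] := D1_MVT 0 x F; move: E; rewrite subr0; lra.
Qed.

End D1.

(** * Bounds on derivatives *)

Section bd.
Context {R : realType}.
Notation mu := (@lebesgue_measure R).
Implicit Types (f g h H F G : R -> R) (b : bool) (e d : R).

(** One constant for the supremum and, when [b] is true, for the [L^1] norm.
Derivatives of elements of [g] are integrable; the elements themselves and the
Jacobians are only bounded.  A product needs one integrable factor, see [bdM]. *)
Definition bd b e H := [/\ continuous H, forall x, `|H x| <= e &
  b -> (\int[mu]_x (`|H x|)%:E <= e%:E)%E].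

Fixpoint bdk b (k : nat) e H : Prop :=
  bd b e H /\ if k is k'.+1 then exists H', D1 H H' /\ bdk b k' e H' else True.

Lemma bdk0 b k e H : bdk b k e H -> bd b e H.
Proof. by case: k => [|k] []. Qed.

Lemma bdkS b k e H : bdk b k.+1 e H -> bdk b k e (H^`()).
Proof. by move=> [_ [H' [D]]]; rewrite (D1E D). Qed.

Lemma bdkS_D1 b k e H : bdk b k.+1 e H -> D1 H (H^`()).
Proof. by move=> [_ [H' [D _]]]; rewrite (D1E D). Qed.

Lemma bdkSI b k e H H' : D1 H H' -> bd b e H -> bdk b k e H' -> bdk b k.+1 e H.
Proof. by move=> D B B'; split=> //; exists H'. Qed.

Lemma bdk_cont b k e H : bdk b k e H -> continuous H.
Proof. by move=> /bdk0[]. Qed.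

Lemma bdk_sup b k e H : bdk b k e H -> forall x, `|H x| <= e.
Proof. by move=> /bdk0[]. Qed.

Lemma bdk_ge0 b k e H : bdk b k e H -> 0 <= e.
Proof. by move=> /bdk_sup/(_ 0); apply: le_trans. Qed.

Lemma bd_ge0 b e H : bd b e H -> 0 <= e.
Proof. by case=> _ /(_ 0) + _; apply: le_trans. Qed.

Lemma bdF b e H : bd b e H -> bd false e H.
Proof. by case: b => // -[]. Qed.

Lemma bdk_false b k e H : bdk b k e H -> bdk false k e H.
Proof.
elim: k H => [|k IH] H [B]; first by split=> //; exact: bdF B.
by move=> [H' [D /IH B']]; split; [exact: bdF B|exists H'].
Qed.

Lemma bdk_k b k e H : bdk b k.+1 e H -> bdk b k e H.
Proof.
elim: k H => [|k IH] H [B]; first by split.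
by move=> [H' [D /IH B']]; split=> //; exists H'.
Qed.

Lemma bd_le b e d H : e <= d -> bd b e H -> bd b d H.
Proof.
move=> ed [cH sH iH]; split=> // [x|/iH]; first exact: le_trans ed.
by move=> /le_trans; apply; rewrite lee_fin.
Qed.

Lemma bdk_le b k e d H : e <= d -> bdk b k e H -> bdk b k d H.
Proof.
move=> ed; elim: k H => [|k IH] H [B]; first by split=> //; exact: bd_le B.
by move=> [H' [D /IH B']]; split; [exact: bd_le B|exists H'].
Qed.

Lemma continuous_measurable_abs H : continuous H ->
  measurable_fun [set: R] (EFin \o (fun x : R => `|H x|)).
Proof.
move=> cH; apply/measurable_EFinP.
by apply: measurableT_comp => //; exact: continuous_measurable_fun.
Qed.
#[local] Hint Resolve continuous_measurable_abs : core.

Lemma bdD b e d H G : bd b e H -> bd b d G -> bd b (e + d) (fun x => H x + G x).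
Proof.
move=> [cH sH iH] [cG sG iG]; split=> [x|x|bt].
- exact: (continuousD (cH x) (cG x)).
- by apply: le_trans (ler_normD _ _) _; exact: lerD.
have cHG : continuous (fun x => H x + G x).
  by move=> x; exact: (continuousD (cH x) (cG x)).
apply: (@le_trans _ _ (\int[mu]_x (`|H x|)%:E + \int[mu]_x (`|G x|)%:E)%E); last first.
  by rewrite EFinD; apply: leeD; [exact: iH|exact: iG].
rewrite -ge0_integralD //; last 2 first.
- exact: continuous_measurable_abs.
- exact: continuous_measurable_abs.
apply: ge0_le_integral => //.
- exact: continuous_measurable_abs.
- by apply: emeasurable_funD; exact: continuous_measurable_abs.
by move=> x _; rewrite -EFinD lee_fin; exact: ler_normD.
Qed.

Lemma bdM b1 b2 e d H G : bd b1 e H -> bd b2 d G ->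
  bd (b1 || b2) (e * d) (fun x => H x * G x).
Proof.
move=> [cH sH iH] [cG sG iG].
have e0 : 0 <= e by apply: le_trans (sH 0).
have d0 : 0 <= d by apply: le_trans (sG 0).
have cHG : continuous (fun x => H x * G x).
  by move=> x; exact: (continuousM (cH x) (cG x)).
split=> // [x|]; first by rewrite normrM ler_pM.
move=> /orP[bt|bt].
  rewrite mulrC EFinM; apply: le_trans (lee_wpmul2l _ (iH bt)); last by rewrite lee_fin.
  rewrite -ge0_integralZl_EFin //; last exact: continuous_measurable_abs.
  apply: ge0_le_integral => //.
  - exact: continuous_measurable_abs.
  - by apply: measurable_funeM; exact: continuous_measurable_abs.
  by move=> x _; rewrite -EFinM lee_fin normrM mulrC ler_wpM2r.
rewrite EFinM; apply: le_trans (lee_wpmul2l _ (iG bt)); last by rewrite lee_fin.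
rewrite -ge0_integralZl_EFin //; last exact: continuous_measurable_abs.
apply: ge0_le_integral => //.
- exact: continuous_measurable_abs.
- by apply: measurable_funeM; exact: continuous_measurable_abs.
by move=> x _; rewrite -EFinM lee_fin normrM ler_wpM2r.
Qed.

Lemma bd_cst c : bd false `|c| (fun=> c).
Proof. by split=> // x; exact: cst_continuous. Qed.

Lemma bdZ b c e H : bd b e H -> bd b (`|c| * e) (fun x => c * H x).
Proof. by move=> B; exact: (bdM (bd_cst c) B). Qed.

Lemma bdkD b k e d H G : bdk b k e H -> bdk b k d G ->
  bdk b k (e + d) (fun x => H x + G x).
Proof.
elim: k H G => [|k IH] H G; first by move=> [B _] [C _]; split=> //; exact: bdD.
move=> [B [H' [DH BH]]] [C [G' [DG CG]]].
by apply: bdkSI; [exact: D1D DH DG|exact: bdD|exact: IH].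
Qed.

Lemma bdkM b1 b2 k e d H G : bdk b1 k e H -> bdk b2 k d G ->
  bdk (b1 || b2) k (2 ^+ k * (e * d)) (fun x => H x * G x).
Proof.
elim: k H G => [|k IH] H G.
  by move=> [B _] [C _]; split=> //; rewrite expr0 mul1r; exact: bdM.
move=> BH CG; have B0 := bdk_k BH; have C0 := bdk_k CG.
have ed0 : 0 <= e * d by rewrite mulr_ge0 // ?(bdk_ge0 BH) // (bdk_ge0 CG).
move: BH CG => [B [H' [DH BH]]] [C [G' [DG CG]]].
apply: bdkSI; first exact: D1M DH DG.
  apply: bd_le (bdM B C); rewrite ler_peMl // exprn_ege1 //; lra.
by rewrite exprS -mulrA mulr_natl mulr2n; apply: bdkD; exact: IH.
Qed.

Lemma bdk_cst k c : bdk false k `|c| (fun=> c).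
Proof.
elim: k c => [|k IH] c; first by split=> //; exact: bd_cst.
apply: bdkSI; [exact: D1_cst|exact: bd_cst|].
by apply: bdk_le (IH 0); rewrite normr0.
Qed.

Lemma bdkZ b k c e H : bdk b k e H -> bdk b k (`|c| * e) (fun x => c * H x).
Proof.
elim: k H => [|k IH] H; first by move=> [B _]; split=> //; exact: bdZ.
move=> [B [H' [DH BH]]].
by apply: bdkSI; [exact: D1Z DH|exact: bdZ|exact: IH].
Qed.

Lemma bdkN b k e H : bdk b k e H -> bdk b k e (fun x => - H x).
Proof.
move=> /(bdkZ (-1)); rewrite normrN normr1 mul1r.
by under eq_fun do rewrite mulN1r.
Qed.

Lemma bdkB b k e d H G : bdk b k e H -> bdk b k d G ->
  bdk b k (e + d) (fun x => H x - G x).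
Proof. by move=> A /bdkN B; exact: bdkD. Qed.

(** [C] is common to all [F], so that the bound passes along filters. *)
Lemma bdkV k M m : 0 < m -> exists C, forall F, bdk false k M F ->
  (forall x, m <= F x) -> bdk false k C (fun x => (F x)^-1).
Proof.
move=> m0.
have B0 F : continuous F -> (forall x, m <= F x) -> bd false m^-1 (fun x => (F x)^-1).
  move=> cF mF; split=> // x.
    by apply: cvgV; [rewrite gt_eqF // (lt_le_trans m0)|exact: cF].
  have F0 : 0 < F x by apply: lt_le_trans (mF x).
  by rewrite gtr0_norm ?invr_gt0 // lef_pV2 ?posrE.
elim: k => [|k [C IH]].
  by exists m^-1 => F [[cF _ _] _] mF; split=> //; exact: B0.
exists (Num.max m^-1 (2 ^+ k * (M * (2 ^+ k * (C * C))))) => F BF mF.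
have F0 x : F x != 0 by rewrite gt_eqF // (lt_le_trans m0).
have BC := IH _ (bdk_k BF) mF.
have [_ [F' [DF BF']]] := BF.
apply: bdkSI; first exact: D1V DF.
  by apply: bd_le (B0 _ (bdk_cont BF) mF); rewrite le_max lexx.
apply: bdk_le; last exact: (bdkM (bdkN BF') (bdkM BC BC)).
by rewrite le_max lexx orbT.
Qed.

(** [W^{oo,1}] when [b] is true; smooth functions with bounded derivatives
otherwise. *)
Definition tame b (f : R -> R) := forall k, exists M, bdk b k M f.

Lemma tame_D1 b f : tame b f -> D1 f (f^`()).
Proof. by move=> /(_ 1%N)[M /bdkS_D1]. Qed.

Lemma tame_derive b f : tame b f -> tame b (f^`()).
Proof. by move=> mf k; have [M /bdkS] := mf k.+1; exists M. Qed.

Lemma tame_cont b f : tame b f -> continuous f.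
Proof. by move=> /(_ 0%N)[M /bdk_cont]. Qed.

Lemma tame_false b f : tame b f -> tame false f.
Proof. by move=> mf k; have [M /bdk_false] := mf k; exists M. Qed.

Lemma tameD b f g : tame b f -> tame b g -> tame b (fun x => f x + g x).
Proof.
by move=> F G k; have [M A] := F k; have [N B] := G k; exists (M + N); exact: bdkD.
Qed.

Lemma tameB b f g : tame b f -> tame b g -> tame b (fun x => f x - g x).
Proof.
by move=> F G k; have [M A] := F k; have [N B] := G k; exists (M + N); exact: bdkB.
Qed.

Lemma tameN b f : tame b f -> tame b (fun x => - f x).
Proof. by move=> F k; have [M A] := F k; exists M; exact: bdkN. Qed.

Lemma tameZ b c f : tame b f -> tame b (fun x => c * f x).
Proof. by move=> F k; have [M A] := F k; exists (`|c| * M); exact: bdkZ. Qed.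

Lemma tameM b1 b2 f g : tame b1 f -> tame b2 g -> tame (b1 || b2) (fun x => f x * g x).
Proof.
move=> F G k; have [M A] := F k; have [N B] := G k.
by exists (2 ^+ k * (M * N)); exact: bdkM.
Qed.

Lemma tame_cst c : tame false (fun=> c).
Proof. by move=> k; exists `|c|; exact: bdk_cst. Qed.

Lemma tameV m f : 0 < m -> (forall x, m <= f x) -> tame false f ->
  tame false (fun x => (f x)^-1).
Proof.
move=> m0 mf F k; have [M A] := F k; have [C H] := bdkV k M m0.
by exists C; exact: H.
Qed.

Lemma tame_I b f f' : D1 f f' -> (exists M, bd b M f) -> tame b f' -> tame b f.
Proof.
move=> D [M B] F [|k]; first by exists M.
have [N A] := F k; exists (Num.max M N); apply: (bdkSI D).
  by apply: bd_le B; rewrite le_max lexx.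
by apply: bdk_le A; rewrite le_max lexx orbT.
Qed.

End bd.

(** * Antiderivatives *)

Section antiderivative.
Context {R : realType}.
Notation mu := (@lebesgue_measure R).
Implicit Types (f g h F G : R -> R).

Lemma integrable_continuous f (a b : R) : continuous f ->
  mu.-integrable `[a, b] (EFin \o f).
Proof.
move=> cf; apply: continuous_compact_integrable; first exact: segment_compact.
exact: continuous_subspaceT.
Qed.

Lemma is_derive_FTC f (a x : R) : continuous f -> a < x ->
  is_derive x (1 : R) (fun y => \int[mu]_(t in `[a, y]) f t) (f x).
Proof.
move=> cf ax; have xu : x < x + 1 by rewrite ltrDl.
have [dF FE] := @continuous_FTC1_closed R f a x (x + 1) xu
  (integrable_continuous _ _ cf) ax (cf x).
by apply: DeriveDef; [exact: dF|rewrite -derive1E; exact: FE].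
Qed.

(** [int_(-1)^x f] is known to be differentiable for [x > -1] only; it is glued to
the reflection of the same construction for [f (- x)]. *)
Lemma antiderivative_exists f : continuous f -> exists F, D1 F f.
Proof.
move=> cf.
have cfN : continuous (fun x => - f (- x)).
  move=> x; apply: (@continuousN _ _ _ (fun x => f (- x))).
  by apply: (@continuous_comp _ _ _ -%R f); [exact: opp_continuous|exact: cf].
pose P (y : R) := \int[mu]_(t in `[- 1, y]) f t.
pose N (y : R) := (\int[mu]_(t in `[- 1, - y]) (- f (- t))).
have DP (x : R) : -1 < x -> is_derive x (1 : R) P (f x) by exact: is_derive_FTC.
have DN (x : R) : x < 1 -> is_derive x (1 : R) N (f x).
  move=> x1; have x1' : - 1 < - x by rewrite ltrN2.
  have D := is_derive_FTC cfN x1'.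
  apply: is_derive_eq (is_derive1_comp D (is_deriveNid x 1)) _.
  by rewrite opprK mulrN1 opprK.
have E (x : R) : -1 < x < 1 -> P x - P 0 = N x - N 0.
  move=> /andP[x1 x2].
  pose d (y : R) := P y - N y.
  have Dd (y : R) : y \in `](-1), 1[%R -> is_derive y (1 : R) d 0.
    rewrite in_itv /= => /andP[y1 y2]; have D := is_deriveB (DP y y1) (DN y y2).
    by apply: is_derive_eq D _; rewrite subrr.
  suff : d x = d 0 by rewrite /d; lra.
  suff W (a b : R) : -1 < a -> b < 1 -> a <= b -> d a = d b.
    by have /orP[] := le_total x 0 => ?; [|symmetry]; apply: W; lra.
  move=> a1 b1 ab.
  have s (c : R) : c \in `[a, b]%R -> c \in `](-1), 1[%R.
    by rewrite !in_itv /= => /andP[? ?]; apply/andP; split; lra.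
  have cd : {within `[a, b], continuous d}.
    apply: continuous_in_subspaceT => y /[!inE] /s yI.
    by apply/differentiable_continuous/derivable1_diffP; have [] := Dd y yI.
  have [c _] := MVT_segment ab (fun c cab => Dd c (s c (subset_itv_oo_cc cab))) cd.
  by rewrite mul0r => /eqP; rewrite subr_eq0 => /eqP.
pose F (x : R) := if -1 < x then P x - P 0 else N x - N 0.
exists F => x; have [x0|x0] := ltP (-1) x.
  have D := is_deriveB (DP x x0) (is_derive_cst (P 0) x 1).
  apply: (@near_eq_is_derive _ _ _ (fun x => P x - P 0)).
  - near=> y; rewrite /F; suff -> : -1 < y by [].
    by near: y; exact: lt_nbhsr.
  - by apply: is_derive_eq D _; rewrite subr0.
have x1 : x < 1 by lra.
have D := is_deriveB (DN x x1) (is_derive_cst (N 0) x 1).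
apply: (@near_eq_is_derive _ _ _ (fun x => N x - N 0)).
- near=> y; rewrite /F; case: ifPn => // y1; apply/esym/E; rewrite y1 /=.
  by near: y; exact: lt_nbhsl.
- by apply: is_derive_eq D _; rewrite subr0.
Unshelve. all: by end_near. Qed.

Lemma FTC2 f F (a b : R) : continuous f -> D1 F f -> a <= b ->
  (\int[mu]_(x in `[a, b]) (f x)%:E = (F b - F a)%:E)%E.
Proof.
move=> cf DF; rewrite le_eqVlt => /predU1P[->|ab].
  by rewrite subrr set_itv1 integral_set1.
rewrite (continuous_FTC2 (F := F) ab) //.
- exact: continuous_subspaceT.
- have cF := D1_continuous DF; split=> [x _||].
  + exact: (D1_derivable DF).
  + by apply: cvg_at_right_filter; exact: cF.
  + by apply: cvg_at_left_filter; exact: cF.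
by move=> x _; rewrite (D1E DF).
Qed.

(** This turns [L^1] bounds into bounds on increments of an antiderivative, for
which translations and changes of variables are instances of the chain rule. *)
Lemma integral_leP f F (M : R) : continuous f -> (forall x, 0 <= f x) -> D1 F f ->
  (\int[mu]_x (f x)%:E <= M%:E)%E <-> (forall a b, a <= b -> F b - F a <= M).
Proof.
move=> cf f0 DF; have mf : measurable_fun [set: R] (EFin \o f).
  by apply/measurable_EFinP; exact: continuous_measurable_fun.
split=> [H a b ab|H].
  rewrite -lee_fin -(FTC2 cf DF ab); apply: le_trans H.
  by apply: ge0_subset_integral => //; move=> x _; rewrite lee_fin.
pose A n := `[- n%:R, n%:R]%classic : set R.
have AT : \bigcup_n A n = setT.
  apply/seteqP; split=> // x _; exists (Num.bound `|x|) => //=.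
  have := archi_boundP (normr_ge0 x); rewrite ltr_norml => /andP[a1 a2].
  by rewrite /A /= in_itv /= (ltW a1) (ltW a2).
have ndA : nondecreasing_seq A.
  move=> m n mn; apply/subsetPset => x; rewrite /A /= !in_itv /= => /andP[x1 x2].
  have ? : m%:R <= n%:R :> R by rewrite ler_nat.
  by apply/andP; split; lra.
have C : (\int[mu]_(x in A i) (f x)%:E @[i --> \oo] -->
    \int[mu]_(x in \bigcup_i A i) (f x)%:E)%E.
  apply: ge0_nondecreasing_set_cvg_integral => //.
  - by move=> n; exact: measurable_itv.
  - by move=> n; exact: measurable_funTS.
  - by move=> n x _; rewrite lee_fin.
rewrite AT in C; rewrite -(cvg_lim _ C) //; apply: lime_le.
  by apply/cvg_ex; eexists; exact: C.
apply: nearW => n; have n0 : - n%:R <= n%:R :> R by have := ler0n R n; lra.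
by rewrite (FTC2 cf DF n0) lee_fin; exact: H.
Qed.

End antiderivative.

(** * Integral bounds read on antiderivatives *)

Section L1.
Context {R : realType}.
Implicit Types (f g h F G P : R -> R).

Lemma D1_nondec P p : D1 P p -> (forall x, 0 <= p x) -> forall a b, a <= b -> P a <= P b.
Proof.
move=> DP p0 a b ab; have [c [_ E]] := D1_MVT a b DP.
by rewrite -subr_ge0 E mulr_ge0 // subr_ge0.
Qed.

Lemma D1_abs_le F f P p : D1 F f -> D1 P p -> (forall x, `|f x| <= p x) ->
  forall a b, a <= b -> `|F b - F a| <= P b - P a.
Proof.
move=> DF DP fp a b ab.
have H1 : (P a - F a) <= (P b - F b).
  apply: (D1_nondec (D1B DP DF)) ab => x.
  by rewrite subr_ge0; apply: le_trans (fp x); exact: ler_norm.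
have H2 : (P a + F a) <= (P b + F b).
  apply: (D1_nondec (D1D DP DF)) ab => x.
  by have := fp x; rewrite ler_norml => /andP[]; lra.
by rewrite ler_norml; apply/andP; split; lra.
Qed.

Lemma bdk_eq b k e f g : (forall x, f x = g x) -> bdk b k e f -> bdk b k e g.
Proof. by move=> /funext ->. Qed.

Lemma continuousB_fun f g : continuous f -> continuous g ->
  continuous (fun x => f x - g x).
Proof. by move=> cf cg x; apply: cvgB; [exact: cf|exact: cg]. Qed.

Lemma continuousM_fun f g : continuous f -> continuous g ->
  continuous (fun x => f x * g x).
Proof. by move=> cf cg x; apply: cvgM; [exact: cf|exact: cg]. Qed.

Lemma continuous_abs f : continuous f -> continuous (fun x => `|f x|).
Proof. by move=> cf x; apply: cvg_norm; exact: cf. Qed.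

Lemma bd_trueP e H P : continuous H -> (forall x, `|H x| <= e) ->
  D1 P (fun x => `|H x|) ->
  (bd true e H <-> forall a b, a <= b -> P b - P a <= e).
Proof.
move=> cH sH DP; have L := integral_leP e (continuous_abs cH) (fun x => normr_ge0 _) DP.
split; first by move=> [_ _ /(_ isT)] /L.
by move=> /L I; split.
Qed.

Lemma bd_abs_antiderivative e H : bd true e H ->
  exists P, D1 P (fun x => `|H x|) /\ forall a b, a <= b -> P b - P a <= e.
Proof.
move=> B; have [cH sH _] := B.
have [P DP] := antiderivative_exists (continuous_abs cH).
by exists P; split=> //; apply/(bd_trueP cH sH DP).
Qed.

Lemma bd_dom b e H G : continuous H -> (forall x, `|H x| <= G x) -> bd b e G -> bd b e H.
Proof.
move=> cH HG [cG sG iG]; split=> // [x|/iG I].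
  by apply: le_trans (HG x) _; apply: le_trans (sG x); exact: ler_norm.
apply: le_trans I; apply: ge0_le_integral => //.
- exact: continuous_measurable_abs.
- exact: continuous_measurable_abs.
by move=> x _; rewrite lee_fin; apply: le_trans (HG x) _; exact: ler_norm.
Qed.

Lemma continuous_shift f c : continuous f -> continuous (fun x => f (x + c)).
Proof.
move=> cf x; apply: (@continuous_comp _ _ _ (fun x => x + c) f); last exact: cf.
by apply: continuousD; [exact: cvg_id|exact: cst_continuous].
Qed.

Lemma D1_shift P p c : D1 P p -> D1 (fun x => P (x + c)) (fun x => p (x + c)).
Proof.
move=> DP; apply: D1_eq (D1_comp DP (D1D D1_id (D1_cst c))) _ => x.
by rewrite addr0 mulr1.
Qed.

(** The oscillation of [G] on windows of radius [d] is dominated by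
[V x := int_(x - d)^(x + d) |G'|], whose own [L^1] norm is at most [2 d] times that of
[G'].  It bounds in [L^1] the effect of a uniformly small change of variable. *)
Lemma window b e d G g : D1 G g -> bd b e g -> 0 <= d ->
  exists V, bd b (2 * d * e) V /\
    forall x a c, `|a - x| <= d -> `|c - x| <= d -> `|G a - G c| <= V x.
Proof.
move=> DG B d0; have e0 := bd_ge0 B; have [cg sg _] := B.
have [P DP] := antiderivative_exists (continuous_abs cg).
have cP := D1_continuous DP.
have Pn : forall a b, a <= b -> P a <= P b by apply: D1_nondec DP _.
pose V x := P (x + d) - P (x + - d).
have V0 x : 0 <= V x by rewrite subr_ge0 Pn //; lra.
have cV : continuous V.
  by apply: continuousB_fun; exact: continuous_shift.
exists V; split; last first.
  move=> x a c; wlog ac : a c / a <= c.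
    move=> W; have /orP[|ca] := le_total a c; first exact: W.
    by move=> *; rewrite distrC; exact: W.
  move=> ha hc; have /andP[a1 a2] : - d <= a - x <= d by rewrite -ler_norml.
  have /andP[c1 c2] : - d <= c - x <= d by rewrite -ler_norml.
  rewrite distrC; apply: le_trans (D1_abs_le DG DP (fun x => lexx _) ac) _.
  by apply: lerB; apply: Pn; lra.
have sV x : `|V x| <= 2 * d * e.
  rewrite /V; have [c [_ ->]] := D1_MVT (x + - d) (x + d) DP.
  rewrite normrM normr_id mulrC; apply: ler_pM => //.
  by rewrite ger0_norm; lra.
case: b B => [B|_]; last by split.
have [Q DQ] := antiderivative_exists cP.
have DW := D1B (D1_shift d DQ) (D1_shift (- d) DQ).
apply/(@bd_trueP _ V (fun x => Q (x + d) - Q (x + - d))) => //.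
  by apply: D1_eq DW _ => x; rewrite ger0_norm.
move=> a b ab.
have [c1 [/andP[c1l _] E1]] := D1_MVT (b + - d) (b + d) DQ.
have [c2 [/andP[_ c2u] E2]] := D1_MVT (a + - d) (a + d) DQ.
rewrite E1 E2.
have -> : b + d - (b + - d) = 2 * d by ring.
have -> : a + d - (a + - d) = 2 * d by ring.
rewrite -mulrBl mulrC; apply: ler_wpM2l; first by lra.
have /(bd_trueP cg sg DP) Pe := B.
have [c21|/ltW c12] := leP c2 c1; first exact: Pe.
by apply: le_trans e0; rewrite subr_le0 Pn.
Qed.

End L1.

(** * Composition with the inverse of a diffeomorphism *)

Section composition.
Context {R : realType}.
Implicit Types (f g F G phi psi : R -> R).

(** [m] is a lower bound for the Jacobian, shared below by all diffeomorphisms near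
a given one. *)
Definition diffeo (m : R) (phi phi' psi : R -> R) :=
  [/\ 0 < m, D1 phi phi', forall x, m <= phi' x & forall y, phi (psi y) = y].

Lemma diffeo_expand m phi phi' psi : diffeo m phi phi' psi ->
  forall x y, m * `|x - y| <= `|phi x - phi y|.
Proof.
move=> [m0 D mphi _] x y; have [c [_ ->]] := D1_MVT y x D.
rewrite normrM; apply: ler_wpM2r => //; apply: le_trans (mphi c) _; exact: ler_norm.
Qed.

Lemma diffeoK m phi phi' psi : diffeo m phi phi' psi -> forall x, psi (phi x) = x.
Proof.
move=> H x; have [m0 _ _ K] := H; have := diffeo_expand H (psi (phi x)) x.
rewrite K subrr normr0 pmulr_rle0 // normr_le0 subr_eq0.
by move/eqP.
Qed.

Lemma diffeo_D1 m phi phi' psi : diffeo m phi phi' psi ->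
  D1 psi (fun y => (phi' (psi y))^-1).
Proof.
move=> H y; have [m0 D mphi K] := H; rewrite -{1}(K y).
apply: (@is_derive_inverse _ phi).
- by near=> x; exact: (diffeoK H).
- by near=> x; exact: (D1_continuous D).
- exact: D.
- by rewrite gt_eqF // (lt_le_trans m0).
Unshelve. all: by end_near. Qed.

Lemma continuous_fcomp f g : continuous f -> continuous g -> continuous (fun x => f (g x)).
Proof.
by move=> cf cg x; apply: (@continuous_comp _ _ _ g f); [exact: cg|exact: cf].
Qed.

(** If [Q] is an antiderivative of [|F| phi'] then [Q o psi] is one of [|F o psi|],
and [Q] grows at most [M] times as fast as an antiderivative of [|F|]. *)
Lemma bd_comp m M phi phi' psi b e F : diffeo m phi phi' psi -> continuous phi' ->
  (forall x, phi' x <= M) -> bd b e F ->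
  bd b (Num.max 1 M * e) (fun y => F (psi y)).
Proof.
move=> H cphi' phiM B; have [m0 D mphi K] := H; have e0 := bd_ge0 B.
have [cF sF _] := B; have Dpsi := diffeo_D1 H.
have cFpsi := continuous_fcomp cF (D1_continuous Dpsi).
have sFpsi x : `|F (psi x)| <= Num.max 1 M * e.
  by apply: le_trans (sF _) _; apply: ler_peMl => //; rewrite le_max lexx.
case: b B => [B|_]; last by split.
have cG : continuous (fun x => `|F x| * phi' x).
  by apply: continuousM_fun => //; exact: continuous_abs.
have [Q DQ] := antiderivative_exists cG.
have [P [DP Pe]] := bd_abs_antiderivative B.
have M0 : 0 <= M by apply: le_trans (phiM 0); apply: le_trans (mphi 0); exact: ltW.
apply/(@bd_trueP _ _ _ (fun y => Q (psi y))) => //.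
  apply: D1_eq (D1_comp DQ Dpsi) _ => y /=.
  by rewrite mulfK // gt_eqF // (lt_le_trans m0).
move=> a c ac.
have pac : psi a <= psi c.
  apply: (D1_nondec Dpsi) ac => x; rewrite invr_ge0.
  by apply: le_trans (mphi _); exact: ltW.
have DMP := D1Z M DP.
have le : Q (psi c) - Q (psi a) <= M * (P (psi c) - P (psi a)).
  rewrite mulrBr; apply: le_trans (ler_norm _) _; apply: (D1_abs_le DQ DMP) => // x.
  rewrite normrM normr_id mulrC ler_wpM2r // ger0_norm //.
  by apply: le_trans (mphi x); exact: ltW.
apply: le_trans le _; apply: ler_pM => //.
- by rewrite subr_ge0; apply: (D1_nondec DP).
- by rewrite le_max lexx orbT.
exact: Pe.
Qed.

(** Again [C] depends on bounds only, not on the diffeomorphism. *)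
Lemma bdk_comp k (m M : R) : 0 < m -> exists C, 0 <= C /\
  forall phi phi' psi, diffeo m phi phi' psi -> bdk false k M phi' ->
  forall b e F, bdk b k e F -> bdk b k (C * e) (fun y => F (psi y)).
Proof.
move=> m0; elim: k => [|k [C [C0 IH]]].
  exists (Num.max 1 M); split; first by rewrite le_max ler01.
  move=> phi phi' psi H B b e F [BF _]; split=> //; apply: (bd_comp H) BF.
    exact: (bdk_cont B).
  by move=> x; apply: le_trans (bdk_sup B x); exact: ler_norm.
have [V HV] := bdkV k M m0.
pose C1 := Num.max (Num.max 1 M) (C * (2 ^+ k * `|V|)).
exists C1; split; first by rewrite /C1 !le_max ler01.
move=> phi phi' psi H B b e F BF; have [_ D mphi K] := H.
have e0 := bdk_ge0 BF.
have [BF0 [F' [DF BF']]] := BF.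
apply: (bdkSI (H' := fun y => F' (psi y) * (phi' (psi y))^-1)).
- exact: (D1_comp DF (diffeo_D1 H)).
- apply: bd_le; last first.
    apply: (bd_comp H) BF0; first exact: (bdk_cont B).
    by move=> x; apply: le_trans (bdk_sup B x); exact: ler_norm.
  by apply: ler_wpM2r => //; rewrite /C1 le_max lexx.
have BV := HV _ (bdk_k B) mphi.
have := IH _ _ _ H (bdk_k B) _ _ _ (bdkM BF' BV); rewrite orbF.
apply: bdk_le; apply: le_trans (_ : C * (2 ^+ k * `|V|) * e <= _).
  rewrite -!mulrA; apply: ler_wpM2l => //; apply: ler_wpM2l; first by rewrite exprn_ge0.
  by rewrite mulrC; apply: ler_wpM2r => //; exact: ler_norm.
by apply: ler_wpM2r => //; rewrite /C1 le_max lexx orbT.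
Qed.

(** Seen from [phi2 x], the two arguments [psi1 (phi2 x)] and [x] are within
[d / m] of each other, so that [window] applies. *)
Lemma bd_comp_diff (m M : R) phi1 phi1' psi1 phi2 phi2' psi2 (d : R) b N F :
  diffeo m phi1 phi1' psi1 -> diffeo m phi2 phi2' psi2 -> bd false M phi2' ->
  (forall x, `|phi1 x - phi2 x| <= d) -> bdk b 1 N F ->
  bd b (Num.max 1 M * (2 / m) * N * d) (fun y => F (psi1 y) - F (psi2 y)).
Proof.
move=> H1 H2 B2 dd BF.
have [m0 _ _ K1] := H1; have [_ D2' _ K2] := H2.
have d0 : 0 <= d by apply: le_trans (dd 0).
have [BF0 [F' [DF [BF' _]]]] := BF.
have [V [BV HV]] := window DF BF' (divr_ge0 d0 (ltW m0)).
have [cF _ _] := BF0; have c1 := D1_continuous (diffeo_D1 H1).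
have [cp2 sp2 _] := B2.
pose K x := F (psi1 (phi2 x)) - F x.
have cK : continuous K.
  apply: continuousB_fun; last exact: cF.
  apply: (continuous_fcomp cF); apply: (continuous_fcomp c1).
  exact: D1_continuous D2'.
have KV x : `|K x| <= V x.
  apply: HV; last by rewrite subrr normr0 divr_ge0 // ltW.
  rewrite ler_pdivlMr // mulrC; apply: le_trans (diffeo_expand H1 _ _) _.
  by rewrite K1 distrC.
have := bd_comp H2 cp2 (fun x => le_trans (ler_norm _) (sp2 x)) (bd_dom cK KV BV).
rewrite /K; under eq_fun do rewrite K2.
by congr (bd b _ _); field; rewrite gt_eqF.
Qed.

End composition.

Section comp_taylor.
Context {R : realType}.
Implicit Types (f g F G phi psi : R -> R).

(** If [phi1 = phi + h dphi + o(h)] then [psi1 = psi - h (dphi / phi') o psi + o(h)];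
this is the corresponding expansion of [G o psi1], with its error in [bd]. *)
Lemma bd_comp_taylor (m M A N : R) phi phi' phi'' psi phi1 phi1' psi1 dphi dphi' (h eta : R) b G :
  diffeo m phi phi' psi -> diffeo m phi1 phi1' psi1 ->
  D1 phi' phi'' -> (forall x, `|phi' x| <= M) -> (forall x, `|phi'' x| <= M) ->
  D1 dphi dphi' -> (forall x, `|dphi x| <= A) -> (forall x, `|dphi' x| <= A) ->
  h != 0 -> 0 <= eta ->
  (forall x, `|(phi1 x - phi x) / h - dphi x| <= eta) ->
  bdk b 2 N G ->
  let d := (A + eta) / m in
  bd b (Num.max 1 M * ((eta + `|h| * (M * d ^+ 2 + A * d)) / m * N
        + d * (2 * (`|h| * d) * N)))
    (fun y => (G (psi1 y) - G (psi y)) / h + G^`() (psi y) * dphi (psi y) / phi' (psi y)).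
Proof.
move=> H H1 Dphi' sphi' sphi'' Ddphi sdphi sdphi' h0 eta0 Heta BG d.
have [m0 D mphi K] := H; have [_ D1' m1 K1] := H1.
have [BG0 [G' [DG [BG' [G'' [DG' [BG'' _]]]]]]] := BG.
rewrite (D1E DG).
have A0 : 0 <= A by apply: le_trans (sdphi 0).
have M0 : 0 <= M by apply: le_trans (sphi' 0).
have d0 : 0 <= d by rewrite divr_ge0 ?addr_ge0 // ltW.
have hd0 : 0 <= `|h| * d by rewrite mulr_ge0.
have [V [BV HV]] := window DG' BG'' hd0.
(* Everything is estimated at phi x, where psi becomes the identity. *)
pose chi x := psi1 (phi x).
have cchi : continuous chi.
  by apply: continuous_fcomp (D1_continuous (diffeo_D1 H1)) (D1_continuous D).
have chid x : `|chi x - x| <= `|h| * d.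
  rewrite /d mulrA ler_pdivlMr // mulrC; apply: le_trans (diffeo_expand H1 _ _) _.
  rewrite /chi K1.
  have -> : phi x - phi1 x = - h * (((phi1 x - phi x) / h - dphi x) + dphi x).
    by field.
  rewrite normrM normrN; apply: ler_wpM2l => //.
  by apply: le_trans (ler_normD _ _) _; rewrite addrC lerD.
pose th := (eta + `|h| * (M * d ^+ 2 + A * d)) / m.
have th0 : 0 <= th.
  by rewrite divr_ge0 ?(ltW m0) // addr_ge0 // mulr_ge0 // addr_ge0 // mulr_ge0 // sqr_ge0.
have phi0 x : phi' x != 0 by rewrite gt_eqF // (lt_le_trans m0).
have Hth x : `|(chi x - x) / h + dphi x / phi' x| <= th.
  rewrite /th ler_pdivlMr // mulrC.
  apply: le_trans (_ : `|phi' x * ((chi x - x) / h + dphi x / phi' x)| <= _).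
    rewrite normrM; apply: ler_wpM2r => //; apply: le_trans (mphi x) _; exact: ler_norm.
  have E : phi1 (chi x) = phi x by rewrite /chi K1.
  have -> : phi' x * ((chi x - x) / h + dphi x / phi' x) =
      - ((phi1 (chi x) - phi (chi x)) / h - dphi (chi x))
      - (phi (chi x) - phi x - phi' x * (chi x - x)) / h - (dphi (chi x) - dphi x).
    by rewrite E; field; rewrite h0 phi0.
  apply: le_trans (ler_normB _ _) _; rewrite [X in _ <= _ + X]mulrDr [X in _ <= X]addrA.
  apply: lerD; last first.
    apply: le_trans (D1_lip Ddphi sdphi' _ _) _; rewrite mulrCA.
    by apply: ler_wpM2l.
  apply: le_trans (ler_normB _ _) _; apply: lerD; first by rewrite normrN.
  rewrite normrM normfV ler_pdivrMr ?normr_gt0 //.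
  apply: le_trans (D1_taylor D Dphi' sphi'' _ _) _.
  have -> : `|h| * (M * d ^+ 2) * `|h| = M * (`|h| * d) ^+ 2 by ring.
  by apply: ler_wpM2l => //; rewrite -real_normK ?num_real // lerXn2r // nnegrE.
pose K0 x := (G (chi x) - G x) / h + G' x * dphi x / phi' x.
(* Return to the original variable by bd_comp. *)
suff BK : bd b (th * N + d * (2 * (`|h| * d) * N)) K0.
  have cphi' := D1_continuous Dphi'.
  have := bd_comp H cphi' (fun x => le_trans (ler_norm _) (sphi' x)) BK.
  by rewrite /K0 /chi; under eq_fun do rewrite K.
have cdphi := D1_continuous Ddphi; have cphi' := D1_continuous Dphi'.
have [cG _ _] := BG0; have [cG' _ _] := BG'.
pose K1' x := (chi x - x) / h + dphi x / phi' x.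
pose K2 x := (G (chi x) - G x - G' x * (chi x - x)) / h.
have cK1 : continuous K1'.
  move=> x; apply: cvgD.
    by apply: cvgM; [apply: cvgB; [exact: cchi|exact: cvg_id]|exact: cvg_cst].
  by apply: cvgM; [exact: cdphi|apply: cvgV => //; exact: cphi'].
have cK2 : continuous K2.
  move=> x; apply: cvgM; last exact: cvg_cst.
  apply: cvgB; first by apply: cvgB; [exact: (continuous_fcomp cG cchi)|exact: cG].
  by apply: cvgM; [exact: cG'|apply: cvgB; [exact: cchi|exact: cvg_id]].
(* K1' is the error on the displacement, K2 the Taylor remainder of G. *)
have -> : K0 = (fun x => K1' x * G' x + K2 x).
  by apply/funext => x; rewrite /K0 /K1' /K2; field; rewrite h0 phi0.
apply: bdD; first by apply: (bdM (b1 := false)) BG'; split.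
have BdV := bdM (bd_cst d) BV; rewrite ger0_norm // in BdV.
apply: bd_dom BdV => // x.
rewrite /K2 normrM normfV ler_pdivrMr ?normr_gt0 //.
have [c [cI E]] := D1_MVT x (chi x) DG.
rewrite E -mulrBl normrM; have -> : d * V x * `|h| = V x * (`|h| * d) by ring.
apply: ler_pM => //.
apply: HV; last by rewrite subrr normr0.
apply: le_trans (chid x); move: cI; rewrite ge_min le_max => /andP[].
by case/orP => a1 /orP[] a2; rewrite ler_norml; apply/andP; split;
  have := ler_norm (chi x - x); have := ler_norm (x - chi x);
  rewrite [`|x - _|]distrC; lra.
Qed.

End comp_taylor.

(** * Limits and difference quotients in all norms *)

Section limits.
Context {R : realType} {T : Type} (FT : set_system T) {FF : Filter FT}.
Implicit Types (b : bool).

Definition small b k (H : T -> R -> R) := forall e : R, 0 < e -> \forall p \near FT, bdk b k e (H p).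

(** For [b = true], convergence in the topology of [W^{oo,1}]. *)
Definition cvgto b (X : T -> R -> R) (X0 : R -> R) := forall k, small b k (fun p x => X p x - X0 x).

Lemma bdk_eq0 b k (e : R) f : 0 <= e -> (forall x, f x = 0) -> bdk b k e f.
Proof.
move=> e0 /funext -> {f}.
have B : bd b e (fun=> 0).
  split=> [x|x|_]; [exact: cst_continuous|by rewrite normr0|].
  by under eq_integral do rewrite normr0; rewrite integral0 lee_fin.
by elim: k => [|k IH]; [split|exact: bdkSI (D1_cst 0) B IH].
Qed.

Lemma small_eq b k H G : (\forall p \near FT, forall x, H p x = G p x) ->
  small b k H -> small b k G.
Proof.
move=> E S e e0; apply: filterS2 E (S e e0) => p E.
by have -> : G p = H p by apply/funext => x; rewrite E.
Qed.

Lemma small_ext b k H G : (forall p x, H p x = G p x) -> small b k H -> small b k G.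
Proof. by move=> E; apply: small_eq; apply: nearW. Qed.

Lemma small_false b k H : small b k H -> small false k H.
Proof. by move=> S e /S; apply: filterS => p /bdk_false. Qed.

Lemma smallD b k H G : small b k H -> small b k G -> small b k (fun p x => H p x + G p x).
Proof.
move=> SH SG e e0; have e2 : 0 < e / 2 by rewrite divr_gt0.
apply: filterS2 (SH _ e2) (SG _ e2) => p A B.
by rewrite [e]splitr; exact: bdkD.
Qed.

Lemma smallN b k H : small b k H -> small b k (fun p x => - H p x).
Proof. by move=> S e /S; apply: filterS => p; exact: bdkN. Qed.

Lemma small_bdM b1 b2 k (M : R) H G : (\forall p \near FT, bdk b1 k M (H p)) ->
  small b2 k G -> small (b1 || b2) k (fun p x => H p x * G p x).
Proof.
move=> BH SG e e0; pose c := 2 ^+ k * (`|M| + 1).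
have c0 : 0 < c by rewrite mulr_gt0 ?exprn_gt0 // ltr_wpDl.
have ec : 0 < e / c by rewrite divr_gt0.
apply: filterS2 BH (SG _ ec) => p A B.
apply: bdk_le (bdkM A B); apply: le_trans (_ : c * (e / c) <= _); last first.
  by rewrite mulrC divfK // gt_eqF.
rewrite mulrA; apply: ler_wpM2r; first exact: ltW.
apply: ler_wpM2l; first by rewrite exprn_ge0.
by apply: le_trans (ler_norm M) _; rewrite lerDl.
Qed.

Lemma smallM b1 b2 k H G : small b1 k H -> small b2 k G ->
  small (b1 || b2) k (fun p x => H p x * G p x).
Proof. by move=> SH; apply: (small_bdM (M := 1)); exact: SH. Qed.

Lemma small_tameM b1 b2 k X0 G : tame b1 X0 -> small b2 k G ->
  small (b1 || b2) k (fun p x => X0 x * G p x).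
Proof. by move=> /(_ k)[M B]; apply: (small_bdM (M := M)); apply: nearW. Qed.

Lemma small_scal b k (c : T -> R) (M : R) H : (forall e : R, 0 < e -> \forall p \near FT, `|c p| <= e) ->
  (\forall p \near FT, bdk b k M (H p)) -> small b k (fun p x => c p * H p x).
Proof.
move=> c0 BH e e0; have M1 : 0 < `|M| + 1 by rewrite ltr_wpDl.
have ec : 0 < e / (`|M| + 1) by rewrite divr_gt0.
apply: filterS2 BH (c0 _ ec) => p A B.
apply: bdk_le (bdkZ (c p) A); apply: le_trans (_ : e / (`|M| + 1) * (`|M| + 1) <= _).
  apply: ler_pM => //; first exact: bdk_ge0 A.
  by apply: le_trans (ler_norm M) _; rewrite lerDl.
by rewrite mulfVK // gt_eqF.
Qed.

Lemma small0 b k : small b k (fun _ _ => 0).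
Proof. by move=> e e0; apply: nearW => p; apply: bdk_eq0 => //; exact: ltW. Qed.

Lemma small_derive b k H : small b k.+1 H -> small b k (fun p => (H p)^`()).
Proof. by move=> S e /S; apply: filterS => p /bdkS. Qed.

Lemma cvgto_eq b X Y X0 : (\forall p \near FT, forall x, X p x = Y p x) ->
  cvgto b X X0 -> cvgto b Y X0.
Proof.
move=> E C k; apply: small_eq (C k); apply: filterS E => p E x; by rewrite E.
Qed.

Lemma cvgto_ext b X Y X0 Y0 : cvgto b X X0 -> (forall p x, X p x = Y p x) ->
  (forall x, X0 x = Y0 x) -> cvgto b Y Y0.
Proof. by move=> C E E0 k; apply: small_ext (C k) => p x; rewrite E E0. Qed.

Lemma cvgto_false b X X0 : cvgto b X X0 -> cvgto false X X0.
Proof. by move=> C k; exact: small_false (C k). Qed.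

Lemma cvgto_cst b X0 : cvgto b (fun=> X0) X0.
Proof. by move=> k; apply: small_ext (small0 b k) => p x; rewrite subrr. Qed.

Lemma cvgtoD b X Y X0 Y0 : cvgto b X X0 -> cvgto b Y Y0 ->
  cvgto b (fun p x => X p x + Y p x) (fun x => X0 x + Y0 x).
Proof. by move=> A B k; apply: small_ext (smallD (A k) (B k)) => p x; ring. Qed.

Lemma cvgtoN b X X0 : cvgto b X X0 -> cvgto b (fun p x => - X p x) (fun x => - X0 x).
Proof. by move=> A k; apply: small_ext (smallN (A k)) => p x; ring. Qed.

Lemma cvgtoB b X Y X0 Y0 : cvgto b X X0 -> cvgto b Y Y0 ->
  cvgto b (fun p x => X p x - Y p x) (fun x => X0 x - Y0 x).
Proof. by move=> A /cvgtoN; exact: cvgtoD. Qed.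

Lemma cvgtoM b1 b2 X Y X0 Y0 : tame b1 X0 -> tame b2 Y0 ->
  cvgto b1 X X0 -> cvgto b2 Y Y0 ->
  cvgto (b1 || b2) (fun p x => X p x * Y p x) (fun x => X0 x * Y0 x).
Proof.
move=> mX mY CX CY k.
have S1 := smallM (CX k) (CY k).
have S2 := small_tameM mX (CY k).
have S3 := small_tameM mY (CX k); rewrite orbC in S3.
by apply: small_ext (smallD (smallD S1 S2) S3) => p x; ring.
Qed.

Lemma cvgtoZ b (c : R) X X0 : cvgto b X X0 ->
  cvgto b (fun p x => c * X p x) (fun x => c * X0 x).
Proof.
move=> A k; apply: small_ext (small_tameM (tame_cst c) (A k)) => p x; ring.
Qed.

Lemma cvgto_derive b b' X X0 : tame b' X0 -> cvgto b X X0 ->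
  cvgto b (fun p => (X p)^`()) (X0^`()).
Proof.
move=> mX C k; apply: small_eq (small_derive (C k.+1)).
apply: filterS (C 1%N 1 ltr01) => p B x.
have DX : D1 (X p) (fun x => (fun x => X p x - X0 x)^`() x + X0^`() x).
  have := D1D (bdkS_D1 B) (tame_D1 mX).
  by congr (D1 _ _); apply/funext => y; rewrite subrK.
by rewrite (D1E DX) addrK.
Qed.

Lemma cvgto_ge (m : R) X X0 : (forall x, m <= X0 x) -> 0 < m -> cvgto false X X0 ->
  \forall p \near FT, forall x, m / 2 <= X p x.
Proof.
move=> mX m0 C; have m2 : 0 < m / 2 by rewrite divr_gt0.
apply: filterS (C 0%N _ m2) => p /bdk_sup B x.
by have := B x; have := mX x; rewrite ler_norml => ? /andP[? ?]; lra.
Qed.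

Lemma cvgto_bd b k X X0 : tame b X0 -> cvgto b X X0 ->
  exists M, \forall p \near FT, bdk b k M (X p).
Proof.
move=> /(_ k)[M B] C; exists (1 + M); apply: filterS (C k 1 ltr01) => p A.
by have := bdkD A B; under eq_fun do rewrite subrK.
Qed.

Lemma cvgtoV (m : R) X X0 : 0 < m -> (forall x, m <= X0 x) -> tame false X0 ->
  cvgto false X X0 -> cvgto false (fun p x => (X p x)^-1) (fun x => (X0 x)^-1).
Proof.
move=> m0 mX memX C k; have m2 : 0 < m / 2 by rewrite divr_gt0.
have [M HM] := cvgto_bd k memX C; have [N HN] := bdkV k M m2.
have ge := cvgto_ge mX m0 C.
have B : \forall p \near FT, bdk false k N (fun x => (X p x)^-1).
  by apply: filterS2 HM ge => p; exact: HN.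
have S := smallN (small_bdM B (small_tameM (tameV m0 mX memX) (C k))).
apply: small_eq S; apply: filterS ge => p ge x /=.
have X1 : X p x != 0 by rewrite gt_eqF // (lt_le_trans m2).
have X2 : X0 x != 0 by rewrite gt_eqF // (lt_le_trans m0).
by field; rewrite X1 X2.
Qed.

Section dif.
Variable h : T -> R.
Hypothesis hn0 : \forall p \near FT, h p != 0.
Hypothesis h0 : forall e : R, 0 < e -> \forall p \near FT, `|h p| <= e.

(** Kept abstract in the filter and in the increment [h], so that the rules below do
not depend on the time interval or on one-sidedness. *)
Definition dif b (X : T -> R -> R) (X0 X' : R -> R) := cvgto b (fun p x => (X p x - X0 x) / h p) X'.

Lemma dif_cvgto b X X0 X' : tame b X' -> dif b X X0 X' -> cvgto b X X0.
Proof.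
move=> mX D k; have [M B] := cvgto_bd k mX D.
apply: small_eq (small_scal h0 B).
by apply: filterS hn0 => p hp x; rewrite mulrC divfK.
Qed.

Lemma difM b1 b2 X Y X0 Y0 X' Y' : tame b1 X0 -> tame b2 Y0 -> tame b1 X' -> tame b2 Y' ->
  dif b1 X X0 X' -> dif b2 Y Y0 Y' ->
  dif (b1 || b2) (fun p x => X p x * Y p x) (fun x => X0 x * Y0 x)
    (fun x => X' x * Y0 x + X0 x * Y' x).
Proof.
move=> mX mY mX' mY' dX dY.
have C1 := cvgtoM mX' mY dX (dif_cvgto mY' dY).
have C2 := cvgtoM mX mY' (cvgto_cst b1 X0) dY.
by apply: cvgto_ext (cvgtoD C1 C2) _ _ => // p x; ring.
Qed.

Lemma difV (m : R) X X0 X' : 0 < m -> (forall x, m <= X0 x) -> tame false X0 ->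
  tame false X' -> dif false X X0 X' ->
  dif false (fun p x => (X p x)^-1) (fun x => (X0 x)^-1)
    (fun x => - (X' x * ((X0 x)^-1 * (X0 x)^-1))).
Proof.
move=> m0 mX memX memX' dX; have C := dif_cvgto memX' dX.
have mV := tameV m0 mX memX.
have CV := cvgtoV m0 mX memX C.
have := cvgtoN (cvgtoM memX' (tameM mV mV) dX (cvgtoM mV mV CV (cvgto_cst false _))).
apply: cvgto_eq; have m2 : 0 < m / 2 by rewrite divr_gt0.
apply: filterS2 hn0 (cvgto_ge mX m0 C) => p hp ge x.
have X1 : X p x != 0 by rewrite gt_eqF // (lt_le_trans m2).
have X2 : X0 x != 0 by rewrite gt_eqF // (lt_le_trans m0).
by field; rewrite X1 X2 hp.
Qed.

Lemma difB b X Y X0 Y0 X' Y' : dif b X X0 X' -> dif b Y Y0 Y' ->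
  dif b (fun p x => X p x - Y p x) (fun x => X0 x - Y0 x) (fun x => X' x - Y' x).
Proof. by move=> A B; apply: cvgto_ext (cvgtoB A B) _ _ => // p x; ring. Qed.

Lemma difZ b (c : R) X X0 X' : dif b X X0 X' ->
  dif b (fun p x => c * X p x) (fun x => c * X0 x) (fun x => c * X' x).
Proof. by move=> A; apply: cvgto_ext (cvgtoZ c A) _ _ => // p x; ring. Qed.

Lemma dif_derive b b' b'' X X0 X' : tame b' X0 -> tame b'' X' -> cvgto b X X0 -> dif b X X0 X' ->
  dif b (fun p => (X p)^`()) (X0^`()) (X'^`()).
Proof.
move=> mX mX' C D.
have E := cvgto_derive mX' D; apply: cvgto_eq E.
apply: filterS (C 1%N 1 ltr01) => p B x.
have DX : D1 (X p) (fun x => (fun x => X p x - X0 x)^`() x + X0^`() x).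
  have := D1D (bdkS_D1 B) (tame_D1 mX).
  by congr (D1 _ _); apply/funext => y; rewrite subrK.
have DQ := D1Z (h p)^-1 (D1B DX (tame_D1 mX)).
have -> : (fun x => (X p x - X0 x) / h p) = (fun x => (h p)^-1 * (X p x - X0 x)).
  by apply/funext => y; rewrite mulrC.
by rewrite (D1E DQ) (D1E DX); ring.
Qed.

End dif.
End limits.

(** * Derivatives of compositions with moving inverses *)

Lemma mul_divr_le (R : realType) (C e : R) : 0 <= C -> 0 <= e -> C * (e / (C + 1)) <= e.
Proof.
move=> C0 e0; have C1 : 0 < C + 1 by apply: (le_lt_trans C0); rewrite ltrDl.
by rewrite mulrA ler_pdivrMr // mulrC; apply: ler_wpM2l => //; rewrite lerDl.
Qed.

Section comp_limits.
Context {R : realType} {T : Type} (FT : set_system T) {FF : Filter FT}.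
Variables (m : R) (phi phi' psi : T -> R -> R) (phi0 phi0' psi0 : R -> R).
Hypothesis Hd : \forall p \near FT, diffeo m (phi p) (phi' p) (psi p).
Hypothesis Hd0 : diffeo m phi0 phi0' psi0.
Hypothesis memphi : tame false phi0'.
Hypothesis C0 : forall e : R, 0 < e -> \forall p \near FT, forall x, `|phi p x - phi0 x| <= e.
Hypothesis C1 : cvgto FT false phi' phi0'.

Let m0 : 0 < m. Proof. by have [] := Hd0. Qed.
Let mphi0 x : m <= phi0' x. Proof. by have [] := Hd0. Qed.
Let phi0n x : phi0' x != 0. Proof. by rewrite gt_eqF // (lt_le_trans m0). Qed.

Let bd_phi k : exists M, bdk false k M phi0' /\ \forall p \near FT, bdk false k M (phi' p).
Proof.
have [M B] := memphi k; have [M' B'] := cvgto_bd k memphi C1.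
exists (Num.max M M'); split; first by apply: bdk_le B; rewrite le_max lexx.
by apply: filterS B' => p; apply: bdk_le; rewrite le_max lexx orbT.
Qed.

Lemma small_compl b k H : small FT b k H -> small FT b k (fun p y => H p (psi p y)).
Proof.
move=> S e e0; have [M [_ Bp]] := bd_phi k.
have [C [C_0 HC]] := bdk_comp k M m0.
have d0 : 0 < e / (C + 1) by rewrite divr_gt0 // ltr_wpDl.
apply: filterS3 Hd Bp (S _ d0) => p Hp Bpp B.
by apply: bdk_le (HC _ _ _ Hp Bpp _ _ _ B); apply: mul_divr_le => //; exact: ltW.
Qed.

(** By induction on the order, as [(G o psi)' = (G' / phi') o psi]: the difference of
the derivatives is controlled by [1 / phi' p - 1 / phi0'] and by the statement for
[G' / phi0'], so that only order [0] needs an estimate. *)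
Lemma small_comp b k G : tame b G -> small FT b k (fun p y => G (psi p y) - G (psi0 y)).
Proof.
have base b' G' : tame b' G' -> forall e : R, 0 < e -> \forall p \near FT,
    bd b' e (fun y => G' (psi p y) - G' (psi0 y)).
  move=> mG e e0; have [M /bdk0 B0] := memphi 0%N; have [N BN] := mG 1%N.
  pose K := Num.max 1 M * (2 / m) * N.
  have K0 : 0 <= K.
    by rewrite !mulr_ge0 ?(bdk_ge0 BN) ?invr_ge0 ?(ltW m0) // le_max ler01.
  have d0 : 0 < e / (K + 1) by rewrite divr_gt0 // ltr_wpDl.
  apply: filterS2 Hd (C0 d0) => p Hp dp.
  by apply: bd_le (bd_comp_diff Hp Hd0 B0 dp BN); apply: mul_divr_le => //; exact: ltW.
elim: k G => [|k IH] G mG e e0; first by apply: filterS (base _ _ mG e e0) => p.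
have mG' := tame_derive mG; have mV := tameV m0 mphi0 memphi.
pose Y x := G^`() x * (phi0' x)^-1.
have mY : tame b Y by have := tameM mG' mV; rewrite /= orbF.
have S1 : small FT b k (fun p x => G^`() x * ((phi' p x)^-1 - (phi0' x)^-1)).
  by have := small_tameM mG' (cvgtoV m0 mphi0 memphi C1 k); rewrite orbF; apply.
pose proof (smallD (small_compl S1) (IH Y mY)) as S.
apply: filterS3 Hd (base _ _ mG e e0) (S e e0) => p Hp B0 B1.
have DG := tame_D1 mG.
apply: (bdkSI (D1B (D1_comp DG (diffeo_D1 Hp)) (D1_comp DG (diffeo_D1 Hd0))) B0).
by apply: bdk_eq B1 => y; rewrite /Y; ring.
Qed.

Lemma cvgto_comp b X X0 : tame b X0 -> cvgto FT b X X0 ->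
  cvgto FT b (fun p y => X p (psi p y)) (fun y => X0 (psi0 y)).
Proof.
move=> mX CX k; pose proof (smallD (small_compl (CX k)) (small_comp k mX)) as S.
by apply: small_ext S => p y; rewrite addrA subrK.
Qed.

Variable h : T -> R.
Hypothesis hn0 : \forall p \near FT, h p != 0.
Hypothesis h0 : forall e : R, 0 < e -> \forall p \near FT, `|h p| <= e.
Variables (dphi dphi' : R -> R).
Hypothesis Ddphi : D1 dphi dphi'.
Hypothesis memdphi : tame false dphi.
Hypothesis dif0 : forall e : R, 0 < e ->
  \forall p \near FT, forall x, `|(phi p x - phi0 x) / h p - dphi x| <= e.
Hypothesis dif1 : dif FT h false phi' phi0' dphi'.

Let memdphi' : tame false dphi'.
Proof. by rewrite -(D1E Ddphi); exact: tame_derive memdphi. Qed.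
Let memV0 : tame false (fun x => (phi0' x)^-1).
Proof. exact: tameV m0 mphi0 memphi. Qed.

(** The derivative of [s |-> G o psi s] is [- (G' dphi / phi') o psi].  Induction on the
order, as for [small_comp]: the derivative of the error is the error for
[G' / phi0'] plus the difference quotient of [G' / phi' p]. *)
Lemma small_comp_dif k b G : tame b G ->
  small FT b k (fun p y => (G (psi p y) - G (psi0 y)) / h p
     + G^`() (psi0 y) * dphi (psi0 y) / phi0' (psi0 y)).
Proof.
have base b' G' : tame b' G' -> forall e : R, 0 < e -> \forall p \near FT,
    bd b' e (fun y => (G' (psi p y) - G' (psi0 y)) / h p
     + G'^`() (psi0 y) * dphi (psi0 y) / phi0' (psi0 y)).
  move=> mG e e0.
  have [M0 B0] := memphi 1; have [M1 B1] := memdphi 1; have [N BN] := mG 2%N.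
  have N0 := bdk_ge0 BN.
  pose M := M0; pose A := M1; pose D := (A + 1) / m.
  have A0 := bdk_ge0 B1; have M00 := bdk_ge0 B0.
  have D0 : 0 <= D by rewrite divr_ge0 ?addr_ge0 // ltW.
  (* The error of bd_comp_taylor is at most K eta once |h| <= eta <= 1. *)
  pose K := Num.max 1 M * N * ((1 + (M * D ^+ 2 + A * D)) / m + 2 * D ^+ 2).
  have K0 : 0 <= K.
    rewrite /K; apply: mulr_ge0; first by apply: mulr_ge0 => //; rewrite le_max ler01.
    apply: addr_ge0; last by rewrite mulr_ge0 ?sqr_ge0.
    apply: divr_ge0; last exact: ltW.
    by rewrite addr_ge0 // addr_ge0 // mulr_ge0 // sqr_ge0.
  have K1 : 0 < K + 1 by apply: (le_lt_trans K0); rewrite ltrDl.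
  pose eta := Num.min 1 (e / (K + 1)).
  have eta0 : 0 < eta by rewrite lt_min ltr01 divr_gt0.
  have eta1 : eta <= 1 by rewrite ge_min lexx.
  near=> p.
  have Hp : diffeo m (phi p) (phi' p) (psi p) by near: p.
  have hp : h p != 0 by near: p.
  have he : `|h p| <= eta by near: p; exact: h0.
  have de : forall x, `|(phi p x - phi0 x) / h p - dphi x| <= eta by near: p; exact: dif0.
  have := bd_comp_taylor Hd0 Hp (bdkS_D1 B0) (bdk_sup B0) (bdk_sup (bdkS B0)) Ddphi
    (bdk_sup B1) _ hp (ltW eta0) de BN.
  have Bd' : forall x, `|dphi' x| <= M1.
    by move=> x; have := bdk_sup (bdkS B1) x; rewrite (D1E Ddphi).
  move=> /(_ Bd'); apply: bd_le.
  apply: (@le_trans _ _ (K * eta)); last first.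
    apply: (@le_trans _ _ (K * (e / (K + 1)))).
      by apply: ler_wpM2l => //; rewrite ge_min lexx orbT.
    by apply: mul_divr_le => //; exact: ltW.
  rewrite -/A -/M; set d := (A + eta) / m.
  have d0 : 0 <= d by rewrite divr_ge0 ?(ltW m0) // addr_ge0 // ltW.
  have dD : d <= D by rewrite ler_pM2r ?invr_gt0 // lerD2l.
  have d2 : d ^+ 2 <= D ^+ 2 by rewrite lerXn2r // nnegrE.
  have hp0 := normr_ge0 (h p).
  have -> : K * eta = Num.max 1 M * (N * ((1 + (M * D ^+ 2 + A * D)) / m + 2 * D ^+ 2) * eta) by rewrite /K !mulrA.
  apply: ler_wpM2l; first by rewrite le_max ler01.
  have E1 : (eta + `|h p| * (M * d ^+ 2 + A * d)) <= (1 + (M * D ^+ 2 + A * D)) * eta.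
    rewrite mulrDl mul1r lerD2l mulrC; apply: ler_pM => //.
      by rewrite addr_ge0 // mulr_ge0 // sqr_ge0.
    by apply: lerD; apply: ler_wpM2l.
  have E2 : d * (`|h p| * d) <= D ^+ 2 * eta.
    have -> : d * (`|h p| * d) = d ^+ 2 * `|h p| by ring.
    by apply: ler_pM => //; rewrite sqr_ge0.
  apply: (@le_trans _ _ (N * (((1 + (M * D ^+ 2 + A * D)) * eta) / m + 2 * (D ^+ 2 * eta)))).
    have -> : (eta + `|h p| * (M * d ^+ 2 + A * d)) / m * N + d * (2 * (`|h p| * d) * N) =
      N * ((eta + `|h p| * (M * d ^+ 2 + A * d)) / m + 2 * (d * (`|h p| * d))) by ring.
    apply: ler_wpM2l => //; apply: lerD; last by apply: ler_wpM2l.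
    by apply: ler_wpM2r => //; rewrite invr_ge0 ltW.
  by rewrite le_eqVlt; apply/orP; left; apply/eqP; ring.
elim: k G => [|k IH] G mG e e0.
  by apply: filterS (base _ _ mG e e0) => p.
have mG' := tame_derive mG.
pose G1 x := G^`() x * (phi0' x)^-1.
have mG1 : tame b G1 by have := tameM mG' memV0; rewrite /= orbF.
have S1 := IH _ mG1.
pose Xp p x := (G^`() x * (phi' p x)^-1 - G1 x) / h p.
pose X0 x := G^`() x * - (dphi' x * ((phi0' x)^-1 * (phi0' x)^-1)).
have mX0 : tame b X0.
  by have := tameM mG' (tameN (tameM memdphi' (tameM memV0 memV0))); rewrite /= orbF.
have CX : cvgto FT b Xp X0.
  have := cvgtoM mG' (tameN (tameM memdphi' (tameM memV0 memV0))) (cvgto_cst b (G^`()))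
    (difV hn0 h0 m0 mphi0 memphi memdphi' dif1).
  rewrite /= orbF => /(_ FF FF FF) C; apply: (cvgto_ext C) => [p x|//]; rewrite /Xp /G1; ring.
have S2 := cvgto_comp mX0 CX k.
near=> p.
have Hp : diffeo m (phi p) (phi' p) (psi p) by near: p.
have hp : h p != 0 by near: p.
have DG := tame_D1 mG.
have DG1 := tame_D1 mG1; have DG' := tame_D1 mG'.
have Dpsi := diffeo_D1 Hp; have Dpsi0 := diffeo_D1 Hd0.
have E : D1 (fun y => (G (psi p y) - G (psi0 y)) / h p + G^`() (psi0 y) * dphi (psi0 y) / phi0' (psi0 y))
   (fun y => ((G1 (psi p y) - G1 (psi0 y)) / h p + G1^`() (psi0 y) * dphi (psi0 y) / phi0' (psi0 y))
     + (Xp p (psi p y) - X0 (psi0 y))).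
  have A := D1Z (h p)^-1 (D1B (D1_comp DG Dpsi) (D1_comp DG Dpsi0)).
  have B := D1_comp (D1M DG1 Ddphi) Dpsi0.
  have -> : (fun y => (G (psi p y) - G (psi0 y)) / h p + G^`() (psi0 y) * dphi (psi0 y) / phi0' (psi0 y)) =
    (fun y => (h p)^-1 * (G (psi p y) - G (psi0 y)) + G1 (psi0 y) * dphi (psi0 y)).
    by apply/funext => y; rewrite /G1; ring.
  apply: D1_eq (D1D A B) _ => y; rewrite /Xp /X0 /G1.
  have [_ _ mp _] := Hp.
  have n1 : phi' p (psi p y) != 0 by rewrite gt_eqF // (lt_le_trans m0).
  by field; rewrite ?hp ?n1 !phi0n ?hp ?n1.
apply: (bdkSI E); first by near: p; exact: base.
rewrite [e]splitr; apply: bdkD; near: p; [apply: S1|apply: S2]; by rewrite divr_gt0.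
Unshelve. all: by end_near. Qed.

(** The derivative of [X(s) o phi(s)^-1] is the sum of those obtained by freezing
either factor. *)
Lemma dif_comp b X X0 X' : tame b X0 -> tame b X' -> dif FT h b X X0 X' ->
  dif FT h b (fun p y => X p (psi p y)) (fun y => X0 (psi0 y))
    (fun y => X' (psi0 y) - X0^`() (psi0 y) * dphi (psi0 y) / phi0' (psi0 y)).
Proof.
move=> mX mX' dX k.
have A := cvgto_comp mX' dX k; have B := small_comp_dif k mX.
by apply: small_ext (smallD A B) => p y; ring.
Qed.

End comp_limits.

(** * Weak derivatives *)

Section weak.
Context {R : realType}.
Notation mu := (@lebesgue_measure R).
Implicit Types (f g h F G psi : R -> R).

Lemma continuous_eqf f g : (forall x, f x = g x) -> continuous f -> continuous g.
Proof. by move=> /funext ->. Qed.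

Lemma measurable_continuous_EFin (D : set R) f : continuous f -> measurable D ->
  measurable_fun D (EFin \o f).
Proof.
by move=> cf mD; apply/measurable_EFinP; apply: measurable_funTS; exact: continuous_measurable_fun.
Qed.

Lemma Rintegral_support f (D : set R) : measurable D -> (forall x, ~ D x -> f x = 0) ->
  Rintegral mu setT f = Rintegral mu D f.
Proof.
move=> mD f0; rewrite [RHS]Rintegral_mkcond; congr Rintegral.
by apply/funext => x; rewrite patchE; case: ifPn => // /negP; rewrite inE => /f0.
Qed.

Lemma Rintegral_by_parts f f' psi : D1 f f' -> continuous f' -> test_function psi ->
  Rintegral mu setT (fun x => f x * psi^`() x) = - Rintegral mu setT (fun x => f' x * psi x).
Proof.
move=> Df cf' [dpsi cpsi' [M HM]].
have Dpsi := derivable_D1 dpsi; have cpsi := D1_continuous Dpsi.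
have cf := D1_continuous Df.
pose N := `|M| + 1.
have N0 : 0 < N by rewrite ltr_wpDl.
have MN x : ~ `[- N, N]%classic x -> M < `|x|.
  rewrite /= in_itv /= -ler_norml => /negP; rewrite -ltNge; apply: le_lt_trans.
  by apply: le_trans (ler_norm M) _; rewrite lerDl.
have psi0 x : M < `|x| -> psi^`() x = 0.
  move=> Mx; have D : is_derive x (1 : R) psi 0.
    have D0 : is_derive x (1 : R) (fun _ : R => 0 : R) 0 := is_derive_cst 0 x 1.
    apply: near_eq_is_derive D0.
    near=> y; rewrite HM //; near: y.
    have := @continuous_abs R id (fun x => cvg_id) x.
    by move/cvgrPdist_lt => /(_ (`|x| - M)); rewrite subr_gt0 => /(_ Mx);
      apply: filterS => y; rewrite ltr_distl => /andP[]; rewrite /=; lra.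
  by rewrite derive1E; have [_ ->] := D.
rewrite (@Rintegral_support _ `[- N, N]) //; last first.
  by move=> x /MN Mx; rewrite psi0 // mulr0.
rewrite [in RHS](@Rintegral_support _ `[- N, N]) //; last first.
  by move=> x /MN Mx; rewrite HM // mulr0.
have NN : - N <= N by lra.
have i1 : mu.-integrable `[- N, N] (EFin \o (fun x => f x * psi^`() x)).
  by apply: integrable_continuous; exact: continuousM_fun.
have i2 : mu.-integrable `[- N, N] (EFin \o (fun x => f' x * psi x)).
  by apply: integrable_continuous; exact: continuousM_fun.
apply/eqP; rewrite -addr_eq0 addrC -RintegralD //; apply/eqP.
have cc : continuous (fun x => f' x * psi x + f x * psi^`() x).
  by move=> x; apply: cvgD; [exact: (continuousM_fun cf' cpsi)|exact: (continuousM_fun cf cpsi')].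
rewrite /Rintegral (FTC2 cc (D1M Df Dpsi) NN) /=.
rewrite (HM (- N)) ?(HM N) ?normrN ?mulr0 ?subrr //; rewrite gtr0_norm //.
  by apply: le_lt_trans (ler_norm M) _; rewrite ltrDl.
by apply: le_lt_trans (ler_norm M) _; rewrite ltrDl.
Unshelve. all: by end_near. Qed.

(** The antiderivative of [y + |y|] that vanishes for [y <= 0], composed with a
parabola which is positive on [(a, b)]. *)
Lemma bump_exists (a b : R) : exists z z' : R -> R,
  [/\ D1 z z', continuous z', forall x, 0 <= z x,
    forall x, x \in `]a, b[%R -> 0 < z x & forall x, x \notin `]a, b[%R -> a < b -> z x = 0].
Proof.
pose q (y : R) := y + `|y|.
have cq : continuous q.
  by move=> x; apply: cvgD; [exact: cvg_id|apply: cvg_norm; exact: cvg_id].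
have qn y : y <= 0 -> q y = 0 by move=> y0; rewrite /q ler0_norm // subrr.
have qp y : 0 < y -> 0 < q y by move=> y0; rewrite /q gtr0_norm // addr_gt0.
have q0 y : 0 <= q y by have [/qn ->//|/qp/ltW//] := leP y 0.
have [Z0 DZ0] := antiderivative_exists cq.
pose Z y := Z0 y - Z0 0.
have DZ : D1 Z q by apply: D1_eq (D1B DZ0 (D1_cst (Z0 0))) _ => x; rewrite subr0.
have Z0E : Z 0 = 0 by rewrite /Z subrr.
have Zn y : y <= 0 -> Z y = 0.
  move=> y0; have [c [/andP[_ +] E]] := D1_MVT 0 y DZ.
  by rewrite (max_idPl y0) => c0; move: E; rewrite Z0E (qn _ c0) mul0r subr0.
have Zmon : forall x y, x <= y -> Z x <= Z y.
  by apply: D1_nondec DZ _ => x; exact: q0.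
have Zp y : 0 < y -> 0 < Z y.
  move=> y0; have [c [/andP[+ _] E]] := D1_MVT (y / 2) y DZ.
  rewrite ge_min => cy.
  have c0 : 0 < c by case/orP: cy => ?; lra.
  have Zy2 : 0 <= Z (y / 2) by rewrite -Z0E Zmon //; lra.
  have : 0 < Z y - Z (y / 2).
    by rewrite E mulr_gt0 ?qp //; lra.
  lra.
pose p (x : R) := (x - a) * (b - x).
have Dp : D1 p (fun x => (1 - 0) * (b - x) + (x - a) * (0 - 1)).
  exact: D1M (D1B D1_id (D1_cst a)) (D1B (D1_cst b) D1_id).
exists (fun x => Z (p x)), (fun x => q (p x) * ((1 - 0) * (b - x) + (x - a) * (0 - 1))).
split.
- exact: D1_comp DZ Dp.
- apply: continuousM_fun; first by apply: (continuous_fcomp cq); exact: D1_continuous Dp.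
  apply: continuous_eqf (D1_continuous (D1D (D1B (D1_cst b) D1_id)
    (D1M (D1B D1_id (D1_cst a)) (D1_cst (-1))))) => x; ring.
- move=> x; have [/Zn ->//|/Zp/ltW//] := leP (p x) 0.
- by move=> x; rewrite in_itv /= => /andP[xa xb]; apply: Zp; rewrite mulr_gt0 ?subr_gt0.
- move=> x; rewrite in_itv /= negb_and -!leNgt => H ab; apply: Zn; rewrite /p.
  case/orP: H => H.
    by apply: mulr_le0_ge0; lra.
  by apply: mulr_ge0_le0; lra.
Qed.

(** The test functions [1 - 1 / (1 + n z)], [z] a bump on [(a, b)], increase to the
indicator function of [(a, b)]; dominated convergence on both sides of the
definition of the weak derivative. *)
Lemma weak_derivative_itv f f' g (a b : R) : D1 f f' -> continuous f' ->
  weak_derivative f g -> mu.-integrable setT (EFin \o g) -> a < b ->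
  Rintegral mu `]a, b[ g = f b - f a.
Proof.
move=> Df cf' W ig ab.
have [z [z' [Dz cz' z0 zp zn]]] := bump_exists a b.
have cz := D1_continuous Dz.
have zn1 n x : 1 + n%:R * z x != 0 :> R.
  by rewrite gt_eqF // ltr_pwDl // mulr_ge0.
(* Tends to 1 where z > 0, and is 0 elsewhere. *)
pose psi (n : nat) x := 1 - (1 + n%:R * z x)^-1.
have Dd n := D1D (D1_cst 1) (D1Z n%:R Dz).
have Dpsi n := D1B (D1_cst 1) (D1V (zn1 n) (Dd n)).
have cd n : continuous (fun x => (1 + n%:R * z x)^-1).
  by move=> x; apply: cvgV; [exact: zn1|exact: (D1_continuous (Dd n))].
have psi_out n x : x \notin `]a, b[%R -> psi n x = 0.
  by move=> xab; rewrite /psi zn // mulr0 addr0 invr1 subrr.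
have psi01 n x : 0 <= psi n x <= 1.
  rewrite /psi; have : 0 < (1 + n%:R * z x)^-1 <= 1.
    have : 1 <= 1 + n%:R * z x by rewrite lerDl mulr_ge0.
    move=> le1; have gt0 : 0 < 1 + n%:R * z x by apply: lt_le_trans le1.
    by rewrite invr_gt0 gt0 /= invf_le1.
  by move=> /andP[? ?]; apply/andP; split; lra.
have tpsi n : test_function (psi n).
  split.
  - exact: D1_derivable (Dpsi n).
  - rewrite (D1E (Dpsi n)).
    have : continuous (fun x => n%:R * z' x * ((1 + n%:R * z x)^-1 * (1 + n%:R * z x)^-1)).
      apply: continuousM_fun; last by apply: continuousM_fun.
      by apply: continuousM_fun => // x; exact: cst_continuous.
    by apply: continuous_eqf => x; ring.
  - exists (`|a| + `|b|) => x xab; apply: psi_out; rewrite in_itv /=; apply/negP => /andP[ax xb].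
    move: xab; apply/negP; rewrite -leNgt ler_norml.
    have := ler_norm a; have := ler_norm (- a); have := ler_norm b; have := ler_norm (- b).
    by rewrite !normrN => *; apply/andP; split; have := normr_ge0 a; have := normr_ge0 b; lra.
have mab : measurable (`]a, b[%classic : set R) by exact: measurable_itv.
have ig' : mu.-integrable `]a, b[ (EFin \o g) by apply: integrableS ig.
have if' : mu.-integrable `]a, b[ (EFin \o f').
  have A := integrable_continuous a b cf'.
  by apply: integrableS A => //; exact: subset_itv_oo_cc.
have mg : measurable_fun `]a, b[ g by apply/measurable_EFinP; exact: measurable_int ig'.
have mf' : measurable_fun `]a, b[ f' by apply/measurable_EFinP; exact: measurable_int if'.
have mpsi n : measurable_fun `]a, b[ (psi n).
  by apply: measurable_funTS; apply: continuous_measurable_fun; exact: D1_continuous (Dpsi n).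
have key k : mu.-integrable `]a, b[ (EFin \o k) -> measurable_fun `]a, b[ k ->
    (\int[mu]_(x in `]a, b[) (k x * psi n x)%:E)%E @[n --> \oo] --> (\int[mu]_(x in `]a, b[) (k x)%:E)%E.
  move=> ik mk.
  have [] // := @dominated_convergence _ _ R mu `]a, b[%classic mab
    (fun n x => (k x * psi n x)%:E) (EFin \o k) (fun x => `|k x|%:E).
  - by move=> n; apply/measurable_EFinP; exact: (measurable_funM mk (mpsi n)).
  - exact: measurable_int ik.
  - apply: aeW => x xab; apply: cvg_EFin; first by apply: nearW.
    have zx : 0 < z x by apply: zp.
    apply/cvgrPdist_le => e e0; near=> n.
    have -> : k x - k x * psi n x = k x * (1 + n%:R * z x)^-1 by rewrite /psi; ring.
    have d0 : 0 < 1 + n%:R * z x by rewrite ltr_pwDl // mulr_ge0.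
    rewrite normrM normfV (gtr0_norm d0) ler_pdivrMr //.
    apply: (@le_trans _ _ (e * (n%:R * z x))); last first.
      by apply: ler_wpM2l; [exact: ltW|rewrite lerDr].
    have ez : 0 < e * z x by rewrite mulr_gt0.
    rewrite mulrCA -ler_pdivrMr //.
    by near: n; exact: nbhs_infty_ger.
  - by move/integrable_abse : ik.
  - apply: aeW => x n xab; rewrite /= lee_fin normrM; have /andP[p0 p1] := psi01 n x.
    by rewrite (ger0_norm p0) ler_piMr.
have ikpsi k n : mu.-integrable `]a, b[ (EFin \o k) -> measurable_fun `]a, b[ k ->
    mu.-integrable `]a, b[ (EFin \o (fun x => k x * psi n x)).
  move=> ik mk; apply: le_integrable ik => //.
    by apply/measurable_EFinP; exact: (measurable_funM mk (mpsi n)).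
  move=> x xab; rewrite /= lee_fin normrM; have /andP[p0 p1] := psi01 n x.
  by rewrite (ger0_norm p0) ler_piMr.
have E n : (\int[mu]_(x in `]a, b[) (g x * psi n x)%:E = \int[mu]_(x in `]a, b[) (f' x * psi n x)%:E)%E.
  have := W _ (tpsi n); rewrite (Rintegral_by_parts Df cf' (tpsi n)) => /oppr_inj.
  rewrite (@Rintegral_support _ `]a, b[) //; last first.
    by move=> x xab; rewrite psi_out ?mulr0 //; apply/negP.
  rewrite [RHS](@Rintegral_support _ `]a, b[) //; last first.
    by move=> x xab; rewrite psi_out ?mulr0 //; apply/negP.
  rewrite /Rintegral => H.
  have i1 : (\int[mu]_(x in `]a, b[) (g x * psi n x)%:E \is a fin_num)%E.
    by apply: integrable_fin_num => //; exact: ikpsi.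
  have i2 : (\int[mu]_(x in `]a, b[) (f' x * psi n x)%:E \is a fin_num)%E.
    by apply: integrable_fin_num => //; exact: ikpsi.
  by rewrite -(fineK i1) -(fineK i2) /= H.
have C1 := key _ ig' mg; have C2 := key _ if' mf'.
have eqint : (\int[mu]_(x in `]a, b[) (g x)%:E = \int[mu]_(x in `]a, b[) (f' x)%:E)%E.
  move: C1; rewrite (_ : (fun n => _) = (fun n => \int[mu]_(x in `]a, b[) (f' x * psi n x)%:E)%E); last exact/funext.
  by move=> C1; apply: cvg_unique C1 C2; exact: ereal_hausdorff.
rewrite /Rintegral eqint -(@integral_itv_bndoo R _ _ _ true false); last exact/measurable_EFinP.
by rewrite (FTC2 cf' Df (ltW ab)).
Unshelve. all: by end_near. Qed.

(** Both functions have the same integral over every interval, so the claim follows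
from the differentiation theorem of Lebesgue. *)
Lemma weak_derivative_ae f f' g : D1 f f' -> continuous f' ->
  weak_derivative f g -> mu.-integrable setT (EFin \o g) ->
  {ae mu, forall x, f' x = g x}.
Proof.
move=> Df cf' W ig.
have igI (D : set R) : measurable D -> mu.-integrable D (EFin \o g).
  by move=> mD; apply: integrableS ig.
(* F differs from f by a constant and is differentiable with derivative g
   almost everywhere. *)
pose F (x : R) := \int[mu]_(t in `]-oo, x]) g t.
have FE x y : y < x -> F x - F y = f x - f y.
  move=> yx; have yx' : (BRight y <= BRight x)%O by rewrite bnd_simp ltW.
  have -> : F x - F y = \int[mu]_(t in `]y, x]) g t.
    by rewrite /F Rintegral_itvB //; exact: igI.
  rewrite -(Rintegral_itv_bndo_bndc (a := BRight y)); last exact: igI.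
  exact: (weak_derivative_itv Df cf' W ig yx).
have Fc x : F x = f x + (F 0 - f 0).
  by have [x0|x0|->] := ltgtP x 0; [have := FE _ _ x0|have := FE _ _ x0|]; lra.
have DF : D1 F f'.
  rewrite (_ : F = fun x => f x + (F 0 - f 0)); last exact/funext.
  by apply: D1_eq (D1D Df (D1_cst (F 0 - f 0))) _ => x; rewrite addr0.
have loc : locally_integrable setT g by apply: open_integrable_locally ig; exact: openT.
have := FTC1Ny (fun y => igI _ (measurable_itv _)) loc.
apply: filterS; first exact: (ae_filter_ringOfSetsType mu).
move=> x [_ <-].
by have := D1E DF; rewrite /F => ->.
Qed.

Lemma integrable_L1 f : continuous f ->
  mu.-integrable setT (EFin \o f) <-> exists M : R, (\int[mu]_x (`|f x|)%:E <= M%:E)%E.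
Proof.
move=> cf; split.
  move=> /integrableP[_ fin]; exists (fine (\int[mu]_x (`|f x|)%:E)%E).
  rewrite fineK // ge0_fin_numE // integral_ge0 // => x _; by rewrite lee_fin.
move=> [M le]; apply/integrableP; split; first exact: measurable_continuous_EFin.
by apply: le_lt_trans le _; exact: ltry.
Qed.

Lemma sobolev_ae k f g : continuous f -> {ae mu, forall x, f x = g x} ->
  sobolev_W1 k g -> sobolev_W1 k f.
Proof.
move=> cf fg S.
have ig : mu.-integrable setT (EFin \o g) by case: k S => [|k] [].
have mf : measurable_fun setT f by exact: continuous_measurable_fun.
have mg : measurable_fun setT g by apply/measurable_EFinP; exact: measurable_int ig.
have if_ : mu.-integrable setT (EFin \o f).
  apply/integrableP; split; first exact/measurable_EFinP.
  move/integrableP : ig => [_]; congr (_ < _)%E; apply: ae_eq_integral => //.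
  - by apply: measurableT_comp => //; exact/measurable_EFinP.
  - by apply: measurableT_comp => //; exact/measurable_EFinP.
  by move: fg; apply: filterS; [exact: (ae_filter_ringOfSetsType mu)|move=> x E _ /=; rewrite E].
case: k S => [|k] [_ S]; split=> //; have [g' [W S']] := S; exists g'; split=> //.
move=> psi tpsi; rewrite -(W _ tpsi); have [_ cpsi' _] := tpsi.
rewrite /Rintegral; congr fine; apply: ae_eq_integral => //.
- by apply/measurable_EFinP; apply: measurable_funM => //; exact: continuous_measurable_fun.
- by apply/measurable_EFinP; apply: measurable_funM => //; exact: continuous_measurable_fun.
by move: fg; apply: filterS; [exact: (ae_filter_ringOfSetsType mu)|move=> x E _ /=; rewrite E].
Qed.

Lemma smooth_D1 f n : smooth f -> D1 (f^`(n)) (f^`(n.+1)).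
Proof. by move=> S; rewrite derive1nS; apply: derivable_D1; exact: S. Qed.

Lemma smooth_derive f : smooth f -> smooth (f^`()).
Proof. by move=> S n x; rewrite -derive1Sn; exact: S. Qed.

Lemma smooth_continuous f n : smooth f -> continuous (f^`(n)).
Proof. by move=> S; exact: D1_continuous (smooth_D1 n S). Qed.

(** The successive weak derivatives of a smooth function are almost everywhere its
classical ones. *)
Lemma sobolev_integrable k f : smooth f -> sobolev_W1 k f ->
  mu.-integrable setT (EFin \o f^`(k)).
Proof.
elim: k f => [|k IH] f Sf; first by case.
move=> [if_ [g [W S]]]; rewrite derive1Sn; apply: IH; first exact: smooth_derive.
have ig : mu.-integrable setT (EFin \o g) by case: k S => [|k] [].
have cf' : continuous (f^`()) by rewrite -derive1n1; exact: smooth_continuous.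
apply: sobolev_ae S => //.
exact: weak_derivative_ae (smooth_D1 0 Sf) cf' W ig.
Qed.

End weak.

(** * The Lie algebra *)

Section g_space.
Context {R : realType}.
Notation mu := (@lebesgue_measure R).
Implicit Types (f g h u v w P : R -> R).

(** An integrable function takes arbitrarily small values, and its oscillation is at
most the [L^1] norm of its derivative. *)
Lemma sup_of_L1 f f' (A B : R) : D1 f f' -> continuous f' ->
  (\int[mu]_x (`|f x|)%:E <= A%:E)%E -> (\int[mu]_x (`|f' x|)%:E <= B%:E)%E ->
  forall x, `|f x| <= B.
Proof.
move=> Df cf' LA LB x; have cf := D1_continuous Df.
have [P DP] := antiderivative_exists (continuous_abs cf).
have [Q DQ] := antiderivative_exists (continuous_abs cf').
have PA := (integral_leP A (continuous_abs cf) (fun x => normr_ge0 _) DP).1 LA.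
have QB := (integral_leP B (continuous_abs cf') (fun x => normr_ge0 _) DQ).1 LB.
have A0 : 0 <= A by have := PA 0 0 (lexx _); rewrite subrr.
apply/ler_addgt0Pr => e e0.
have Ae : 0 < (A + 1) / e by rewrite divr_gt0 // ltr_wpDl.
have [c [_ E]] := D1_MVT 0 ((A + 1) / e) DP.
have cs : `|f c| <= e.
  rewrite leNgt; apply/negP => ec.
  have := PA _ _ (ltW Ae); rewrite E subr0; apply/negP; rewrite -ltNge.
  apply: (@lt_le_trans _ _ (e * ((A + 1) / e))).
    by rewrite mulrC divfK ?gt_eqF // ltrDl.
  by apply: ler_wpM2r; exact: ltW.
rewrite -(subrK (f c) (f x)); apply: le_trans (ler_normD _ _) _; apply: lerD => //.
have /orP[xc|cx] := le_total c x.
  by apply: le_trans (D1_abs_le Df DQ (fun _ => lexx _) xc) _; exact: QB.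
by rewrite distrC; apply: le_trans (D1_abs_le Df DQ (fun _ => lexx _) cx) _; exact: QB.
Qed.

(** The Sobolev embedding of [W^{1,1}] in [L^oo], at each order. *)
Lemma L1_bdk k (e : R) f : smooth f ->
  (forall j, (j <= k.+1)%N -> (\int[mu]_x (`|f^`(j) x|)%:E <= e%:E)%E) -> bdk true k e f.
Proof.
elim: k f => [|k IH] f Sf H.
  have c0 := smooth_continuous (n := 0) Sf; have c1 := smooth_continuous (n := 1) Sf.
  split=> //; split=> [//|x|_]; last exact: (H 0%N).
  exact: (sup_of_L1 (smooth_D1 0 Sf) c1 (H 0%N isT) (H 1%N isT)).
have B : bdk true k e f by apply: IH Sf _ => j jk; apply: H; exact: leqW.
apply: (bdkSI (smooth_D1 0 Sf)); first exact: bdk0 B.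
apply: IH; first exact: smooth_derive.
by move=> j jk; rewrite -derive1Sn; exact: H.
Qed.

Lemma bdk_derive1n b k j (e : R) f : bdk b (k + j) e f -> bdk b k e (f^`(j)).
Proof.
elim: j k => [|j IH] k; first by rewrite addn0.
by rewrite addnS derive1nS -addSn => /IH /bdkS.
Qed.

Lemma tame_derive1n b n f : tame b f -> tame b (f^`(n)).
Proof. by elim: n => [//|n IH] /IH; rewrite derive1nS; exact: tame_derive. Qed.

Lemma tame_smooth b f : tame b f -> smooth f.
Proof. by move=> mf n x; exact: D1_derivable (tame_D1 (tame_derive1n n mf)) x. Qed.

Lemma smooth_tame f : smooth f -> sobolev_Woo1 f -> tame true f.
Proof.
move=> Sf W k.
have L j : exists M : R, (\int[mu]_x (`|f^`(j) x|)%:E <= M%:E)%E.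
  by apply/integrable_L1; [exact: smooth_continuous|exact: sobolev_integrable].
have [M HM] : exists M : R, forall j, (j <= k.+1)%N -> (\int[mu]_x (`|f^`(j) x|)%:E <= M%:E)%E.
  elim: k.+1 => [|n [M HM]].
    by have [M HM] := L 0%N; exists M => j; rewrite leqn0 => /eqP ->.
  have [N HN] := L n.+1; exists (Num.max M N) => j; rewrite leq_eqVlt => /orP[/eqP->|/HM L1].
    by apply: le_trans HN _; rewrite lee_fin le_max lexx orbT.
  by apply: le_trans L1 _; rewrite lee_fin le_max lexx.
by exists M; exact: L1_bdk.
Qed.

Lemma tame_integrable f : tame true f -> mu.-integrable setT (EFin \o f).
Proof.
move=> mf; apply/integrable_L1; first exact: tame_cont mf.
by have [M [[_ _ /(_ isT) I] _]] := mf 0%N; exists M.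
Qed.

Lemma tame_sobolev f : tame true f -> sobolev_Woo1 f.
Proof.
move=> mf k; elim: k f mf => [|k IH] f mf; split=> //; try exact: tame_integrable.
exists (f^`()); split; last by apply: IH; exact: tame_derive mf.
move=> psi tpsi; apply: Rintegral_by_parts tpsi; first exact: tame_D1 mf.
exact: tame_cont (tame_derive mf).
Qed.

Lemma in_g_D1 u : in_g u -> D1 u (u^`()).
Proof. by move=> [S _ _]; exact: (smooth_D1 0 S). Qed.

Lemma in_g_tame u : in_g u -> tame true (u^`()).
Proof. by move=> [S W _]; apply: smooth_tame => //; exact: smooth_derive. Qed.

Lemma in_gI u u' : D1 u u' -> tame true u' -> u x @[x --> -oo%R] --> (0 : R) -> in_g u.
Proof.
move=> D m c; split=> //; last by rewrite (D1E D); exact: tame_sobolev.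
case=> [|n] x; first exact: D1_derivable D x.
by rewrite derive1Sn (D1E D); exact: (tame_smooth m).
Qed.

Lemma cvgNy_le f (M l x : R) : f y @[y --> -oo%R] --> l ->
  (forall y, y <= x -> `|f x - f y| <= M) -> `|f x - l| <= M.
Proof.
move=> c H; apply/ler_addgt0Pr => e e0.
have N : \forall y \near -oo, `|l - f y| <= e by move/cvgrPdist_le: c; apply.
have Nx : \forall y \near -oo%R, y <= x by exact: nbhs_ninfty_le (num_real x).
have [y [ly yx]] := filter_ex (filterI N Nx).
rewrite -(subrK (f y) (f x)) -addrA; apply: le_trans (ler_normD _ _) _.
by apply: lerD; [exact: H|rewrite distrC].
Qed.

Lemma in_g_sup (e : R) u : in_g u -> bd true e (u^`()) -> forall x, `|u x| <= e.
Proof.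
move=> gu B x; have [P [DP Pe]] := bd_abs_antiderivative B.
have [_ _ c] := gu; rewrite -[u x]subr0; apply: (cvgNy_le c) => y yx.
by apply: le_trans (D1_abs_le (in_g_D1 gu) DP (fun _ => lexx _) yx) _; exact: Pe.
Qed.

Lemma in_g_bdk k (e : R) u : in_g u -> bdk true k e (u^`()) -> bdk false k.+1 e u.
Proof.
move=> gu B; apply: (bdkSI (in_g_D1 gu)); last exact: bdk_false B.
split=> //; first exact: D1_continuous (in_g_D1 gu).
by apply: in_g_sup => //; exact: bdk0 B.
Qed.

Lemma in_g_tameF u : in_g u -> tame false u.
Proof.
move=> gu k; have [M B] := in_g_tame gu k; exists M.
by apply: bdk_k; exact: in_g_bdk.
Qed.

Lemma in_gD u v : in_g u -> in_g v -> in_g (fun x => u x + v x).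
Proof.
move=> gu gv; apply: (in_gI (D1D (in_g_D1 gu) (in_g_D1 gv))).
  by apply: tameD; exact: in_g_tame.
have [_ _ cu] := gu; have [_ _ cv] := gv.
by rewrite -(addr0 (0 : R)); exact: cvgD.
Qed.

Lemma in_gZ (c : R) u : in_g u -> in_g (fun x => c * u x).
Proof.
move=> gu; apply: (in_gI (D1Z c (in_g_D1 gu))).
  by apply: tameZ; exact: in_g_tame.
have [_ _ cu] := gu.
by rewrite -(mulr0 c); apply: cvgM => //; exact: cvg_cst.
Qed.

Lemma in_gB u v : in_g u -> in_g v -> in_g (fun x => u x - v x).
Proof.
move=> gu /(in_gZ (-1)) gv; have := in_gD gu gv.
by under eq_fun do rewrite mulN1r.
Qed.

Lemma in_g0 : in_g (fun _ : R => 0 : R).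
Proof.
apply: (in_gI (D1_cst 0)); last exact: cvg_cst.
by move=> k; exists 0; exact: bdk_eq0.
Qed.

Lemma nondec_cvgNy P (M : R) : (forall a b, a <= b -> P a <= P b) ->
  (forall a b, a <= b -> P b - P a <= M) -> exists l : R, P y @[y --> -oo%R] --> l.
Proof.
move=> nd B; pose E := range P.
have hE : has_inf E.
  split; first by exists (P 0), 0.
  exists (P 0 - M) => _ [y _ <-].
  have /orP[y0|y0] := le_total 0 y.
    by have := B _ _ (lexx (0 : R)); have := nd _ _ y0; lra.
  by have := B _ _ y0; lra.
exists (inf E); apply/cvgrPdist_le => e e0.
have [_ [y _ <-] ye] := inf_adherent e0 hE.
near=> z.
have zy : z <= y by near: z; exact: nbhs_ninfty_le (num_real y).
have : inf E <= P z by apply: ge_inf; [exact: hE.2|exists z].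
have := nd _ _ zy => ? ?; rewrite ler_norml; apply/andP; split; lra.
Unshelve. all: by end_near. Qed.

(** With [P] an antiderivative of [|h|] and [F] one of [h], both [P] and [P + F] are
nondecreasing with bounded increments, so [F] has a limit at [-oo] to subtract. *)
Lemma g_antiderivative h : tame true h -> exists rho, in_g rho /\ D1 rho h.
Proof.
move=> mh; have [M [B _]] := mh 0%N.
have [F DF] := antiderivative_exists (tame_cont mh).
have [P [DP PM]] := bd_abs_antiderivative B.
have Pn a b := D1_nondec DP (fun x => normr_ge0 (h x)) (a := a) (b := b).
have FP a b (ab : a <= b) := D1_abs_le DF DP (fun x => lexx _) ab.
have [l1 c1] : exists l : R, (P y + F y) @[y --> -oo%R] --> l.
  apply: (@nondec_cvgNy _ (M + M)) => a b ab.
    by have := FP _ _ ab; rewrite ler_norml => /andP[]; lra.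
  by have := FP _ _ ab; have := PM _ _ ab; rewrite ler_norml => ? /andP[]; lra.
have [l2 c2] := nondec_cvgNy Pn PM.
exists (fun x => F x - (l1 - l2)); split; last first.
  by apply: D1_eq (D1B DF (D1_cst (l1 - l2))) _ => x; rewrite subr0.
apply: (in_gI (D1B DF (D1_cst (l1 - l2)))).
  by move=> k; have [N BN] := mh k; exists N; apply: bdk_eq BN => x; rewrite subr0.
rewrite -(subrr (l1 - l2)); apply: cvgB; last exact: cvg_cst.
have : (P y + F y) - P y @[y --> -oo%R] --> l1 - l2 by exact: cvgB.
by under eq_fun do rewrite addrAC subrr add0r.
Qed.

Section g_cvg.
Context {T : Type} (FT : set_system T) {FF : Filter FT}.

Lemma ereal_cvg0P (f : T -> \bar R) : (forall p, (0 <= f p)%E) ->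
  (f p @[p --> FT] --> 0%E) <-> (forall e : R, 0 < e -> \forall p \near FT, (f p <= e%:E)%E).
Proof.
move=> f0; split.
  move=> /fine_cvgP[fin /cvgrPdist_le c] e e0.
  apply: filterS2 fin (c e e0) => p fp; rewrite sub0r normrN => le.
  by rewrite -(fineK fp) lee_fin; apply: le_trans (ler_norm _) le.
move=> H; apply/fine_cvgP; split.
  apply: filterS (H 1 ltr01) => p le; rewrite ge0_fin_numE //.
  by apply: le_lt_trans le _; exact: ltry.
apply/cvgrPdist_le => e e0; apply: filterS (H e e0) => p le /=.
have fp : f p \is a fin_num by rewrite ge0_fin_numE //; apply: le_lt_trans le _; exact: ltry.
by rewrite sub0r normrN ger0_norm ?fine_ge0 // -lee_fin fineK.
Qed.

(** By Sobolev embedding the seminorms of [g] also control suprema. *)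
Lemma g_cvgP (U : T -> R -> R) (V : R -> R) :
  (\forall p \near FT, in_g (fun x => U p x - V x)) ->
  g_cvg FT U V <-> forall k, small FT true k (fun p => (fun x => U p x - V x)^`()).
Proof.
move=> gUV; pose W p := (fun x => U p x - V x).
have W0 k p : (0 <= \int[mu]_x (`|(W p)^`(k.+1) x|)%:E)%E.
  by apply: integral_ge0 => x _; rewrite lee_fin.
split=> [H k e e0|H k].
  have N : \forall p \near FT, forall j, (j <= k.+1)%N ->
      (\int[mu]_x (`|(W p)^`(j.+1) x|)%:E <= e%:E)%E.
    elim: k.+1 => [|n IH].
      have := (ereal_cvg0P (W0 0%N)).1 (H 0%N) e e0.
      by apply: filterS => p le j; rewrite leqn0 => /eqP ->.
    apply: filterS2 IH ((ereal_cvg0P (W0 n.+1)).1 (H n.+1) e e0) => p IH le j.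
    by rewrite leq_eqVlt => /orP[/eqP->|/IH].
  apply: filterS2 gUV N => p [S _ _] N.
  by apply: L1_bdk; [exact: smooth_derive|move=> j jk; rewrite -derive1Sn; exact: N].
apply/(ereal_cvg0P (W0 k)) => e e0.
apply: filterS (H k e e0) => p B.
rewrite derive1Sn; have := @bdk_derive1n _ 0 k e _ B.
by move=> [[_ _ /(_ isT)]].
Qed.

Lemma g_cvg_small (U : T -> R -> R) (V : R -> R) :
  (\forall p \near FT, in_g (fun x => U p x - V x)) -> g_cvg FT U V -> cvgto FT false U V.
Proof.
move=> gUV /(g_cvgP gUV) H k e e0; apply: filterS2 gUV (H k e e0) => p g B.
by apply: bdk_k; exact: in_g_bdk.
Qed.

Lemma g_cvg_cvgto (U : T -> R -> R) (V : R -> R) :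
  (\forall p \near FT, in_g (fun x => U p x - V x)) ->
  (\forall p \near FT, forall x, derivable (U p) x 1) -> (forall x, derivable V x 1) ->
  g_cvg FT U V <-> cvgto FT true (fun p => (U p)^`()) (V^`()).
Proof.
move=> gUV dU dV; rewrite (g_cvgP gUV).
have E : \forall p \near FT, forall x, (fun x => U p x - V x)^`() x = (U p)^`() x - V^`() x.
  apply: filterS dU => p dU x.
  by rewrite (D1E (D1B (derivable_D1 dU) (derivable_D1 dV))).
split=> H k; first exact: small_eq (H k).
by apply: small_eq (H k); apply: filterS E => p E x; rewrite E.
Qed.

End g_cvg.
End g_space.

(** * The diffeomorphism group *)

Section diffeo.
Context {R : realType}.
Implicit Types (f g h u v w phi psi : R -> R).

Lemma bd_near0 (e A x : R) f : bd true A f -> 0 < e -> exists y z, [/\ y <= x, x <= z, `|f y| <= e & `|f z| <= e].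
Proof.
move=> B e0; have [P [DP PA]] := bd_abs_antiderivative B.
have A0 := bd_ge0 B.
have Ae : 0 < (A + 1) / e by rewrite divr_gt0 // ltr_wpDl.
have W a b : b - a = (A + 1) / e -> exists c, [/\ a <= c, c <= b & `|f c| <= e].
  move=> ba; have ab : a <= b by lra.
  have [c [/andP[ac cb] E]] := D1_MVT a b DP.
  rewrite (min_idPl ab) in ac; rewrite (max_idPr ab) in cb.
  exists c; split=> //; rewrite leNgt; apply/negP => ec.
  have := PA _ _ ab; rewrite E ba; apply/negP; rewrite -ltNge.
  apply: (@lt_le_trans _ _ (e * ((A + 1) / e))).
    by rewrite mulrC divfK ?gt_eqF // ltrDl.
  by apply: ler_wpM2r; exact: ltW.
have [y [_ yx fy]] := W (x - (A + 1) / e) x (subKr _ _).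
have E : x + (A + 1) / e - x = (A + 1) / e by ring.
have [z [xz _ fz]] := W _ _ E.
by exists y, z.
Qed.

(** [f] is small somewhere beyond any point, and varies little near infinity since
[f'] is integrable. *)
Lemma tame_decay f (e : R) : tame true f -> 0 < e -> exists N : R, forall x, N <= `|x| -> `|f x| <= e.
Proof.
move=> mf e0; have [M BM] := mf 1%N.
have [P [DP PM]] := bd_abs_antiderivative (bdk0 (bdkS BM)).
have Pn a b := D1_nondec DP (fun x => normr_ge0 _) (a := a) (b := b).
have e2 : 0 < e / 2 by rewrite divr_gt0.
have [l1 /cvgrPdist_le c1] := nondec_cvgNy Pn PM.
have [l2 /cvgrPdist_le c2] : exists l : R, - P (- y) @[y --> -oo%R] --> l.
  apply: (@nondec_cvgNy _ _ M) => a b ab.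
    by rewrite lerN2 Pn // lerN2.
  by have := PM (- b) (- a); rewrite lerN2 => /(_ ab); lra.
have e4 : 0 < e / 4 by rewrite divr_gt0.
have [N1 HN1] : exists N, forall y, y <= N -> `|l1 - P y| <= e / 4.
  have [K [_ HK]] := c1 _ e4; exists (K - 1) => y yK; apply: HK; lra.
have [N2 HN2] : exists N, forall y, y <= N -> `|l2 + P (- y)| <= e / 4.
  have [K [_ HK]] := c2 _ e4; exists (K - 1) => y yK; have := HK y.
  by rewrite opprK; apply; lra.
have Df := tame_D1 mf.
have osc a b (ab : a <= b) : `|f b - f a| <= P b - P a := D1_abs_le Df DP (fun _ => lexx _) ab.
exists (`|N1| + `|N2|) => x.
have n1 := ler_norm (- N1); have n2 := ler_norm (- N2); rewrite !normrN in n1 n2.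
have p1 := normr_ge0 N1; have p2 := normr_ge0 N2.
have [y [z [yx xz fy fz]]] := bd_near0 x (bdk0 BM) e2.
have [x0|x0] := ger0P x => xN.
  have := HN2 (- x); rewrite opprK => /(_ _) Hx.
  have := HN2 (- z); rewrite opprK => /(_ _) Hz.
  have : `|l2 + P x| <= e / 4 by apply: Hx; lra.
  have : `|l2 + P z| <= e / 4 by apply: Hz; lra.
  rewrite !ler_norml => /andP[a1 a2] /andP[b1 b2].
  have := osc _ _ xz; move: fz; rewrite !ler_norml => /andP[c3 c4] /andP[c5 c6].
  by apply/andP; split; lra.
have : `|l1 - P x| <= e / 4 by apply: HN1; lra.
have : `|l1 - P y| <= e / 4 by apply: HN1; lra.
rewrite !ler_norml => /andP[a1 a2] /andP[b1 b2].
have := osc _ _ yx; move: fy; rewrite !ler_norml => /andP[c3 c4] /andP[c5 c6].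
by apply/andP; split; lra.
Qed.

Lemma Diff_D1 phi : in_Diff phi -> D1 phi (phi^`()).
Proof.
move=> [f [gf _ E]]; have D := D1D D1_id (in_g_D1 gf).
have -> : phi = (fun x => x + f x) by exact/funext.
by rewrite (D1E D).
Qed.

Lemma Diff_deriveE phi : in_Diff phi -> exists f, in_g f /\ phi^`() = (fun x => 1 + f^`() x) /\ (forall x, phi x = x + f x).
Proof.
move=> [f [gf _ E]]; exists f; split=> //; split=> //.
have -> : phi = (fun x => x + f x) by exact/funext.
exact: (D1E (D1D D1_id (in_g_D1 gf))).
Qed.

Lemma Diff_tame phi : in_Diff phi -> tame false (phi^`()).
Proof.
move=> /Diff_deriveE[f [gf [-> _]]]; apply: tameD; first exact: tame_cst.
exact: tame_false (in_g_tame gf).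
Qed.

Lemma Diff_gt0 phi : in_Diff phi -> forall x, 0 < phi^`() x.
Proof.
move=> [f [gf f1 E]] x.
have -> : phi = (fun x => x + f x) by exact/funext.
by rewrite (D1E (D1D D1_id (in_g_D1 gf))); have := f1 x; lra.
Qed.

Lemma Diff_sub phi phi2 : in_Diff phi -> in_Diff phi2 -> in_g (fun x => phi x - phi2 x).
Proof.
move=> [f [gf _ E]] [g [gg _ E2]].
rewrite (_ : (fun x => _) = (fun x => f x - g x)); first exact: in_gB.
by apply/funext => x; rewrite E E2; ring.
Qed.

(** [phi'] is close to [1] outside of a segment, where it has a positive minimum. *)
Lemma Diff_ge phi : in_Diff phi -> exists2 m : R, 0 < m & forall x, m <= phi^`() x.
Proof.
move=> Dp; have [f [gf [E _]]] := Diff_deriveE Dp.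
have [N HN] := tame_decay (in_g_tame gf) (divr_gt0 ltr01 (ltr0n R 2)).
pose K := `|N| + 1.
have K0 : - K <= K by have := normr_ge0 N; rewrite /K; lra.
have cphi : {within `[- K, K], continuous (phi^`())}.
  by apply: continuous_subspaceT; exact: tame_cont (Diff_tame Dp).
have [c _ Hc] := EVT_min K0 cphi.
exists (Num.min (phi^`() c) 2^-1) => [|x]; first by rewrite lt_min Diff_gt0 //= invr_gt0.
have [xK|Kx] := leP `|x| K.
  by rewrite ge_min Hc // in_itv /= -ler_norml.
rewrite ge_min; apply/orP; right; rewrite E.
have : `|f^`() x| <= 1 / 2.
  by apply: HN; apply: le_trans (ltW Kx); apply: le_trans (ler_norm N) _; rewrite lerDl.
by rewrite ler_norml => /andP[]; lra.
Qed.

Lemma Diff_surj phi : in_Diff phi -> exists psi, forall y, phi (psi y) = y.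
Proof.
move=> Dp; have [f [gf [_ E]]] := Diff_deriveE Dp.
have [M B] := in_g_tameF gf 0%N; have sf := bdk_sup B; have M0 := bdk_ge0 B.
suff H y : exists x, phi x = y by have [psi Hpsi] := choice H; exists psi.
have cphi : {within `[y - M, y + M], continuous phi}.
  by apply: continuous_subspaceT; exact: D1_continuous (Diff_D1 Dp).
have yM : y - M <= y + M by lra.
have [|x _ <-] := IVT yM cphi (v := y); last by exists x.
have := sf (y - M); have := sf (y + M); rewrite !E !ler_norml => /andP[a1 a2] /andP[b1 b2].
rewrite ge_min le_max; apply/andP; split; apply/orP; [left|right]; lra.
Qed.

Lemma Diff_diffeo phi psi : in_Diff phi -> (forall y, phi (psi y) = y) ->
  exists m, diffeo m phi (phi^`()) psi.
Proof.
by move=> Dp K; have [m m0 mp] := Diff_ge Dp; exists m; split=> //; exact: Diff_D1.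
Qed.

Lemma diffeo_le m m' phi phi' psi : 0 < m' -> (forall x, m' <= phi' x) ->
  diffeo m phi phi' psi -> diffeo m' phi phi' psi.
Proof. by move=> m0 H [_ ? _ ?]. Qed.

Lemma cvgNy_comp_inv phi psi w (l : R) : in_Diff phi -> (forall y, phi (psi y) = y) ->
  w x @[x --> -oo%R] --> l -> w (psi y) @[y --> -oo%R] --> l.
Proof.
move=> Dp K c; have [f [gf [_ E]]] := Diff_deriveE Dp.
have [M B] := in_g_tameF gf 0%N; have sf := bdk_sup B.
apply: (@cvg_comp _ _ _ psi w _ -oo%R) => // A [N [_ HN]].
exists (N - M); split; first exact: num_real.
move=> y yN; apply: HN; have := sf (psi y); have := K y; rewrite E ler_norml => ? /andP[]; lra.
Qed.

Lemma tame_comp b phi psi f : in_Diff phi -> (forall y, phi (psi y) = y) ->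
  tame b f -> tame b (fun y => f (psi y)).
Proof.
move=> Dp K mf k; have [m dp] := Diff_diffeo Dp K; have [m0 _ _ _] := dp.
have [M B] := Diff_tame Dp k; have [N BN] := mf k.
have [C [_ HC]] := bdk_comp k M m0.
by exists (C * N); apply: HC BN; [exact: dp|exact: B].
Qed.

Lemma tame_invD phi : in_Diff phi -> tame false (fun x => (phi^`() x)^-1).
Proof. by move=> Dp; have [m m0 mp] := Diff_ge Dp; apply: (tameV m0 mp); exact: Diff_tame. Qed.

Lemma in_g_comp phi psi w : in_Diff phi -> (forall y, phi (psi y) = y) ->
  in_g w -> in_g (fun y => w (psi y)).
Proof.
move=> Dp K gw; have [m dp] := Diff_diffeo Dp K.
apply: (in_gI (D1_comp (in_g_D1 gw) (diffeo_D1 dp))).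
  have := tameM (in_g_tame gw) (tame_invD Dp); rewrite orbF => H.
  exact: (tame_comp Dp K H).
by have [_ _ c] := gw; exact: (cvgNy_comp_inv Dp K c).
Qed.

Lemma in_gM f w : tame true f -> in_g w -> in_g (fun x => f x * w x).
Proof.
move=> mf gw; apply: (in_gI (D1M (tame_D1 mf) (in_g_D1 gw))).
  apply: tameD; first exact: tameM (tame_derive mf) (in_g_tameF gw).
  exact: tameM mf (tame_false (in_g_tame gw)).
have [_ _ c] := gw; have [M B] := mf 0%N.
apply/cvgrPdist_le => e e0.
have M1 : 0 < `|M| + 1 by rewrite ltr_wpDl.
move/cvgrPdist_le : c => /(_ (e / (`|M| + 1))); rewrite divr_gt0 // => /(_ isT).
apply: filterS => x; rewrite !sub0r !normrN => le; rewrite normrM.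
apply: le_trans (_ : (`|M| + 1) * (e / (`|M| + 1)) <= _).
  apply: ler_pM => //; apply: le_trans (bdk_sup B x) _.
  by apply: le_trans (ler_norm M) _; rewrite lerDl.
by rewrite mulrC divfK // gt_eqF.
Qed.

End diffeo.

(** * Curves in the group and in its Lie algebra *)

(** [pd] is punctured, for difference quotients; [pw] is not, for continuity. *)
Notation pw D t := (within D (nbhs t)).
Notation pd D t := (within D (dnbhs t)).

Section curves.
Context {R : realType}.

Lemma D1Zr (c : R) (f f' : R -> R) : D1 f f' -> D1 (fun x => f x / c) (fun x => f' x / c).
Proof.
move=> /(D1Z c^-1); rewrite (_ : (fun x => c^-1 * f x) = (fun x => f x / c)).
  by move=> D; apply: D1_eq D _ => x; rewrite mulrC.
by apply/funext => x; rewrite mulrC.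
Qed.

Implicit Types (D : set R) (t : R).

Lemma near_pd_in D t : \forall s \near pd D t, D s.
Proof. by rewrite near_withinE; apply: nearW. Qed.

Lemma near_pw_in D t : \forall s \near pw D t, D s.
Proof. by rewrite near_withinE; apply: nearW. Qed.

Lemma near_pd_neq D t : \forall s \near pd D t, s - t != 0.
Proof.
rewrite near_withinE; near=> s => _; rewrite subr_eq0.
by near: s; exact: nbhs_dnbhs_neq.
Unshelve. all: by end_near. Qed.

Lemma near_pd_small D t (e : R) : 0 < e -> \forall s \near pd D t, `|s - t| <= e.
Proof.
move=> e0; rewrite near_withinE; apply: nbhs_dnbhs; near=> s => _.
rewrite distrC; apply: ltW; near: s; exact: (nbhsx_ballx t e e0).
Unshelve. all: by end_near. Qed.

Lemma near_pd_pw D t (P : R -> Prop) : (D t -> P t) -> (\forall s \near pd D t, P s) ->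
  \forall s \near pw D t, P s.
Proof.
move=> Pt; rewrite !near_withinE => H.
have H' : \forall s \near t, s != t -> D s -> P s by exact: H.
apply: filterS H' => s H' Ds; have [st|st] := eqVneq s t; last exact: H'.
by rewrite st; apply: Pt; rewrite -st.
Qed.

(** For [b = true], and applied to [x]-derivatives, this is differentiability in [g];
see [g_derivative_tder] and [tder_g_derivative]. *)
Definition tder b D (U : R -> R -> R) (V : R -> R) t := dif (pd D t) (fun s => s - t) b U (U t) V.

Definition tcont b D (U : R -> R -> R) t := cvgto (pw D t) b U (U t).

Lemma tder_cont b D U V t : tame b V -> tder b D U V t -> cvgto (pd D t) b U (U t).
Proof. by move=> mV; apply: dif_cvgto mV; [exact: near_pd_neq|exact: near_pd_small]. Qed.

Lemma cvgto_pd_pw b D U t : cvgto (pd D t) b U (U t) -> tcont b D U t.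
Proof.
move=> C k e e0; apply: near_pd_pw; last exact: C.
by move=> _; apply: bdk_eq0 => [|x]; [exact: ltW|rewrite subrr].
Qed.

Lemma tder_tcont b D U V t : tame b V -> tder b D U V t -> tcont b D U t.
Proof. by move=> mV /(tder_cont mV); exact: cvgto_pd_pw. Qed.

(** Both curves in [g] and curves in [Diff] satisfy this; it is all that derivatives
in the sense of [g] require. *)
Definition g_affine D (U : R -> R -> R) := forall s t, D s -> D t ->
  in_g (fun x => U s x - U t x) /\ D1 (U t) ((U t)^`()).

Lemma in_g_affine D U : (forall t, D t -> in_g (U t)) -> g_affine D U.
Proof.
move=> gU s t Ds Dt; split; first by apply: in_gB; exact: gU.
by apply: in_g_D1; exact: gU.
Qed.

Lemma Diff_affine D U : (forall t, D t -> in_Diff (U t)) -> g_affine D U.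
Proof.
move=> gU s t Ds Dt; split; first by apply: Diff_sub; exact: gU.
by apply: Diff_D1; exact: gU.
Qed.

(** Elements of [g] vanish at [-oo], so convergence of the [x]-derivatives in [L^1]
entails uniform convergence. *)
Lemma g_derivative_tder D U V t : g_affine D U -> g_derivative_on D U V -> D t ->
  tder false D U (V t) t /\
  tder true D (fun s => (U s)^`()) ((V t)^`()) t.
Proof.
move=> aff dU Dt; have [gV C] := dU t Dt.
have gq : \forall s \near pd D t, in_g (fun x => (U s x - U t x) / (s - t) - V t x).
  apply: filterS (near_pd_in D t) => s Ds; apply: in_gB => //.
  have [g1 _] := aff s t Ds Dt; have := in_gZ (s - t)^-1 g1.
  by under eq_fun do rewrite mulrC.
split; first exact: g_cvg_small gq C.
have Dq s : D s -> D1 (fun x => (U s x - U t x) / (s - t))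
    (fun x => ((U s)^`() x - (U t)^`() x) / (s - t)).
  move=> Ds; have [_ D2] := aff s s Ds Ds; have [_ D3] := aff t t Dt Dt.
  exact: D1Zr (D1B D2 D3).
pose proof (fun a b => (g_cvg_cvgto gq a b).1 C) as H.
apply: (cvgto_eq _ (H _ _)).
- by apply: filterS (near_pd_in D t) => s Ds x; rewrite (D1E (Dq s Ds)).
- by apply: filterS (near_pd_in D t) => s Ds; exact: D1_derivable (Dq s Ds).
- exact: D1_derivable (in_g_D1 gV).
Qed.

Lemma tder_g_derivative D U V : (forall t, D t -> in_g (U t)) -> (forall t, D t -> in_g (V t)) ->
  (forall t, D t -> tder true D (fun s => (U s)^`()) ((V t)^`()) t) -> g_derivative_on D U V.
Proof.
move=> gU gV H t Dt; split; first exact: gV.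
have gq : \forall s \near pd D t, in_g (fun x => (U s x - U t x) / (s - t)).
  apply: filterS (near_pd_in D t) => s Ds.
  have := in_gZ (s - t)^-1 (in_gB (gU s Ds) (gU t Dt)).
  by under eq_fun do rewrite mulrC.
apply/g_cvg_cvgto.
- by apply: filterS gq => s g; apply: in_gB => //; exact: gV.
- by apply: filterS gq => s g; exact: D1_derivable (in_g_D1 g).
- exact: D1_derivable (in_g_D1 (gV t Dt)).
apply: cvgto_eq (H t Dt); apply: filterS (near_pd_in D t) => s Ds x.
by rewrite (D1E (D1Zr (s - t) (D1B (in_g_D1 (gU s Ds)) (in_g_D1 (gU t Dt))))).
Qed.

Lemma g_continuous_tcont D U t : g_affine D U -> g_continuous_on D U -> D t ->
  tcont false D U t /\ tcont true D (fun s => (U s)^`()) t.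
Proof.
move=> aff cU Dt; have C := cU t Dt.
have gq : \forall s \near pw D t, in_g (fun x => U s x - U t x).
  by apply: filterS (near_pw_in D t) => s Ds; have [] := aff s t Ds Dt.
split; first exact: g_cvg_small gq C.
apply: (g_cvg_cvgto gq _ _).1 C.
  by apply: filterS (near_pw_in D t) => s Ds; have [_ /D1_derivable] := aff s s Ds Ds.
by have [_ /D1_derivable] := aff t t Dt Dt.
Qed.

Lemma tcont_g_continuous D U : (forall t, D t -> in_g (U t)) ->
  (forall t, D t -> tcont true D (fun s => (U s)^`()) t) -> g_continuous_on D U.
Proof.
move=> gU H t Dt.
apply/g_cvg_cvgto; last exact: H.
- by apply: filterS (near_pw_in D t) => s Ds; apply: in_gB; exact: gU.
- by apply: filterS (near_pw_in D t) => s Ds; exact: D1_derivable (in_g_D1 (gU s Ds)).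
exact: D1_derivable (in_g_D1 (gU t Dt)).
Qed.

Lemma g_derivative_continuous D U V : g_affine D U -> g_derivative_on D U V -> 
  forall t, D t -> tcont false D U t /\ tcont true D (fun s => (U s)^`()) t.
Proof.
move=> aff dU t Dt; have [d1 d2] := g_derivative_tder aff dU Dt.
have [gV _] := dU t Dt.
split; first exact: tder_tcont (in_g_tameF gV) d1.
exact: tder_tcont (in_g_tame gV) d2.
Qed.

End curves.

(** * Eulerian velocities *)

Section eulerian.
Context {R : realType}.

(** The lower bound of the Jacobian is halved to hold at all nearby times. *)
Lemma near_diffeo (FT : set_system R) {FF : Filter FT} (D : set R) (phi psi : R -> R -> R) t :
  (forall s, D s -> in_Diff (phi s)) -> (forall s, D s -> forall y, phi s (psi s y) = y) ->
  D t -> (\forall s \near FT, D s) ->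
  cvgto FT false (fun s => (phi s)^`()) ((phi t)^`()) ->
  exists m, diffeo m (phi t) ((phi t)^`()) (psi t) /\
    \forall s \near FT, diffeo m (phi s) ((phi s)^`()) (psi s).
Proof.
move=> dphi K Dt inD C; have [m d] := Diff_diffeo (dphi t Dt) (K t Dt).
have [m0 _ mp _] := d; exists (m / 2).
have m2 : 0 < m / 2 by rewrite divr_gt0.
split.
  by apply: (diffeo_le m2) d => x; apply: le_trans (mp x); lra.
apply: filterS2 inD (cvgto_ge mp m0 C) => s Ds ge.
have [m' d'] := Diff_diffeo (dphi s Ds) (K s Ds).
exact: diffeo_le d'.
Qed.

Lemma cvgto_comp_curve (FT : set_system R) {FF : Filter FT} (D : set R) (phi psi : R -> R -> R) t b X X0 :
  (forall s, D s -> in_Diff (phi s)) -> (forall s, D s -> forall y, phi s (psi s y) = y) ->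
  D t -> (\forall s \near FT, D s) ->
  cvgto FT false phi (phi t) -> cvgto FT false (fun s => (phi s)^`()) ((phi t)^`()) ->
  tame b X0 -> cvgto FT b X X0 ->
  cvgto FT b (fun s y => X s (psi s y)) (fun y => X0 (psi t y)).
Proof.
move=> dphi K Dt inD C0 C1 mX CX.
have [m [d dn]] := near_diffeo dphi K Dt inD C1.
apply: (cvgto_comp dn d) => //; first exact: Diff_tame (dphi t Dt).
by move=> e e0; apply: filterS (C0 0%N e e0) => s; exact: bdk_sup.
Qed.

(** The [x]-derivative of [u] is [(phi_tx / phi_x) o phi^-1], to which [dif_comp]
applies; as elements of [g] are determined by their derivatives, this suffices.
The value of [u_t] is the acceleration minus the convective term. *)
Lemma eulerian_C1 (D : set R) (phi phit phitt u : R -> R -> R) :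
  (forall t, D t -> in_Diff (phi t)) -> g_derivative_on D phi phit ->
  C1_curve_g D phit phitt -> eulerian_velocity D phit phi u ->
  exists ut, C1_curve_g D u ut /\
    forall t, D t -> forall x,
      phitt t x = ut t (phi t x) + (u t)^`() (phi t x) * phit t x.
Proof.
move=> dphi dphit [gphit dphitt cphitt] eul.
have [psi K] : exists psi : R -> R -> R, forall t, D t -> forall y, phi t (psi t y) = y.
  have H t : exists p : R -> R, D t -> forall y, phi t (p y) = y.
    have [Dt|nDt] := pselect (D t); last by exists id.
    by have [p Hp] := Diff_surj (dphi t Dt); exists p.
  by have [psi Hpsi] := choice H; exists psi => t; exact: Hpsi.
have gphitt t : D t -> in_g (phitt t) by move=> /dphitt[].
have mV t : D t -> tame false (fun x => ((phi t)^`() x)^-1) by move=> /dphi/tame_invD.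
have mP t : D t -> tame true ((phit t)^`()) by move=> /gphit/in_g_tame.
have mPP t : D t -> tame true ((phitt t)^`()) by move=> /gphitt/in_g_tame.
pose X s x := (phit s)^`() x * ((phi s)^`() x)^-1.
have mX t : D t -> tame true (X t) by move=> Dt; have := tameM (mP t Dt) (mV t Dt).
have psiK t : D t -> forall x, psi t (phi t x) = x.
  by move=> Dt; have [m d] := Diff_diffeo (dphi t Dt) (K t Dt); exact: diffeoK d.
have uE t : D t -> u t = (fun y => phit t (psi t y)).
  move=> Dt; apply/funext => y; have := congr1 (@^~ (psi t y)) (eul t Dt).
  by rewrite /= K.
have Dpsi t : D t -> D1 (psi t) (fun y => ((phi t)^`() (psi t y))^-1).
  by move=> Dt; have [m d] := Diff_diffeo (dphi t Dt) (K t Dt); exact: diffeo_D1 d.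
have Du t : D t -> D1 (u t) (fun y => X t (psi t y)).
  by move=> Dt; rewrite uE //; exact: D1_comp (in_g_D1 (gphit t Dt)) (Dpsi t Dt).
have gu t : D t -> in_g (u t).
  by move=> Dt; rewrite uE //; apply: (in_g_comp (dphi t Dt) (K t Dt)); exact: gphit.
(* X and W are u_x and u_t pulled back by phi. *)
pose W t x := phitt t x - X t x * phit t x.
have gW t : D t -> in_g (W t).
  move=> Dt; apply: in_gB; first exact: gphitt.
  by apply: in_gM; [exact: mX|exact: gphit].
pose ut t y := W t (psi t y).
have gut t : D t -> in_g (ut t).
  by move=> Dt; apply: (in_g_comp (dphi t Dt) (K t Dt)); exact: gW.
pose W' t x := (phitt t)^`() x - ((X t)^`() x * phit t x + X t x * (phit t)^`() x).
have DW t : D t -> D1 (W t) (W' t).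
  move=> Dt; apply: D1B (in_g_D1 (gphitt t Dt)) _.
  exact: D1M (tame_D1 (mX t Dt)) (in_g_D1 (gphit t Dt)).
have Dut t : D t -> D1 (ut t) (fun y => W' t (psi t y) * ((phi t)^`() (psi t y))^-1).
  by move=> Dt; exact: D1_comp (DW t Dt) (Dpsi t Dt).
have aphi := Diff_affine dphi; have aphit := in_g_affine gphit.
have phin0 t x : D t -> (phi t)^`() x != 0.
  by move=> Dt; rewrite gt_eqF // Diff_gt0 //; exact: dphi.
exists ut; split; last first.
  move=> t Dt x; rewrite (D1E (Du t Dt)) /ut /W psiK //; ring.
split; first exact: gu.
- apply: (tder_g_derivative gu gut) => t Dt.
  have [p1 p2] := g_derivative_tder aphi dphit Dt.
  have [q1 q2] := g_derivative_tder aphit dphitt Dt.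
  have mp1 := in_g_tameF (gphit t Dt); have mp2 := in_g_tame (gphit t Dt).
  pose proof (tder_cont mp1 p1) as C0.
  pose proof (cvgto_false (tder_cont mp2 p2)) as C1.
  pose proof (near_diffeo dphi K Dt (near_pd_in D t) C1) as [m [d dn]].
  have [m0 _ mge _] := d.
  have n0 := near_pd_neq D t; have h0 := near_pd_small D t.
  have mphi := Diff_tame (dphi t Dt).
  pose proof (difV n0 h0 m0 mge mphi (tame_false mp2) (cvgto_false p2)) as dV.
  pose proof (difM n0 h0 (mP t Dt) (mV t Dt) (mPP t Dt)
    (tameN (tameM (tame_false mp2) (tameM (mV t Dt) (mV t Dt)))) q2 dV) as dX.
  have Ddp := in_g_D1 (gphit t Dt).
  have d0 e : 0 < e -> \forall s \near pd D t, forall x, `|(phi s x - phi t x) / (s - t) - phit t x| <= e.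
    by move=> e0; apply: filterS (p1 0%N e e0) => s; exact: bdk_sup.
  have c0 e : 0 < e -> \forall s \near pd D t, forall x, `|phi s x - phi t x| <= e.
    by move=> e0; apply: filterS (C0 0%N e e0) => s; exact: bdk_sup.
  have mX' : tame true (fun x => (phitt t)^`() x * ((phi t)^`() x)^-1 +
      (phit t)^`() x * - ((phit t)^`() x * (((phi t)^`() x)^-1 * ((phi t)^`() x)^-1))).
    apply: tameD; first exact: tameM (mPP t Dt) (mV t Dt).
    exact: tameM (mP t Dt) (tameN (tameM (tame_false mp2) (tameM (mV t Dt) (mV t Dt)))).
  pose proof (dif_comp dn d mphi c0 C1 n0 h0 Ddp mp1 d0 (cvgto_false p2) (mX t Dt) mX' dX) as H.
  rewrite /tder (D1E (Du t Dt)).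
  apply: (cvgto_eq (X := fun s y => (X s (psi s y) - X t (psi t y)) / (s - t))).
    by apply: filterS (near_pd_in D t) => s Ds x; rewrite (D1E (Du s Ds)).
  apply: (cvgto_ext H) => // y; rewrite (D1E (Dut t Dt)) /W' /X.
  by field; rewrite phin0.
apply: (tcont_g_continuous gut) => t Dt.
have [p1 p2] := g_derivative_continuous aphi dphit Dt.
have [q1 q2] := g_derivative_continuous aphit dphitt Dt.
have agut := in_g_affine gphitt.
have [r1 r2] := g_continuous_tcont agut cphitt Dt.
have mp1 := in_g_tameF (gphit t Dt); have mp2 := in_g_tame (gphit t Dt).
have [m m0 mge] := Diff_ge (dphi t Dt).
have mphi := Diff_tame (dphi t Dt).
pose proof (cvgtoV m0 mge mphi (cvgto_false p2)) as cV.
pose proof (cvgtoM (mP t Dt) (mV t Dt) q2 cV) as cX.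
pose proof (cvgto_derive (mX t Dt) cX) as cX'.
have mXt := mX t Dt; have mX' := tame_derive mXt.
pose proof (cvgtoM (tameB (mPP t Dt) (tameD (tameM mX' mp1) (tameM mXt (tame_false mp2)))) (mV t Dt)
  (cvgtoB r2 (cvgtoD (cvgtoM mX' mp1 cX' q1) (cvgtoM mXt (tame_false mp2) cX (cvgto_false q2)))) cV) as cY.
have mY := tameM (tameB (mPP t Dt) (tameD (tameM mX' mp1) (tameM mXt (tame_false mp2)))) (mV t Dt).
pose proof (cvgto_comp_curve dphi K Dt (near_pw_in D t) p1 (cvgto_false p2) mY cY) as H.
rewrite /tcont (D1E (Dut t Dt)).
apply: cvgto_eq H; apply: filterS (near_pw_in D t) => s Ds x.
by rewrite (D1E (Dut s Ds)).
Qed.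

End eulerian.

(** * Real powers *)

Section power.
Context {R : realType}.
Implicit Types (A : R -> R) (r : R).

Lemma D1_powR A A' r : (forall x, 0 < A x) -> D1 A A' ->
  D1 (fun x => A x `^ r) (fun x => r * A x `^ (r - 1) * A' x).
Proof.
move=> A0 D x; exact: (is_derive1_comp (is_derive1_powR r (A0 x)) (D x)).
Qed.

Lemma powR_MVT r (y z : R) : 0 < y -> 0 < z ->
  exists c, (Num.min y z <= c <= Num.max y z) /\ z `^ r - y `^ r = r * c `^ (r - 1) * (z - y).
Proof.
move=> y0 z0.
wlog yz : y z y0 z0 / y <= z.
  move=> W; have /orP[|zy] := le_total y z; first exact: W.
  have [c [cI E]] := W z y z0 y0 zy; exists c; split; first by rewrite minC maxC.
  by rewrite -opprB E -mulrN opprB.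
have d x : y <= x -> is_derive x (1 : R) (fun x => x `^ r) (r * x `^ (r - 1)).
  by move=> yx; apply: is_derive1_powR; exact: lt_le_trans yx.
have cf : {within `[y, z], continuous (fun x : R => x `^ r)}.
  apply: continuous_in_subspaceT => x; rewrite inE /= in_itv /= => /andP[yx _].
  by apply/differentiable_continuous/derivable1_diffP; have [] := d x yx.
have d' x : x \in `]y, z[%R -> is_derive x (1 : R) (fun x => x `^ r) (r * x `^ (r - 1)).
  by rewrite in_itv /= => /andP[/ltW yx _]; exact: d.
have [c cI E] := MVT_segment yz d' cf; move: cI; rewrite in_itv /= => cI.
by exists c; split=> //; rewrite (min_idPl yz) (max_idPr yz).
Qed.

Lemma powR_bd r (m M : R) : 0 < m -> exists C, 0 <= C /\ forall y, m <= y <= M -> `|y `^ r| <= C.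
Proof.
move=> m0; have [mM|Mm] := leP m M; last first.
  by exists 0; split=> // y /andP[my yM]; have := le_lt_trans (le_trans my yM) Mm; rewrite ltxx.
have cf : {within `[m, M], continuous (fun x : R => x `^ r)}.
  apply: continuous_in_subspaceT => x; rewrite inE /= in_itv /= => /andP[yx _].
  have [d _] := is_derive1_powR r (lt_le_trans m0 yx).
  by apply/differentiable_continuous/derivable1_diffP.
have [c _ H] := EVT_max mM cf.
exists (c `^ r); split; first exact: powR_ge0.
by move=> y yI; rewrite ger0_norm ?powR_ge0 // H // in_itv.
Qed.

Lemma between_le (y z c : R) : Num.min y z <= c <= Num.max y z -> `|c - y| <= `|z - y|.
Proof.
rewrite ge_min le_max => /andP[]; have := ler_norm (z - y); have := ler_norm (y - z).
rewrite [`|y - z|]distrC => h1 h2; rewrite ler_norml.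
by case/orP => a1 /orP[] a2; apply/andP; split; lra.
Qed.

Lemma between_in (m M y z c : R) : Num.min y z <= c <= Num.max y z ->
  m <= y <= M -> m <= z <= M -> m <= c <= M.
Proof.
rewrite ge_min le_max => /andP[c1 c2] /andP[y1 y2] /andP[z1 z2].
by case/orP: c1 => c1; case/orP: c2 => c2; apply/andP; split; lra.
Qed.

Lemma powR_lip r (m M : R) : 0 < m -> exists C, 0 <= C /\ forall y z,
  m <= y <= M -> m <= z <= M -> `|z `^ r - y `^ r| <= C * `|z - y|.
Proof.
move=> m0; have [C [C0 HC]] := powR_bd (r - 1) M m0.
exists (`|r| * C); split=> [|y z yI zI]; first by rewrite mulr_ge0.
have y0 : 0 < y by case/andP: yI => /(lt_le_trans m0).
have z0 : 0 < z by case/andP: zI => /(lt_le_trans m0).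
have [c [cI ->]] := powR_MVT r y0 z0.
rewrite !normrM; apply: ler_wpM2r => //; apply: ler_wpM2l => //; apply: HC.
exact: between_in cI yI zI.
Qed.

Lemma powR_taylor r (m M : R) : 0 < m -> exists C, 0 <= C /\ forall y z,
  m <= y <= M -> m <= z <= M ->
  `|z `^ r - y `^ r - r * y `^ (r - 1) * (z - y)| <= C * (z - y) ^+ 2.
Proof.
move=> m0; have [C [C0 HC]] := powR_lip (r - 1) M m0.
exists (`|r| * C); split=> [|y z yI zI]; first by rewrite mulr_ge0.
have y0 : 0 < y by case/andP: yI => /(lt_le_trans m0).
have z0 : 0 < z by case/andP: zI => /(lt_le_trans m0).
have [c [cI ->]] := powR_MVT r y0 z0.
have -> : r * c `^ (r - 1) * (z - y) - r * y `^ (r - 1) * (z - y) =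
  r * ((c `^ (r - 1) - y `^ (r - 1)) * (z - y)) by ring.
rewrite !normrM -(@real_normK _ (z - y)) ?num_real // -!mulrA.
apply: ler_wpM2l => //; rewrite expr2 mulrA; apply: ler_wpM2r => //.
apply: le_trans (HC _ _ yI (between_in cI yI zI)) _; apply: ler_wpM2l => //.
exact: between_le.
Qed.

Lemma continuous_powR A r : continuous A -> (forall x, 0 < A x) -> continuous (fun x => A x `^ r).
Proof.
move=> cA A0 x; apply: (@continuous_comp _ _ _ A (fun y => y `^ r)); first exact: cA.
have [d _] := is_derive1_powR r (A0 x).
by apply/differentiable_continuous/derivable1_diffP.
Qed.

Lemma bdk_powR k r (m M : R) : 0 < m -> exists C, forall A, (forall x, m <= A x) ->
  bdk false k M A -> bdk false k C (fun x => A x `^ r).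
Proof.
move=> m0; elim: k r => [|k IH] r; have [C0 [C00 HC0]] := powR_bd r M m0.
  exists C0 => A mA [[cA sA _] _]; split=> //; split=> // [|x].
    by apply: continuous_powR => // x; exact: lt_le_trans (mA x).
  by apply: HC0; rewrite mA /=; apply: le_trans (sA x); exact: ler_norm.
have [C1 HC1] := IH (r - 1).
exists (Num.max C0 (2 ^+ k * (`|r| * C1 * M))) => A mA BA.
have A0 x : 0 < A x by exact: lt_le_trans (mA x).
have BA' := bdkS BA; have BA0 := bdk_sup BA.
apply: (bdkSI (D1_powR r A0 (bdkS_D1 BA))).
  split=> // [|x]; first exact: continuous_powR (bdk_cont BA) A0.
  apply: le_trans (_ : C0 <= _); last by rewrite le_max lexx.
  by apply: HC0; rewrite mA /=; apply: le_trans (BA0 x); exact: ler_norm.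
have := bdkM (bdkZ r (HC1 A mA (bdk_k BA))) BA'.
by apply: bdk_le; rewrite le_max lexx orbT.
Qed.

Lemma tame_powR A r m : 0 < m -> (forall x, m <= A x) -> tame false A -> tame false (fun x => A x `^ r).
Proof.
move=> m0 mA tame_A k; have [M B] := tame_A k; have [C H] := bdk_powR k r M m0.
by exists C; exact: H.
Qed.

(** At order [0] this is Taylor's formula for [y ^ r]; the derivative of the error
involves the same quotient for the power [r - 1], hence the induction. *)
Lemma dif_powR {T : Type} (FT : set_system T) {FF : Filter FT} (h : T -> R)
  (X : T -> R -> R) (X0 X' : R -> R) (m r : R) :
  (\forall p \near FT, h p != 0) -> (forall e : R, 0 < e -> \forall p \near FT, `|h p| <= e) ->
  0 < m -> (forall x, m <= X0 x) -> tame false X0 -> tame false X' ->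
  dif FT h false X X0 X' ->
  dif FT h false (fun p x => X p x `^ r) (fun x => X0 x `^ r) (fun x => r * X0 x `^ (r - 1) * X' x).
Proof.
move=> hn0 h0 m0 mX mX0 mX' dX k.
pose proof (dif_cvgto hn0 h0 mX' dX) as C.
have m2 : 0 < m / 2 by rewrite divr_gt0.
have X00 x : 0 < X0 x by exact: lt_le_trans (mX x).
pose proof (cvgto_ge mX m0 C) as ge.
have mX2 x : m / 2 <= X0 x by apply: le_trans (mX x); lra.
have base q e : 0 < e -> \forall p \near FT, bd false e
    (fun x => (X p x `^ q - X0 x `^ q) / h p - q * X0 x `^ (q - 1) * X' x).
  move=> e0; have [M0 B0] := mX0 0%N; have [M' B'] := mX' 0%N.
  have [M HM] := cvgto_bd 0 mX0 C.
  pose N := Num.max M0 M.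
  have [K [K0 HK]] := powR_taylor q N m2.
  have [L [L0 HL]] := powR_bd (q - 1) N m2.
  have M'0 := bdk_ge0 B'.
  have e2 : 0 < e / 2 by rewrite divr_gt0.
  pose c1 := `|q| * L; have c10 : 0 <= c1 by rewrite mulr_ge0.
  pose c2 := K * (M' + 1) ^+ 2; have c20 : 0 <= c2 by rewrite mulr_ge0 ?sqr_ge0.
  have e3 : 0 < e / 2 / (c1 + 1) by rewrite divr_gt0 // ltr_wpDl.
  have e4 : 0 < e / 2 / (c2 + 1) by rewrite divr_gt0 // ltr_wpDl.
  near=> p.
  have hp : h p != 0 by near: p.
  have gep : forall x, m / 2 <= X p x by near: p.
  have BM : bdk false 0 M (X p) by near: p.
  have q1 : bdk false 0 1 (fun x => (X p x - X0 x) / h p - X' x) by near: p; exact: dX.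
  have q2 : bdk false 0 (e / 2 / (c1 + 1)) (fun x => (X p x - X0 x) / h p - X' x).
    by near: p; exact: dX.
  have hs : `|h p| <= e / 2 / (c2 + 1) by near: p; exact: h0.
  have Xp0 x : 0 < X p x by exact: lt_le_trans (gep x).
  have X0I x : m / 2 <= X0 x <= N.
    rewrite mX2 /N le_max; apply/orP; left; apply: le_trans (bdk_sup B0 x); exact: ler_norm.
  have XpI x : m / 2 <= X p x <= N.
    rewrite gep /N le_max; apply/orP; right; apply: le_trans (bdk_sup BM x); exact: ler_norm.
  have cXp := bdk_cont BM; have cX0 := bdk_cont B0; have cX' := bdk_cont B'.
  split=> // [|x].
    apply: continuousB_fun.
      apply: continuousM_fun; last by move=> x; exact: cst_continuous.
      by apply: continuousB_fun; apply: continuous_powR.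
    apply: continuousM_fun => //; apply: continuousM_fun; first by move=> x; exact: cst_continuous.
    by apply: continuous_powR.
  have -> : (X p x `^ q - X0 x `^ q) / h p - q * X0 x `^ (q - 1) * X' x =
     q * X0 x `^ (q - 1) * ((X p x - X0 x) / h p - X' x)
     + (X p x `^ q - X0 x `^ q - q * X0 x `^ (q - 1) * (X p x - X0 x)) / h p.
    by field.
  apply: le_trans (ler_normD _ _) _; rewrite [leRHS]splitr; apply: lerD.
    rewrite normrM; apply: le_trans (_ : c1 * (e / 2 / (c1 + 1)) <= _).
      apply: ler_pM => //; last exact: bdk_sup q2 x.
      by rewrite /c1 normrM; apply: ler_wpM2l => //; exact: HL.
    by apply: mul_divr_le => //; exact: ltW.
  rewrite normrM normfV ler_pdivrMr ?normr_gt0 //.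
  apply: le_trans (HK _ _ (X0I x) (XpI x)) _.
  have le1 : (X p x - X0 x) ^+ 2 <= (M' + 1) ^+ 2 * `|h p| * `|h p|.
    rewrite -real_normK ?num_real // -mulrA -expr2 -exprMn lerXn2r ?nnegrE ?mulr_ge0 ?addr_ge0 //.
    rewrite -ler_pdivrMr ?normr_gt0 // -normfV -normrM.
    rewrite -[(X p x - X0 x) / h p](subrK (X' x)); apply: le_trans (ler_normD _ _) _.
    by rewrite addrC; apply: lerD; [exact: bdk_sup B' x|exact: bdk_sup q1 x].
  apply: le_trans (ler_wpM2l K0 le1) _; rewrite !mulrA; apply: ler_wpM2r => //.
  have -> : K * (M' + 1) * (M' + 1) * `|h p| = c2 * `|h p| by rewrite /c2 expr2 !mulrA.
  apply: le_trans (ler_wpM2l c20 hs) _.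
  by apply: mul_divr_le => //; exact: ltW.
elim: k r => [|k IH] r e e0; first by apply: filterS (base r e e0) => p.
have mp1 := tame_powR (r - 1) m0 mX mX0.
have mp2 := tame_powR (r - 1 - 1) m0 mX mX0.
have mX0' := tame_derive mX0; have mX'' := tame_derive mX'.
pose proof (cvgto_bd k mX0' (cvgto_derive mX0 C)) as [M HM].
have [N HN] := cvgto_bd 1 mX0 C.
pose Z x := (r - 1) * X0 x `^ (r - 1 - 1) * X' x.
have mZ : tame false Z.
  by apply: (tameM (b1 := false) (b2 := false)) => //; exact: tameZ.
pose proof (small_bdM HM (IH (r - 1))) as S1.
pose proof (small_tameM mZ (cvgto_derive mX0 C k)) as S2.
pose proof (small_tameM mp1 (dif_derive mX0 mX' C dX k)) as S3.
pose proof (small_tameM (tame_cst r) (smallD (smallD S1 S2) S3)) as Sr.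
near=> p.
have gep : forall x, m / 2 <= X p x by near: p.
have Xp0 x : 0 < X p x by exact: lt_le_trans (gep x).
have DX : D1 (X p) ((X p)^`()).
  suff : bdk false 1 N (X p) by exact: bdkS_D1.
  by near: p.
have DX0 := tame_D1 mX0; have DX' := tame_D1 mX'.
have E := D1B (D1Zr (h p) (D1B (D1_powR r Xp0 DX) (D1_powR r X00 DX0)))
  (D1M (D1Z r (D1_powR (r - 1) X00 DX0)) DX').
apply: (bdkSI E); first by near: p; exact: base.
suff : bdk false k e (fun x => r * (((X p)^`() x * ((X p x `^ (r - 1) - X0 x `^ (r - 1)) / h p -
   (r - 1) * X0 x `^ (r - 1 - 1) * X' x) + Z x * ((X p)^`() x - X0^`() x))
   + X0 x `^ (r - 1) * (((X p)^`() x - X0^`() x) / h p - X'^`() x))).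
  by apply: bdk_eq => x; rewrite /Z; ring.
by near: p; exact: Sr.
Unshelve. all: by end_near. Qed.

End power.

(** * Continuous induction *)

Section real_induction.
Context {R : realType}.

(** Consider the supremum of the [s] such that [P] holds on [[a, s]]. *)
Lemma real_induction (P : R -> Prop) (a b : R) : a <= b -> P a ->
  (forall s, a <= s < b -> P s -> exists2 d, 0 < d & forall r, s < r -> r <= s + d -> r <= b -> P r) ->
  (forall s, a < s <= b -> (forall r, a <= r < s -> P r) -> P s) -> P b.
Proof.
move=> ab Pa step lim.
pose E := [set s | a <= s <= b /\ forall r, a <= r <= s -> P r].
have Ea : E a.
  split; first by rewrite lexx.
  by move=> r /andP[ra ar]; have -> : r = a by apply/eqP; rewrite eq_le ar ra.
have hE : has_sup E.
  by split; [exists a|exists b => s [/andP[]]].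
pose c := sup E.
have ac : a <= c by apply: ub_le_sup => //; exact: hE.2.
have cb : c <= b by apply: ge_sup; [exists a|move=> s [/andP[]]].
have below r : a <= r < c -> P r.
  move=> /andP[ar rc]; have cr : 0 < c - r by rewrite subr_gt0.
  have [s [_ Ps] rs] := sup_adherent cr hE.
  by apply: Ps; rewrite ar /=; move: rs; rewrite -/c subKr => /ltW.
have Pc : P c.
  by move: ac; rewrite le_eqVlt => /predU1P[<-//|ac]; apply: lim; rewrite ?ac.
have [cb'|bc] := ltP c b; last by have <- : c = b by apply/eqP; rewrite eq_le cb bc.
have [d d0 Hd] := step c (introT andP (conj ac cb')) Pc.
pose c' := Num.min (c + d) b.
have cc' : c < c' by rewrite lt_min cb' ltrDl d0.
have : E c'.
  split; first by rewrite (le_trans ac (ltW cc')) /= ge_min lexx orbT.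
  move=> r /andP[ar rc']; have [rc|cr|->//] := ltgtP r c; first by apply: below; rewrite ar.
  by move: rc'; rewrite le_min => /andP[r1 r2]; exact: Hd.
by move=> Ec'; have := ub_le_sup hE.2 Ec'; rewrite leNgt cc'.
Qed.

End real_induction.

Section mean_value.
Context {R : realType}.
Notation mu := (@lebesgue_measure R).

Lemma near_pd_ex (D : set R) t (P : R -> Prop) : (\forall s \near pd D t, P s) ->
  exists2 d, 0 < d & forall s, D s -> s != t -> `|s - t| < d -> P s.
Proof.
rewrite near_withinE => H.
have H' : \forall s \near t, s != t -> D s -> P s by exact: H.
have [d /= d0 Hd] := H'; exists d => // s Ds st sd; apply: Hd => //.
by rewrite /ball_ /= distrC.
Qed.

Lemma near_pw_ex (D : set R) t (P : R -> Prop) : (\forall s \near pw D t, P s) ->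
  exists2 d, 0 < d & forall s, D s -> `|s - t| < d -> P s.
Proof.
rewrite near_withinE => H.
have [d /= d0 Hd] := H; exists d => // s Ds sd; apply: Hd => //.
by rewrite /ball_ /= distrC.
Qed.

Lemma bd_closed b (e : R) f : continuous f -> (forall d : R, 0 < d -> bd b (e + d) f) -> bd b e f.
Proof.
move=> cf H; split=> // [x|bt].
  by apply/ler_addgt0Pr => d d0; have [_ + _] := H d d0; apply.
by apply/lee_addgt0Pr => d d0; have [_ _ /(_ bt)] := H d d0; rewrite EFinD.
Qed.

Lemma bd_eq b (e : R) f g : (forall x, f x = g x) -> bd b e f -> bd b e g.
Proof. by move=> /funext ->. Qed.

(** Continuous induction on the increment from [a], with slope [C + e]. *)
Lemma bd_mean_value b (D : set R) (Y Y' : R -> R -> R) (C a c : R) : a <= c ->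
  (forall s, a <= s <= c -> D s) ->
  (forall s, D s -> tder b D Y (Y' s) s) ->
  (forall s, D s -> tame b (Y' s)) ->
  (forall s, D s -> bd b C (Y' s)) ->
  bd b (C * (c - a)) (fun x => Y c x - Y a x).
Proof.
move=> ac inD dY mY' BC.
have C0 : 0 <= C by apply: bd_ge0 (BC a _); apply: inD; rewrite lexx.
suff W e : 0 < e -> bd b ((C + e) * (c - a)) (fun x => Y c x - Y a x).
  have cc : continuous (fun x => Y c x - Y a x) by have [] := W 1 ltr01.
  apply: bd_closed cc _ => d d0.
  have ca : 0 < c - a + 1 by rewrite ltr_wpDl // subr_ge0.
  have := W (d / (c - a + 1)); rewrite divr_gt0 // => /(_ isT).
  apply: bd_le; rewrite mulrDl lerD2l mulrC.
  by apply: mul_divr_le; [rewrite subr_ge0|exact: ltW].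
move=> e0.
apply: (@real_induction R (fun s => bd b ((C + e) * (s - a)) (fun x => Y s x - Y a x)) a c ac).
- rewrite subrr mulr0; apply: (bdk0 (k := 0)); apply: bdk_eq0 => // x; exact: subrr.
- move=> s /andP[as_ sc] Bs.
  have Ds : D s by apply: inD; rewrite as_ ltW.
  have [d d0 Hd] := near_pd_ex (dY s Ds 0%N e e0).
  exists (d / 2) => [|r sr rd rc]; first by rewrite divr_gt0.
  have Dr : D r by apply: inD; rewrite rc andbT (le_trans as_) // ltW.
  have rs0 : 0 < r - s by rewrite subr_gt0.
  have Br : bd b e (fun x => (Y r x - Y s x) / (r - s) - Y' s x).
    by apply: (bdk0 (k := 0)); apply: Hd => //; [rewrite gt_eqF|rewrite gtr0_norm //; lra].
  have := bdD Bs (bdZ (r - s) (bdD Br (BC s Ds))).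
  have -> : (C + e) * (s - a) + `|r - s| * (e + C) = (C + e) * (r - a).
    by rewrite gtr0_norm //; ring.
  by apply: bd_eq => x; field; rewrite gt_eqF.
move=> s /andP[as_ sc] H.
have Ds : D s by apply: inD; rewrite sc ltW.
have sma : forall d : R, 0 < d -> exists r, [/\ a <= r, r < s & bd b d (fun x => Y s x - Y r x)].
  move=> d d0; have Cs := tder_tcont (mY' s Ds) (dY s Ds).
  have [d1 d10 Hd] := near_pw_ex (Cs 0%N d d0).
  pose r := Num.max a (s - d1 / 2).
  have rs : r < s by rewrite gt_max as_ /=; lra.
  have ar : a <= r by rewrite le_max lexx.
  exists r; split=> //.
  have Dr : D r by apply: inD; rewrite ar (le_trans (ltW rs)).
  have : bd b d (fun x => Y r x - Y s x).
    apply: (bdk0 (k := 0)); apply: Hd => //; rewrite ltr0_norm ?subr_lt0 //.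
    have : s - d1 / 2 <= r by rewrite le_max lexx orbT.
    lra.
  move=> /(bdZ (-1)); rewrite normrN normr1 mul1r; apply: bd_eq => x; ring.
have cs : continuous (fun x => Y s x - Y a x).
  have [r [ar rs B]] := sma 1 ltr01.
  have [c1 _ _] := bdD B (H r (introT andP (conj ar rs))).
  by apply: continuous_eqf c1 => x; rewrite addrA subrK.
apply: bd_closed cs _ => d d0.
have [r [ar rs B]] := sma d d0.
apply: (@bd_eq _ _ (fun x => Y s x - Y r x + (Y r x - Y a x))).
  by move=> x; rewrite addrA subrK.
apply: bd_le (bdD B (H r (introT andP (conj ar rs)))).
by rewrite addrC lerD2r; apply: ler_wpM2l; [rewrite addr_ge0 // ltW|lra].
Qed.

End mean_value.

(** * Integrals of curves of functions *)

Section Rint.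
Context {R : realType}.
Notation mu := (@lebesgue_measure R).

Definition Rint (f : R -> R) : R := Rintegral mu setT f.

Lemma bd_integrable (e : R) f : bd true e f -> mu.-integrable setT (EFin \o f).
Proof. by move=> [cf _ /(_ isT) I]; apply/integrable_L1 => //; exists e. Qed.

Lemma Rint_le (e : R) f : bd true e f -> `|Rint f| <= e.
Proof.
move=> B; have I := bd_integrable B; have [_ _ /(_ isT) L] := B.
apply: le_trans (le_normr_Rintegral measurableT I) _.
rewrite /Rintegral -lee_fin fineK //.
by have := integrable_fin_num measurableT (integrable_abse I).
Qed.

Lemma RintD (e d : R) f g : bd true e f -> bd true d g ->
  Rint (fun x => f x + g x) = Rint f + Rint g.
Proof. by move=> /bd_integrable I /bd_integrable J; exact: RintegralD. Qed.

Lemma RintB (e d : R) f g : bd true e f -> bd true d g ->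
  Rint (fun x => f x - g x) = Rint f - Rint g.
Proof. by move=> /bd_integrable I /bd_integrable J; exact: RintegralB. Qed.

Lemma RintZ (e c : R) f : bd true e f -> Rint (fun x => c * f x) = c * Rint f.
Proof. by move=> /bd_integrable I; exact: RintegralZl. Qed.

Lemma Rint_eq f g : (forall x, f x = g x) -> Rint f = Rint g.
Proof. by move=> /funext ->. Qed.

Lemma is_derive_eps (f : R -> R) (t l : R) :
  (forall e : R, 0 < e -> \forall s \near t, `|f s - f t - l * (s - t)| <= e * `|s - t|) ->
  is_derive t (1 : R) f l.
Proof.
move=> H.
have C : h^-1 *: ((f \o shift t) (h *: (1 : R)) - f t) @[h --> 0^'] --> l.
  apply/cvgrPdist_le => e e0.
  have [d /= d0 Hd] := H e e0.
  rewrite /dnbhs near_withinE; exists d => // h /= hd h0.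
  rewrite sub0r normrN in hd.
  have := Hd (h + t); rewrite /ball_ /= opprD addrCA subrr addr0 normrN => /(_ hd).
  rewrite addrK /GRing.scale /= mulr1 => le.
  have -> : l - h^-1 * (f (h + t) - f t) = - ((f (h + t) - f t - l * h) / h) by field.
  by rewrite normrN normrM normfV ler_pdivrMr ?normr_gt0.
apply: DeriveDef; first by apply/cvg_ex; exists l.
exact: cvg_lim C.
Qed.

Lemma is_derive_quad (f : R -> R) (l d K : R) : 0 < d ->
  (forall s, `|s| <= d -> `|f s - f 0 - l * s| <= K * s ^+ 2) -> is_derive (0 : R) (1 : R) f l.
Proof.
move=> d0 H; apply: is_derive_eps => e e0.
have q0 : 0 < e / (`|K| + 1) by rewrite divr_gt0 // ltr_wpDl.
exists (Num.min d (e / (`|K| + 1))); first by rewrite /= lt_min d0.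
move=> s; rewrite /ball_ /= sub0r normrN lt_min => /andP[/ltW sd /ltW se].
rewrite subr0; apply: le_trans (H s sd) _.
rewrite -real_normK ?num_real // expr2 mulrA; apply: ler_wpM2r => //.
apply: le_trans (ler_wpM2r (normr_ge0 _) (ler_norm K)) _.
apply: le_trans (ler_wpM2l (normr_ge0 K) se) _.
by apply: mul_divr_le => //; exact: ltW.
Qed.

Lemma Rint_within_continuous (D : set R) (Y : R -> R -> R) :
  (forall t, D t -> tame true (Y t)) -> (forall t, D t -> tcont true D Y t) ->
  {within D, continuous (fun t => Rint (Y t))}.
Proof.
move=> mY cY; apply/subspace_continuousP => t Dt.
apply/cvgrPdist_le => e e0.
apply: filterS2 (near_pw_in D t) (cY t Dt 0%N e e0) => s Ds /bdk0 B.
have [M /bdk0 BM] := mY t Dt 0%N; have [N /bdk0 BN] := mY s Ds 0%N.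
by rewrite distrC -(RintB BN BM); exact: Rint_le.
Qed.

Lemma Rint_is_derive (D : set R) (Y : R -> R -> R) Y' t : (\forall s \near t, D s) ->
  (forall t, D t -> tame true (Y t)) -> tame true Y' -> tder true D Y Y' t ->
  is_derive t (1 : R) (fun t => Rint (Y t)) (Rint Y').
Proof.
move=> nD mY mY' dY; have Dt : D t by exact: nbhs_singleton nD.
apply: is_derive_eps => e e0.
have [d d0 Hd] := near_pd_ex (dY 0%N e e0).
have [M /bdk0 BM] := mY t Dt 0%N; have [K /bdk0 BK] := mY' 0%N.
have nd : \forall s \near t, `|s - t| < d.
  by exists d => //= s; rewrite /ball_ /= distrC.
apply: filterS2 nD nd => s Ds sd.
have [->|st] := eqVneq s t; first by rewrite !subrr mulr0 subrr normr0 mulr0.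
have [N /bdk0 BN] := mY s Ds 0%N.
have /bdk0 B := Hd s Ds st sd.
have st0 : s - t != 0 by rewrite subr_eq0.
have E : Rint (Y s) - Rint (Y t) - Rint Y' * (s - t) =
    (s - t) * Rint (fun x => (Y s x - Y t x) / (s - t) - Y' x).
  rewrite -(RintB BN BM) mulrC -(RintZ (s - t) BK) -(RintZ (s - t) B).
  have B2 := bdZ (s - t) BK.
  have B1 : bd true (N + `|-1| * M) (fun x => Y s x - Y t x).
    by apply: bd_eq (bdD BN (bdZ (-1) BM)) => x; rewrite mulN1r.
  rewrite -(RintB B1 B2).
  by apply: Rint_eq => x; field.
by rewrite E normrM mulrC; apply: ler_wpM2r => //; exact: Rint_le.
Qed.

End Rint.

(** * Uniqueness of time derivatives *)

Section uniqueness.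
Context {R : realType}.

(** In a nondegenerate interval every point is a limit of others, which makes
one-sided derivatives unique. *)
Lemma pd_proper (D : set R) (t : R) : is_interval D -> (exists p q, [/\ D p, D q & p < q]) ->
  D t -> ProperFilter (pd D t).
Proof.
move=> iD [p [q [Dp Dq pq]]] Dt; apply: Build_ProperFilter_ex => P H.
have [d d0 Hd] := near_pd_ex H.
have W r : D r -> r != t -> exists x, P x.
  move=> Dr rt; pose l := Num.min 1 (d / 2 / `|r - t|).
  have rt0 : 0 < `|r - t| by rewrite normr_gt0 subr_eq0.
  have l0 : 0 < l by rewrite lt_min ltr01 !divr_gt0.
  have l1 : l <= 1 by rewrite ge_min lexx.
  pose s := t + l * (r - t).
  exists s; apply: Hd.
  - have [tr|rt'] := ltP t r.
      apply: (iD t r) => //; apply/andP; split; rewrite /s; first by rewrite lerDl mulr_ge0 // ?ltW // subr_gt0.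
      by rewrite -lerBrDl ler_piMl // subr_ge0 ltW.
    apply: (iD r t) => //; apply/andP; split; rewrite /s.
      by rewrite -lerBlDl; rewrite -opprB mulrN lerN2 ler_piMl // subr_ge0.
    by rewrite gerDl; apply: mulr_ge0_le0; [exact: ltW|rewrite subr_le0].
  - rewrite /s -subr_eq0 addrC addKr; apply: mulf_neq0; last by rewrite subr_eq0.
    by rewrite gt_eqF.
  rewrite /s addrC addKr normrM (gtr0_norm l0).
  apply: (@le_lt_trans _ _ (d / 2)); last by lra.
  by rewrite -ler_pdivlMr // ge_min lexx orbT.
have [pt|pt] := eqVneq p t; last by apply: (W p).
by apply: (W q) => //; rewrite -pt gt_eqF.
Qed.

Lemma g_derivative_unique (D : set R) (U V V2 : R -> R -> R) (t : R) : ProperFilter (pd D t) ->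
  g_affine D U -> g_derivative_on D U V -> g_derivative_on D U V2 -> D t -> V t = V2 t.
Proof.
move=> PF aff d1 d2 Dt.
have [t1 _] := g_derivative_tder aff d1 Dt; have [t2 _] := g_derivative_tder aff d2 Dt.
apply/funext => x; apply/eqP; rewrite -subr_eq0 -normr_le0; apply/ler_addgt0Pr => e e0.
have e2 : 0 < e / 2 by rewrite divr_gt0.
have [s [/bdk_sup B1 /bdk_sup B2]] := filter_ex (filterI (t1 0%N _ e2) (t2 0%N _ e2)).
rewrite add0r; have -> : V t x - V2 t x = ((U s x - U t x) / (s - t) - V2 t x) -
  ((U s x - U t x) / (s - t) - V t x) by ring.
by apply: le_trans (ler_normB _ _) _; rewrite [e]splitr lerD.
Qed.

Lemma within_subset_cvg {T : Type} (F : set_system T) (D D' : set T) : Filter F ->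
  D' `<=` D -> within D' F --> within D F.
Proof.
move=> FF s P; rewrite /within /= => H.
apply: (filterS (P := fun r => D r -> P r)) H => r Ar Dr; exact: (Ar (s _ Dr)).
Qed.

Lemma g_derivative_sub (D D' : set R) (U V : R -> R -> R) : D' `<=` D ->
  g_derivative_on D U V -> g_derivative_on D' U V.
Proof.
move=> s H t Dt; have [gV C] := H t (s _ Dt); split=> // k.
by apply: cvg_trans (C k); apply: cvg_app; exact: within_subset_cvg.
Qed.

Lemma g_continuous_sub (D D' : set R) (U : R -> R -> R) : D' `<=` D ->
  g_continuous_on D U -> g_continuous_on D' U.
Proof.
move=> s H t Dt k; have C := H t (s _ Dt) k.
by apply: cvg_trans C; apply: cvg_app; exact: within_subset_cvg.
Qed.

End uniqueness.

(** * The Proudman-Johnson equation in Lagrangian coordinates *)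

Section PJ.
Context {R : realType}.
Implicit Types (u ut : R -> R).

(** The Proudman-Johnson expression is the derivative of a function in [W^{oo,1}]; if
it vanishes, that function is constant and integrable, hence zero. *)
Lemma PJ_integrated (alpha : R) u ut : in_g u -> in_g ut ->
  proudman_johnson alpha u ut <->
  (forall x, ut^`() x + (1 - alpha) / 2 * (u^`() x * u^`() x) + u x * (u^`())^`() x = 0).
Proof.
move=> gu gut; have m1 := in_g_tame gu; have m2 := tame_derive m1; have m3 := in_g_tame gut.
pose E x := ut^`() x + (1 - alpha) / 2 * (u^`() x * u^`() x) + u x * (u^`())^`() x.
have mE : tame true E.
  apply: tameD; last exact: tameM (in_g_tameF gu) m2.
  by apply: tameD => //; apply: tameZ; exact: (tameM m1 m1).
pose E' x := ut^`()^`() x + (2 - alpha) * u^`() x * u^`()^`() x + u x * u^`()^`()^`() x.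
have DE : D1 E E'.
  pose proof (D1D (D1D (tame_D1 m3) (D1Z ((1 - alpha) / 2) (D1M (tame_D1 m1) (tame_D1 m1))))
    (D1M (in_g_D1 gu) (tame_D1 m2))) as H.
  apply: D1_eq H _ => x; rewrite /E'.
  move: (ut^`()^`() x) (u^`()^`()^`() x) (u^`()^`() x) (u^`() x) (u x) => p q r s v.
  by field.
have -> : proudman_johnson alpha u ut = (forall x, E' x = 0) by [].
split=> H; last first.
  move=> x; have E0 : E = fun=> 0 by exact/funext.
  by rewrite -(congr1 (@^~ x) (D1E DE)) E0 derive1_cst.
have E0 : D1 E (fun=> 0) by apply: D1_eq DE _ => x; exact: H.
have Ec x : E x = E 0 by have := D1_inj_cst E0 x; rewrite mul0r addr0.
have [M /bdk0 B] := mE 0%N.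
suff Z : E 0 = 0 by move=> x; have := Ec x; rewrite Z.
apply/eqP; rewrite -normr_le0; apply/ler_addgt0Pr => e e0; rewrite add0r.
by have [y [_ [_ _ + _]]] := bd_near0 0 B e0; rewrite Ec.
Qed.

(** Differentiate [phi_t = u o phi] and [phi_tt = (u_t + u u_x) o phi] in [x]. *)
Lemma lagrangian_residual (alpha : R) phi phit phitt u ut : in_Diff phi ->
  in_g phit -> in_g phitt -> in_g u -> in_g ut ->
  (forall x, phit x = u (phi x)) ->
  (forall x, phitt x = ut (phi x) + u^`() (phi x) * phit x) ->
  forall x, phi^`() x * phitt^`() x - (alpha + 1) / 2 * (phit^`() x * phit^`() x) =
    phi^`() x * phi^`() x * (ut^`() (phi x) + (1 - alpha) / 2 * (u^`() (phi x) * u^`() (phi x))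
      + u (phi x) * (u^`())^`() (phi x)).
Proof.
move=> dphi gp gpp gu gut Ep Epp x.
have Dphi := Diff_D1 dphi.
have Dp : D1 phit (fun x => u^`() (phi x) * phi^`() x).
  by rewrite (_ : phit = fun x => u (phi x)); [exact: D1_comp (in_g_D1 gu) Dphi|exact/funext].
have Dpp := D1D (D1_comp (in_g_D1 gut) Dphi) (D1M (D1_comp (tame_D1 (in_g_tame gu)) Dphi) (in_g_D1 gp)).
have -> : phitt = (fun x => ut (phi x) + u^`() (phi x) * phit x) by exact/funext.
by rewrite (D1E Dpp) (D1E Dp) Ep; field.
Qed.

End PJ.

(** * Integrals in time *)

Section interval_integral.
Context {R : realType}.
Notation mu := (@lebesgue_measure R).
Variables (a b : R).
Hypothesis ab : a < b.

Lemma within_integrable f : {within `[a, b], continuous f} -> mu.-integrable `[a, b] (EFin \o f).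
Proof. by move=> cf; apply: continuous_compact_integrable => //; exact: segment_compact. Qed.

Lemma Rintegral_itv_FTC (f F : R -> R) : {within `[a, b], continuous f} ->
  {within `[a, b], continuous F} -> (forall t, t \in `]a, b[%R -> is_derive t (1 : R) F (f t)) ->
  Rintegral mu `[a, b] f = F b - F a.
Proof.
move=> cf cF D; have [_ ca cb] := (continuous_within_itvP F ab).1 cF.
rewrite /Rintegral (continuous_FTC2 (F := F) ab) //.
- by split=> // x xab; have [] := D x xab.
by move=> x xab; rewrite derive1E; have [_ ->] := D x xab.
Qed.

Lemma Rintegral_itv_le (f : R -> R) (C : R) : {within `[a, b], continuous f} ->
  (forall t, `[a, b]%classic t -> `|f t| <= C) -> `|Rintegral mu `[a, b] f| <= C * (b - a).
Proof.
move=> cf H; have I := within_integrable cf.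
apply: le_trans (le_normr_Rintegral _ I) _; first exact: measurable_itv.
have -> : C * (b - a) = Rintegral mu `[a, b] (fun=> C).
  have cC : continuous (fun _ : R => C) by move=> x; exact: cst_continuous.
  have DC : D1 (fun x => C * x) (fun=> C) by apply: D1_eq (D1Z C D1_id) _ => x; rewrite mulr1.
  have c1 : {within `[a, b], continuous (fun _ : R => C)} by exact: continuous_subspaceT.
  have c2 : {within `[a, b], continuous (fun x : R => C * x)}.
    by apply: continuous_subspaceT; exact: D1_continuous DC.
  by rewrite mulrBr; apply/esym; exact: (Rintegral_itv_FTC c1 c2 (fun t _ => DC t)).
apply: le_Rintegral => //.
- by move/integrable_abse : I.
by apply: within_integrable; apply: continuous_subspaceT => x; exact: cst_continuous.
Qed.

Lemma within_cB (f g : R -> R) (D : set R) : {within D, continuous f} -> {within D, continuous g} ->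
  {within D, continuous (fun x => f x - g x)}.
Proof. by move=> cf cg x; apply: cvgB; [exact: cf|exact: cg]. Qed.

Lemma within_cD (f g : R -> R) (D : set R) : {within D, continuous f} -> {within D, continuous g} ->
  {within D, continuous (fun x => f x + g x)}.
Proof. by move=> cf cg x; apply: cvgD; [exact: cf|exact: cg]. Qed.

Lemma within_cM (f g : R -> R) (D : set R) : {within D, continuous f} -> {within D, continuous g} ->
  {within D, continuous (fun x => f x * g x)}.
Proof. by move=> cf cg x; apply: cvgM; [exact: cf|exact: cg]. Qed.

Lemma within_cZ (c : R) (f : R -> R) (D : set R) : {within D, continuous f} ->
  {within D, continuous (fun x => c * f x)}.
Proof. by move=> cf x; apply: cvgM; [exact: cvg_cst|exact: cf]. Qed.

Lemma within_RintegralD (f g : R -> R) : {within `[a, b], continuous f} -> {within `[a, b], continuous g} ->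
  Rintegral mu `[a, b] (fun t => f t + g t) = Rintegral mu `[a, b] f + Rintegral mu `[a, b] g.
Proof.
by move=> /within_integrable If /within_integrable Ig; apply: RintegralD => //; exact: measurable_itv.
Qed.

Lemma within_RintegralB (f g : R -> R) : {within `[a, b], continuous f} -> {within `[a, b], continuous g} ->
  Rintegral mu `[a, b] (fun t => f t - g t) = Rintegral mu `[a, b] f - Rintegral mu `[a, b] g.
Proof.
by move=> /within_integrable If /within_integrable Ig; apply: RintegralB => //; exact: measurable_itv.
Qed.

Lemma within_RintegralZ (c : R) (f : R -> R) : {within `[a, b], continuous f} ->
  Rintegral mu `[a, b] (fun t => c * f t) = c * Rintegral mu `[a, b] f.
Proof. by move=> /within_integrable If; apply: RintegralZl => //; exact: measurable_itv. Qed.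

End interval_integral.

(** * Second order expansion of the energy *)

Section energy_compare.
Context {R : realType}.
Notation mu := (@lebesgue_measure R).

Lemma bd_abs b (e : R) f : bd b e f -> bd b e (fun x => `|f x|).
Proof.
move=> [cf sf If]; split; first exact: continuous_abs.
  by move=> x; rewrite normr_id.
by move=> /If; congr (_ <= _)%E; apply: eq_integral => x _; rewrite normr_id.
Qed.

Lemma powR_pred (y r : R) : 0 < y -> y `^ r = y `^ (r - 1) * y.
Proof.
move=> y0; rewrite -[X in _ = _ * X](powRr1 (ltW y0)) -powRD; first by rewrite subrK.
by apply/implyP => _; rewrite gt_eqF.
Qed.

(** The density is quadratic in [P], and [A `^ g] is expanded by Taylor's formula.  Every
remainder contains two of the factors [d] and [l], whence the square of [sg] in [L^1]. *)
Lemma density_expand (g m M : R) : 0 < m -> exists K, 0 <= K /\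
  forall (A P d l : R -> R) (sg : R), sg <= m / 2 -> sg <= 1 ->
  continuous A -> (forall x, m <= A x <= M) -> continuous P -> (forall x, `|P x| <= M) ->
  bd true sg d -> bd true sg l ->
  bd true (K * sg ^+ 2) (fun x =>
    2^-1 * ((A x + d x) `^ g * (P x + l x) * (P x + l x) - A x `^ g * P x * P x)
    - (A x `^ g * P x * l x + 2^-1 * (g * A x `^ (g - 1) * P x * P x) * d x)).
Proof.
move=> m0; have m2 : 0 < m / 2 by rewrite divr_gt0.
have [C0 [C00 H0]] := powR_bd g (M + 1) m2.
have [C1 [C10 H1]] := powR_bd (g - 1) (M + 1) m2.
have [C2 [C20 H2]] := powR_taylor g (M + 1) m2.
pose ca := C2 * (`|M| + 1) ^+ 2; pose cb := C0; pose cc := `|g| * C1 * (2 * `|M| + 1).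
have ca0 : 0 <= ca by rewrite mulr_ge0 // sqr_ge0.
have cc0 : 0 <= cc by rewrite !mulr_ge0 // addr_ge0 // mulr_ge0.
exists (ca + cb + cc); split; first by rewrite !addr_ge0.
move=> A P d l sg sm s1 cA AI cP PM Bd Bl.
have [cd sd _] := Bd; have [cl sl _] := Bl.
have A0 x : 0 < A x by have /andP[] := AI x => /(lt_le_trans m0).
have AI' x : m / 2 <= A x <= M + 1 by have /andP[? ?] := AI x; apply/andP; split; lra.
have dI x : m / 2 <= A x + d x <= M + 1.
  have /andP[? ?] := AI x; have := le_trans (sd x) sm; have := le_trans (sd x) s1.
  by rewrite !ler_norml => /andP[? ?] /andP[? ?]; apply/andP; split; lra.
have Ad0 x : 0 < A x + d x by have /andP[] := dI x => /(lt_le_trans m2).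
(* The three quadratic remainders: in d, in l, and mixed. *)
have BG : bd true ((ca + cb + cc) * sg ^+ 2) (fun x =>
    (ca * (`|d x| * `|d x|) + cb * (`|l x| * `|l x|)) + cc * (`|d x| * `|l x|)).
  have Bd' := bd_abs Bd; have Bl' := bd_abs Bl.
  have := bdD (bdD (bdZ ca (bdM Bd' Bd')) (bdZ cb (bdM Bl' Bl'))) (bdZ cc (bdM Bd' Bl')).
  by rewrite !ger0_norm // -!mulrDl -expr2.
apply: bd_dom BG => [|x].
  have cAd : continuous (fun x => A x + d x) by move=> x; apply: cvgD; [exact: cA|exact: cd].
  have cPl : continuous (fun x => P x + l x) by move=> x; apply: cvgD; [exact: cP|exact: cl].
  have cAg := continuous_powR (r := g) cA A0; have cAg1 := continuous_powR (r := g - 1) cA A0.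
  have cAdg := continuous_powR (r := g) cAd Ad0.
  have cc_ c : continuous (fun _ : R => c : R) by move=> x; exact: cst_continuous.
  apply: continuousB_fun.
    apply: (continuousM_fun (cc_ _)); apply: continuousB_fun.
      exact: (continuousM_fun (continuousM_fun cAdg cPl) cPl).
    exact: (continuousM_fun (continuousM_fun cAg cP) cP).
  move=> x; apply: cvgD.
    exact: (continuousM_fun (continuousM_fun cAg cP) cl).
  exact: (continuousM_fun (continuousM_fun (cc_ _)
    (continuousM_fun (continuousM_fun (continuousM_fun (cc_ g) cAg1) cP) cP)) cd).
set y := A x; set z := A x + d x; set p := P x; set q := l x.
have zy : z - y = d x by rewrite /z /y addrC addKr.
have -> : 2^-1 * (z `^ g * (p + q) * (p + q) - y `^ g * p * p)
    - (y `^ g * p * q + 2^-1 * (g * y `^ (g - 1) * p * p) * d x) =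
  2^-1 * ((z `^ g - y `^ g - g * y `^ (g - 1) * (z - y)) * (p + q) ^+ 2)
  + 2^-1 * (y `^ g * (q * q)) + 2^-1 * (g * y `^ (g - 1) * (d x * q) * (2 * p + q)).
  by rewrite zy; field.
have h2 : `|2^-1 : R| <= 1 by rewrite ger0_norm ?invr_ge0 // invf_le1 // ler1n.
have hpq : `|p + q| <= `|M| + 1.
  apply: le_trans (ler_normD _ _) _; apply: lerD; last exact: le_trans (sl x) s1.
  by apply: le_trans (PM x) _; exact: ler_norm.
have hpq2 : `|2 * p + q| <= 2 * `|M| + 1.
  apply: le_trans (ler_normD _ _) _; apply: lerD; last exact: le_trans (sl x) s1.
  rewrite normrM ger0_norm //; apply: ler_wpM2l => //.
  by apply: le_trans (PM x) _; exact: ler_norm.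
have half (c e : R) : `|c| <= e -> `|2^-1 * c| <= e.
  by move=> ce; rewrite normrM; apply: le_trans ce; apply: ler_piMl.
apply: le_trans (ler_normD _ _) _; apply: lerD.
  apply: le_trans (ler_normD _ _) _; apply: lerD; apply: half.
    rewrite normrM /ca [leRHS]mulrAC; apply: ler_pM => //.
      apply: le_trans (H2 _ _ (AI' x) (dI x)) _; rewrite -/y -/z zy.
      by rewrite -(@real_normK _ (d x)) ?num_real // expr2.
    by rewrite normrX lerXn2r ?nnegrE // addr_ge0.
  rewrite normrM /cb; apply: ler_pM => //; first by apply: H0; exact: AI'.
  by rewrite normrM.
apply: half; rewrite normrM /cc [leRHS]mulrAC; apply: ler_pM => //.
rewrite !normrM; apply: ler_pM => //; apply: ler_wpM2l => //.
by apply: H1; exact: AI'.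
Qed.

Lemma tder_powR (D : set R) (phi phit : R -> R -> R) (g : R) t : (forall t, D t -> in_Diff (phi t)) ->
  g_derivative_on D phi phit -> D t ->
  tder false D (fun s x => (phi s)^`() x `^ g)
    (fun x => g * (phi t)^`() x `^ (g - 1) * (phit t)^`() x) t /\
  tame false (fun x => (phi t)^`() x `^ g).
Proof.
move=> dphi dphit Dt; have [m m0 mp] := Diff_ge (dphi t Dt).
have [_ p2] := g_derivative_tder (Diff_affine dphi) dphit Dt.
have [gp _] := dphit t Dt.
split; last by apply: (tame_powR g m0 mp); exact: Diff_tame (dphi t Dt).
apply: (dif_powR (m := m)) => //.
- exact: near_pd_neq.
- exact: near_pd_small.
- exact: Diff_tame (dphi t Dt).
- exact: tame_false (in_g_tame gp).
exact: cvgto_false p2.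
Qed.

(** The linear part of [density_expand] contains the difference [l] of the velocities;
it is removed by integrating by parts in time, that is by subtracting the time
derivative of [int phi_x ^ g phi_tx d], which vanishes at both ends.  What remains
of the linear part is [- k]. *)
Lemma energy_compare (alpha m M : R) : 0 < m -> exists K, 0 <= K /\
  forall (a b : R) (phi phit phitt phi1 phit1 phitt1 : R -> R -> R) (sg : R), a < b ->
  let D := `[a, b]%classic in
  (forall t, D t -> in_Diff (phi t)) -> g_derivative_on D phi phit ->
  g_derivative_on D phit phitt -> g_continuous_on D phitt ->
  (forall t, D t -> in_Diff (phi1 t)) -> g_derivative_on D phi1 phit1 ->
  g_derivative_on D phit1 phitt1 ->
  phi1 a = phi a -> phi1 b = phi b ->
  (forall t, D t -> forall x, m <= (phi t)^`() x <= M) ->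
  (forall t, D t -> forall x, `|(phit t)^`() x| <= M) ->
  sg <= m / 2 -> sg <= 1 ->
  (forall t, D t -> bd true sg (fun x => (phi1 t)^`() x - (phi t)^`() x)) ->
  (forall t, D t -> bd true sg (fun x => (phit1 t)^`() x - (phit t)^`() x)) ->
  let k t := Rint (fun x => (phi t)^`() x `^ (- alpha - 1 - 1) *
      ((phi t)^`() x * (phitt t)^`() x - (alpha + 1) / 2 * ((phit t)^`() x * (phit t)^`() x))
      * ((phi1 t)^`() x - (phi t)^`() x)) in
  {within D, continuous k} /\
  `|energy (alpha_H1dot alpha) a b phi1 phit1 - energy (alpha_H1dot alpha) a b phi phit
    + Rintegral mu D k| <= K * sg ^+ 2 * (b - a).
Proof.
move=> m0; pose g := - alpha - 1; have [K [K0 HK]] := density_expand g M m0.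
exists K; split=> // a b phi phit phitt phi1 phit1 phitt1 sg ab D dphi dp dpp cpp dphi1 dp1 dpp1
  ea eb mA MP sm s1 Bd Bl k.
have gp t : D t -> in_g (phit t) by move=> /dp[].
have gp1 t : D t -> in_g (phit1 t) by move=> /dp1[].
have gpp t : D t -> in_g (phitt t) by move=> /dpp[].
have mp t Dt := in_g_tame (gp t Dt); have mp1 t Dt := in_g_tame (gp1 t Dt).
have mpp t Dt := in_g_tame (gpp t Dt).
have aphi := Diff_affine dphi; have aphi1 := Diff_affine dphi1.
have ap := in_g_affine gp; have ap1 := in_g_affine gp1; have app := in_g_affine gpp.
pose d t x := (phi1 t)^`() x - (phi t)^`() x.
pose l t x := (phit1 t)^`() x - (phit t)^`() x.
have Ddiff t : D t -> D1 (fun x => phi1 t x - phi t x) (d t).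
  by move=> Dt; exact: D1B (Diff_D1 (dphi1 t Dt)) (Diff_D1 (dphi t Dt)).
have md t : D t -> tame true (d t).
  by move=> Dt; rewrite -(D1E (Ddiff t Dt)); apply: in_g_tame; apply: Diff_sub; [exact: dphi1|exact: dphi].
have ml t : D t -> tame true (l t) by move=> Dt; apply: tameB; [exact: mp1|exact: mp].
have mAg q t : D t -> tame false (fun x => (phi t)^`() x `^ q).
  by move=> Dt; have [] := tder_powR q dphi dp Dt.
have mAg1 q t : D t -> tame false (fun x => (phi1 t)^`() x `^ q).
  by move=> Dt; have [] := tder_powR q dphi1 dp1 Dt.
have tA q t Dt := (tder_powR q dphi dp (t := t) Dt).1.
have tA1 q t Dt := (tder_powR q dphi1 dp1 (t := t) Dt).1.
have mtA q t : D t -> tame false (fun x => q * (phi t)^`() x `^ (q - 1) * (phit t)^`() x).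
  move=> Dt; apply: (tameM (b1 := false) (b2 := false)); last exact: tame_false (mp t Dt).
  by apply: tameZ; exact: mAg.
have mtA1 q t : D t -> tame false (fun x => q * (phi1 t)^`() x `^ (q - 1) * (phit1 t)^`() x).
  move=> Dt; apply: (tameM (b1 := false) (b2 := false)); last exact: tame_false (mp1 t Dt).
  by apply: tameZ; exact: mAg1.
have tP t Dt := (g_derivative_tder ap dpp (t := t) Dt).2.
have tP1 t Dt := (g_derivative_tder ap1 dpp1 (t := t) Dt).2.
have tphi t Dt := (g_derivative_tder aphi dp (t := t) Dt).2.
have tphi1 t Dt := (g_derivative_tder aphi1 dp1 (t := t) Dt).2.
have td t : D t -> tder true D d (l t) t.
  by move=> Dt; exact: difB (tphi1 t Dt) (tphi t Dt).
have cA q t Dt : tcont false D _ t := tder_tcont (mtA q t Dt) (tA q t Dt).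
have cA1 q t Dt : tcont false D _ t := tder_tcont (mtA1 q t Dt) (tA1 q t Dt).
have cP t Dt : tcont true D _ t := tder_tcont (mpp t Dt) (tP t Dt).
have cP1 t Dt : tcont true D _ t := tder_tcont (in_g_tame (dpp1 t Dt).1) (tP1 t Dt).
have cd t Dt : tcont true D _ t := tder_tcont (ml t Dt) (td t Dt).
have cl t : D t -> tcont true D l t by move=> Dt; exact: cvgtoB (cP1 t Dt) (cP t Dt).
have cphi t Dt : tcont true D _ t := tder_tcont (mp t Dt) (tphi t Dt).
have cPP t Dt := (g_continuous_tcont app cpp (t := t) Dt).2.
have mphi t Dt := Diff_tame (dphi t Dt).
(* The boundary term of the integration by parts, and its time derivative. *)
pose Y t x := (phi t)^`() x `^ g * (phit t)^`() x * d t x.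
pose Y' t x := (g * (phi t)^`() x `^ (g - 1) * (phit t)^`() x * (phit t)^`() x
   + (phi t)^`() x `^ g * (phitt t)^`() x) * d t x
  + (phi t)^`() x `^ g * (phit t)^`() x * l t x.
have mY t : D t -> tame true (Y t).
  by move=> Dt; exact: tameM (tameM (mAg g t Dt) (mp t Dt)) (md t Dt).
have mW t : D t -> tame true (fun x => g * (phi t)^`() x `^ (g - 1) * (phit t)^`() x * (phit t)^`() x
   + (phi t)^`() x `^ g * (phitt t)^`() x).
  move=> Dt; apply: tameD; first exact: tameM (mtA g t Dt) (mp t Dt).
  exact: tameM (mAg g t Dt) (mpp t Dt).
have mY' t : D t -> tame true (Y' t).
  move=> Dt; apply: tameD; first exact: tameM (mW t Dt) (md t Dt).
  exact: tameM (tameM (mAg g t Dt) (mp t Dt)) (ml t Dt).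
have tY t : D t -> tder true D Y (Y' t) t.
  move=> Dt; have n0 := near_pd_neq D t; have h0 := near_pd_small D t.
  pose proof (difM n0 h0 (mAg g t Dt) (mp t Dt) (mtA g t Dt) (mpp t Dt) (tA g t Dt) (tP t Dt)) as T1.
  exact: (difM n0 h0 (tameM (mAg g t Dt) (mp t Dt)) (md t Dt) (mW t Dt) (ml t Dt) T1 (td t Dt)).
have cY' t : D t -> tcont true D Y' t.
  move=> Dt.
  have mtc : tcont false D (fun s x => g * (phi s)^`() x `^ (g - 1) * (phit s)^`() x) t.
    apply: (cvgtoM (b1 := false) (b2 := false)).
    - by apply: tameZ; exact: mAg.
    - exact: tame_false (mp t Dt).
    - by apply: cvgtoZ; exact: cA.
    exact: cvgto_false (cP t Dt).
  pose proof (cvgtoD (cvgtoM (mtA g t Dt) (mp t Dt) mtc (cP t Dt))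
    (cvgtoM (mAg g t Dt) (mpp t Dt) (cA g t Dt) (cPP t Dt))) as T1.
  pose proof (cvgtoM (mW t Dt) (md t Dt) T1 (cd t Dt)) as T2.
  pose proof (cvgtoM (mAg g t Dt) (mp t Dt) (cA g t Dt) (cP t Dt)) as T3.
  pose proof (cvgtoM (tameM (mAg g t Dt) (mp t Dt)) (ml t Dt) T3 (cl t Dt)) as T4.
  exact: cvgtoD T2 T4.
pose e0 t := Rint (fun x => (phi t)^`() x `^ g * (phit t)^`() x * (phit t)^`() x).
pose e1 t := Rint (fun x => (phi1 t)^`() x `^ g * (phit1 t)^`() x * (phit1 t)^`() x).
have me0 t : D t -> tame true (fun x => (phi t)^`() x `^ g * (phit t)^`() x * (phit t)^`() x).
  by move=> Dt; exact: tameM (tameM (mAg g t Dt) (mp t Dt)) (mp t Dt).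
have me1 t : D t -> tame true (fun x => (phi1 t)^`() x `^ g * (phit1 t)^`() x * (phit1 t)^`() x).
  by move=> Dt; exact: tameM (tameM (mAg1 g t Dt) (mp1 t Dt)) (mp1 t Dt).
have ce0 : {within D, continuous e0}.
  apply: Rint_within_continuous me0 _ => t Dt.
  pose proof (cvgtoM (mAg g t Dt) (mp t Dt) (cA g t Dt) (cP t Dt)) as T3.
  exact: (cvgtoM (tameM (mAg g t Dt) (mp t Dt)) (mp t Dt) T3 (cP t Dt)).
have ce1 : {within D, continuous e1}.
  apply: Rint_within_continuous me1 _ => t Dt.
  pose proof (cvgtoM (mAg1 g t Dt) (mp1 t Dt) (cA1 g t Dt) (cP1 t Dt)) as T3.
  exact: (cvgtoM (tameM (mAg1 g t Dt) (mp1 t Dt)) (mp1 t Dt) T3 (cP1 t Dt)).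
have cj' : {within D, continuous (fun t => Rint (Y' t))} := Rint_within_continuous mY' cY'.
have cj : {within D, continuous (fun t => Rint (Y t))}.
  by apply: Rint_within_continuous mY _ => t Dt; exact: tder_tcont (mY' t Dt) (tY t Dt).
pose B t x := (phi t)^`() x * (phitt t)^`() x - (alpha + 1) / 2 * ((phit t)^`() x * (phit t)^`() x).
have mB t : D t -> tame true (B t).
  move=> Dt; apply: tameB; first exact: tameM (mphi t Dt) (mpp t Dt).
  by apply: tameZ; exact: tameM (mp t Dt) (mp t Dt).
have mk t : D t -> tame true (fun x => (phi t)^`() x `^ (g - 1) * B t x * d t x).
  by move=> Dt; exact: tameM (tameM (mAg (g - 1) t Dt) (mB t Dt)) (md t Dt).
have ck : {within D, continuous k}.
  apply: Rint_within_continuous mk _ => t Dt.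
  have cB : tcont true D B t.
    pose proof (cvgtoM (mphi t Dt) (mpp t Dt) (cvgto_false (cphi t Dt)) (cPP t Dt)) as T1.
    pose proof (cvgtoZ ((alpha + 1) / 2) (cvgtoM (mp t Dt) (mp t Dt) (cP t Dt) (cP t Dt))) as T2.
    exact: cvgtoB T1 T2.
  pose proof (cvgtoM (mAg (g - 1) t Dt) (mB t Dt) (cA (g - 1) t Dt) cB) as T3.
  exact: (cvgtoM (tameM (mAg (g - 1) t Dt) (mB t Dt)) (md t Dt) T3 (cd t Dt)).
split=> //.
pose w t := (2^-1 * (e1 t - e0 t) - Rint (Y' t)) + k t.
have cw1 : {within D, continuous (fun t => 2^-1 * (e1 t - e0 t))}.
  exact: (within_cZ (within_cB ce1 ce0)).
have cw2 : {within D, continuous (fun t => 2^-1 * (e1 t - e0 t) - Rint (Y' t))} by exact: (within_cB cw1 cj').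
have cw : {within D, continuous w} by exact: (within_cD cw2 ck).
(* The two paths have the same end points. *)
have int0 : Rintegral mu D (fun t => Rint (Y' t)) = 0.
  have DJ t : t \in `]a, b[%R -> is_derive t (1 : R) (fun t => Rint (Y t)) (Rint (Y' t)).
    move=> tab; have nD : \forall s \near t, D s.
      apply: filterS (near_in_itvoo tab) => s; rewrite /D /= !in_itv /= => /andP[? ?].
      by apply/andP; split; exact: ltW.
    have Dt : D t by exact: nbhs_singleton nD.
    exact: (Rint_is_derive nD mY (mY' t Dt) (tY t Dt)).
  have Y0 t : phi1 t = phi t -> Rint (Y t) = 0.
    move=> E; rewrite (Rint_eq (g := fun x => 0 * 0)); last by move=> x; rewrite /Y /d E subrr mulr0 mul0r.
    by rewrite /Rint /Rintegral; under eq_integral do rewrite mul0r; rewrite integral0.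
  rewrite [LHS](Rintegral_itv_FTC ab cj' cj DJ).
  by rewrite !Y0 // subrr.
have -> : energy (alpha_H1dot alpha) a b phi1 phit1 - energy (alpha_H1dot alpha) a b phi phit
    + Rintegral mu D k = Rintegral mu D w.
  rewrite /w (within_RintegralD cw2 ck) (within_RintegralB cw1 cj') int0 subr0.
  rewrite (within_RintegralZ 2^-1%R (within_cB ce1 ce0)) (within_RintegralB ce1 ce0).
  have E0 : energy (alpha_H1dot alpha) a b phi phit = 2^-1 * Rintegral mu D e0 := erefl.
  have E1 : energy (alpha_H1dot alpha) a b phi1 phit1 = 2^-1 * Rintegral mu D e1 := erefl.
  rewrite E0 E1 [in RHS]mulrBr; reflexivity.
apply: Rintegral_itv_le; first exact: ab.
  exact: cw.
move=> t Dt.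
have cAt := tame_cont (mphi t Dt); have cPt := tame_cont (mp t Dt).
have Br := HK _ _ _ _ _ sm s1 cAt (mA t Dt) cPt (MP t Dt) (Bd t Dt) (Bl t Dt).
have [N1 /bdk0 b1] := me1 t Dt 0%N; have [N0 /bdk0 b0] := me0 t Dt 0%N.
have [N2 /bdk0 b2] := mY' t Dt 0%N; have [N3 /bdk0 b3] := mk t Dt 0%N.
have bB (q r : R) (f h : R -> R) : bd true q f -> bd true r h -> bd true (q + `|-1| * r) (fun x => f x - h x).
  by move=> F H; apply: bd_eq (bdD F (bdZ (-1) H)) => x; rewrite mulN1r.
have -> : w t = Rint (fun x =>
    2^-1 * (((phi t)^`() x + d t x) `^ g * ((phit t)^`() x + l t x) * ((phit t)^`() x + l t x)
      - (phi t)^`() x `^ g * (phit t)^`() x * (phit t)^`() x)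
    - ((phi t)^`() x `^ g * (phit t)^`() x * l t x
      + 2^-1 * (g * (phi t)^`() x `^ (g - 1) * (phit t)^`() x * (phit t)^`() x) * d t x)).
  rewrite /w /e0 /e1 -(RintB b1 b0) -(RintZ 2^-1%R (bB _ _ _ _ b1 b0)).
  rewrite -(RintB (bdZ 2^-1%R (bB _ _ _ _ b1 b0)) b2).
  rewrite /k -(RintD (bB _ _ _ _ (bdZ 2^-1%R (bB _ _ _ _ b1 b0)) b2) b3).
  apply: Rint_eq => x.
  have p0 := Diff_gt0 (dphi t Dt) x.
  have pg : (phi t)^`() x `^ g = (phi t)^`() x `^ (g - 1) * (phi t)^`() x.
    exact: powR_pred.
  have ed : (phi t)^`() x + d t x = (phi1 t)^`() x by rewrite /d addrC subrK.
  have el : (phit t)^`() x + l t x = (phit1 t)^`() x by rewrite /l addrC subrK.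
  have ga : alpha + 1 = - g by rewrite /g opprD !opprK.
  rewrite ed el /Y' /B ga pg.
  move: ((phi1 t)^`() x `^ g) ((phi t)^`() x `^ (g - 1)) ((phi t)^`() x) ((phit t)^`() x)
    ((phit1 t)^`() x) ((phitt t)^`() x) (d t x) (l t x) => F1 Fm A p p1 q d0 l0.
  by field.
exact: Rint_le.
Qed.

End energy_compare.

(** * Uniform bounds on compact time intervals *)

Section families.
Context {R : realType}.

(** Compactness of the segment; [r] stands for a small constant and bounds that hold
near each point hold uniformly. *)
Lemma segment_near (a b : R) (P : R -> R -> Prop) :
  (forall t, a <= t <= b -> exists2 d, 0 < d &
     forall s, a <= s <= b -> `|s - t| < d -> forall r, 0 < r -> r <= d -> P r s) ->
  exists2 d, 0 < d & forall r, 0 < r -> r <= d -> forall t, a <= t <= b -> P r t.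
Proof.
move=> H; have [ba|ab] := ltP b a.
  exists 1 => // r _ _ t /andP[at_ tb]; have := le_lt_trans (le_trans at_ tb) ba.
  by rewrite ltxx.
pose Q s := exists2 d, 0 < d & forall r, 0 < r -> r <= d -> forall t, a <= t <= s -> P r t.
suff : Q b by [].
apply: (@real_induction R Q a b ab).
- have [d d0 Hd] := H a (introT andP (conj (lexx a) ab)).
  exists d => // r r0 rd t /andP[at_ ta].
  have Et : t = a by apply/eqP; rewrite eq_le ta at_.
  by apply: Hd => //; rewrite Et ?lexx ?(ltW ab) // subrr normr0.
- move=> s /andP[as_ sb] [d d0 Hd].
  have [d1 d10 Hd1] := H s (introT andP (conj as_ (ltW sb))).
  exists (d1 / 2) => [|r sr rd rb]; first by rewrite divr_gt0.
  exists (Num.min d d1) => [|q q0]; first by rewrite lt_min d0.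
  rewrite le_min => /andP[qd qd1] t /andP[at_ tr].
  have [ts|st] := leP t s; first by apply: Hd => //; rewrite at_.
  apply: Hd1 => //; first by rewrite at_ (le_trans tr).
  by rewrite gtr0_norm ?subr_gt0 //; lra.
move=> s /andP[as_ sb] IH.
have [d1 d10 Hd1] := H s (introT andP (conj (ltW as_) sb)).
pose r := Num.max a (s - d1 / 2).
have rs : r < s by rewrite gt_max as_ /=; lra.
have ar : a <= r by rewrite le_max lexx.
have [d d0 Hd] := IH r (introT andP (conj ar rs)).
exists (Num.min d d1) => [|q q0]; first by rewrite lt_min d0.
rewrite le_min => /andP[qd qd1] t /andP[at_ ts].
have [tr|rt] := leP t r; first by apply: Hd => //; rewrite at_.
apply: Hd1 => //; first by rewrite at_ (le_trans ts).
have : s - d1 / 2 <= r by rewrite le_max lexx orbT.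
by move=> ?; rewrite ler0_norm ?subr_le0 //; lra.
Qed.

Lemma near_pw2_ex (J I : set R) (s t : R) (P : R * R -> Prop) :
  (\forall p \near within (J `*` I) (nbhs (s, t)), P p) ->
  exists2 d, 0 < d & forall s' t', J s' -> I t' -> `|s' - s| < d -> `|t' - t| < d -> P (s', t').
Proof.
rewrite near_withinE => H.
have [[A B] /= [[d1 /= d10 H1] [d2 /= d20 H2]] AB] := H.
exists (Num.min d1 d2) => [|s' t' Js It]; first by rewrite lt_min d10.
rewrite !lt_min => /andP[s1 _] /andP[_ t2].
apply: (AB (s', t')) => //; split => /=.
  by apply: H1; rewrite /ball_ /= distrC.
by apply: H2; rewrite /ball_ /= distrC.
Qed.

(** Joint continuity at the points [(0, t)] and compactness in [t]. *)
Lemma family_bound (e a b : R) (k : nat) (Z : R -> R -> R -> R) : 0 < e ->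
  let J := `]- e, e[%classic in let I := `[a, b]%classic in
  (forall s t, J s -> I t -> in_g (Z s t)) ->
  g_continuous_on (J `*` I) (fun p : R * R => Z p.1 p.2) ->
  exists2 d, 0 < d & forall s t, `|s| <= d -> I t -> J s /\ bdk true k d^-1 ((Z s t)^`()).
Proof.
move=> e0 J I gZ cZ.
pose P r t := forall s, `|s| <= r -> J s /\ bdk true k r^-1 ((Z s t)^`()).
suff [d d0 Hd] : exists2 d, 0 < d & forall r, 0 < r -> r <= d -> forall t, a <= t <= b -> P r t.
  exists d => // s t sd It; have tI : a <= t <= b by move: It; rewrite /I /= in_itv.
  exact: (Hd d d0 (lexx d) t tI s sd).
apply: segment_near => t tI.
have J0 : J 0 by rewrite /J /= in_itv /= oppr_lt0 e0.
have It : I t by rewrite /I /= in_itv.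
have C := cZ (0, t) (conj J0 It).
have gq : \forall p \near within (J `*` I) (nbhs (0, t)), in_g (fun x => Z p.1 p.2 x - Z 0 t x).
  by rewrite near_withinE; apply: nearW => -[s' t'] [Js' It'] /=; apply: in_gB; exact: gZ.
pose proof ((g_cvgP gq).1 C k 1 ltr01) as S.
have [d1 d10 Hd1] := near_pw2_ex S.
have [M BM] := in_g_tame (gZ 0 t J0 It) k.
have M0 := bdk_ge0 BM.
pose d := Num.min (Num.min (d1 / 2) (e / 2)) (1 + M)^-1.
have M1 : 0 < 1 + M by rewrite ltr_pwDl.
have d0 : 0 < d by rewrite !lt_min !divr_gt0 // invr_gt0.
exists d => // t' t'I t't r r0 rd s sr.
have [rd1 re rM] : [/\ r <= d1 / 2, r <= e / 2 & r <= (1 + M)^-1].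
  by move: rd; rewrite !le_min => /andP[/andP[]].
have [td1 _ _] : [/\ d <= d1 / 2, d <= e / 2 & d <= (1 + M)^-1].
  by have := lexx d; rewrite {2}/d !le_min => /andP[/andP[]].
have Js : J s.
  rewrite /J /= in_itv /=; have : `|s| <= e / 2 by lra.
  by rewrite ler_norml => /andP[? ?]; apply/andP; split; lra.
split=> //.
have It' : I t' by rewrite /I /= in_itv.
have B : bdk true k 1 ((fun x => Z s t' x - Z 0 t x)^`()).
  by apply: (Hd1 s t') => //; [rewrite subr0; lra|lra].
rewrite (D1E (D1B (in_g_D1 (gZ s t' Js It')) (in_g_D1 (gZ 0 t J0 It)))) in B.
have := bdkD B BM; under eq_fun do rewrite subrK.
apply: bdk_le; rewrite -[leLHS]invrK lef_pV2 ?posrE ?invr_gt0 //.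
Qed.

Lemma g_derivative_eq (D : set R) (U U2 V V2 : R -> R -> R) :
  (forall t, D t -> U t = U2 t) -> (forall t, D t -> V t = V2 t) ->
  g_derivative_on D U V -> g_derivative_on D U2 V2.
Proof.
move=> EU EV H t Dt; have [gV C] := H t Dt; rewrite -(EV t Dt); split; first exact: gV.
move=> k; apply: cvg_trans (C k); apply: near_eq_cvg; apply: filterS (near_pd_in D t) => s Ds.
by rewrite -(EU s Ds) -(EU t Dt).
Qed.

Lemma family_lip_one (d e : R) (U V : R -> R -> R) : 0 < d -> d < e ->
  let J := `]- e, e[%classic in
  g_affine J U -> g_derivative_on J U V ->
  (forall s, `|s| <= d -> bd true d^-1 ((V s)^`())) ->
  forall s, `|s| <= d -> bd true (d^-1 * `|s|) (fun x => (U s)^`() x - (U 0)^`() x).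
Proof.
move=> d0 de J aff dU BV s sd.
pose D := `[- d, d]%classic : set R.
have DJ : D `<=` J.
  by move=> r; rewrite /D /J /= !in_itv /= => /andP[? ?]; apply/andP; split; lra.
have Dd r : D r -> `|r| <= d by rewrite /D /= in_itv /= ler_norml.
have dU' := g_derivative_sub DJ dU.
have aff' : g_affine D U by move=> r q /DJ Jr /DJ Jq; exact: aff.
have tU r Dr := (g_derivative_tder aff' dU' (t := r) Dr).2.
have mV r : D r -> tame true ((V r)^`()) by move=> Dr; have [gV _] := dU' r Dr; exact: in_g_tame.
have BV' r : D r -> bd true d^-1 ((V r)^`()) by move=> /Dd; exact: BV.
have /andP[s1 s2] : - d <= s <= d by rewrite -ler_norml.
have [s0|s0] := ger0P s.
  have := bd_mean_value s0 (D := D) (Y' := fun r => (V r)^`()) _ tU mV BV'.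
  rewrite subr0; apply => r /andP[? ?]; rewrite /D /= in_itv /=; apply/andP; split; lra.
have := bd_mean_value (ltW s0) (D := D) (Y' := fun r => (V r)^`()) _ tU mV BV'.
rewrite sub0r => B; have {}B := B _.
have := bdZ (-1) (B _); rewrite normrN normr1 mul1r => H.
apply: bd_eq (H _) => [x|r /andP[? ?]]; first by ring.
by rewrite /D /= in_itv /=; apply/andP; split; lra.
Qed.

Lemma is_interval_cc (a b : R) : is_interval `[a, b]%classic.
Proof. exact: interval_is_interval. Qed.

Lemma pd_proper_cc (a b t : R) : a < b -> `[a, b]%classic t -> ProperFilter (pd `[a, b]%classic t).
Proof.
move=> ab It; apply: pd_proper It; first exact: is_interval_cc.
by exists a, b; rewrite /= !in_itv /= !lexx (ltW ab).
Qed.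

(** The mean value inequality in the parameter, for [Phi] and for its velocity: the
derivatives [Phi_s] and [Phi_st] are bounded near [s = 0] by [family_bound].  The
velocity is that of the family by uniqueness of derivatives. *)
Lemma variation_lip (a b e : R) (phi : R -> R -> R) (Phi Phit : R -> R -> R -> R) : a < b -> 0 < e ->
  proper_variation a b e phi Phi Phit ->
  (exists Phitt : R -> R -> R -> R, forall s, `]- e, e[%classic s ->
     g_derivative_on `[a, b]%classic (Phit s) (Phitt s)) /\
  exists2 d, 0 < d & d < e /\ forall s t, `|s| <= d -> `[a, b]%classic t ->
   bd true (d^-1 * `|s|) (fun x => (Phi s t)^`() x - (Phi 0 t)^`() x) /\
   bd true (d^-1 * `|s|) (fun x => (Phit s t)^`() x - (Phit 0 t)^`() x).
Proof.
move=> ab e0 [dPhi CF dPhit EPhi bdry].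
have [_ [Phis [Pt [dS dT [cS _] [cT [Pts [Ptt [dTs dTt [cTs _] _]]]]]]]] := CF.
have J0 : `]- e, e[%classic 0 by rewrite /= in_itv /= oppr_lt0 e0.
have EP s t : `]- e, e[%classic s -> `[a, b]%classic t -> Phit s t = Pt s t.
  move=> Js It; have PF := pd_proper_cc ab It.
  apply: (g_derivative_unique PF _ (dPhit s Js) (dT s Js) It).
  by apply: Diff_affine => r Ir; exact: dPhi.
have gPs s t : `]- e, e[%classic s -> `[a, b]%classic t -> in_g (Phis s t).
  by move=> Js It; have [] := dS t It s Js.
have gPt s t : `]- e, e[%classic s -> `[a, b]%classic t -> in_g (Pt s t).
  by move=> Js It; have [] := dT s Js t It.
have gPts s t : `]- e, e[%classic s -> `[a, b]%classic t -> in_g (Pts s t).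
  by move=> Js It; have [] := dTs t It s Js.
split.
  exists Ptt => s Js; apply: g_derivative_eq (dTt s Js) => // t It.
  by rewrite EP.
have [d1 d10 H1] := family_bound 0 e0 gPs cS.
have [d2 d20 H2] := family_bound 0 e0 gPts cTs.
pose d := Num.min (Num.min d1 d2) (e / 2).
have d0 : 0 < d by rewrite !lt_min d10 d20 divr_gt0.
have [dd1 dd2 de2] : [/\ d <= d1, d <= d2 & d <= e / 2].
  by have := lexx d; rewrite {2}/d !le_min => /andP[/andP[]].
have de : d < e by lra.
have inv d' : 0 < d' -> d <= d' -> d'^-1 <= d^-1 by move=> d'0 dd'; rewrite lef_pV2.
exists d => //; split=> // s t sd It.
have Js : `]- e, e[%classic s.
  by move: sd; rewrite ler_norml /= in_itv /= => /andP[? ?]; apply/andP; split; lra.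
split.
  apply: (@family_lip_one d e (fun s => Phi s t) (fun s => Phis s t)) => //.
  - by apply: Diff_affine => r Jr; exact: dPhi.
  - exact: dS.
  move=> r rd; have [_ /bdk0 B] := H1 r t (le_trans rd dd1) It.
  by apply: bd_le B; exact: inv.
rewrite (EP _ _ Js It) (EP _ _ J0 It).
apply: (@family_lip_one d e (fun s => Pt s t) (fun s => Pts s t)) => //.
- by apply: in_g_affine => r Jr; exact: gPt.
- exact: dTs.
move=> r rd; have [_ /bdk0 B] := H2 r t (le_trans rd dd2) It.
by apply: bd_le B; exact: inv.
Qed.

Lemma curve_bounds (a b : R) (phi phit phitt : R -> R -> R) :
  (forall t, `[a, b]%classic t -> in_Diff (phi t)) -> g_derivative_on `[a, b]%classic phi phit ->
  g_derivative_on `[a, b]%classic phit phitt ->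
  exists2 r, 0 < r & forall t, `[a, b]%classic t ->
    forall x, r <= (phi t)^`() x <= r^-1 /\ `|(phit t)^`() x| <= r^-1.
Proof.
move=> dphi dp dpp.
pose P r t := forall x, r <= (phi t)^`() x <= r^-1 /\ `|(phit t)^`() x| <= r^-1.
suff [d d0 Hd] : exists2 d, 0 < d & forall r, 0 < r -> r <= d -> forall t, a <= t <= b -> P r t.
  exists d => // t It x; have tI : a <= t <= b by move: It; rewrite /= in_itv.
  exact: (Hd d d0 (lexx d) t tI x).
apply: segment_near => t tI.
have It : `[a, b]%classic t by rewrite /= in_itv.
have gp s : `[a, b]%classic s -> in_g (phit s) by move=> /dp[].
have [_ c1] := g_derivative_continuous (Diff_affine dphi) dp It.
have [_ c2] := g_derivative_continuous (in_g_affine gp) dpp It.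
have [m m0 mp] := Diff_ge (dphi t It).
have [M BM] := Diff_tame (dphi t It) 0%N; have [N BN] := in_g_tame (gp t It) 0%N.
have m2 : 0 < m / 2 by rewrite divr_gt0.
have [e1 e10 H1] := near_pw_ex (c1 0%N _ m2).
have [e2 e20 H2] := near_pw_ex (c2 0%N _ ltr01).
pose K := `|M| + `|N| + m + 1.
have K0 : 0 < K by rewrite ltr_wpDl // !addr_ge0 // ltW.
pose d := Num.min (Num.min (e1 / 2) (e2 / 2)) (Num.min (m / 2) K^-1).
have d0 : 0 < d by rewrite !lt_min !divr_gt0 // invr_gt0.
exists d => // s sI sd r r0 rd x.
have Is : `[a, b]%classic s by rewrite /= in_itv.
have [de1 de2] : d <= e1 / 2 /\ d <= e2 / 2.
  by have := lexx d; rewrite {2}/d !le_min => /andP[/andP[]].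
have [dm dK] : d <= m / 2 /\ d <= K^-1.
  by have := lexx d; rewrite {2}/d !le_min => /andP[_ /andP[]].
have rK : K <= r^-1.
  by rewrite -[leLHS]invrK lef_pV2 ?posrE ?invr_gt0 //; apply: le_trans rd dK.
have := bdk_sup (H1 s Is _) x; have := bdk_sup (H2 s Is _) x.
have s1 : `|s - t| < e1 by lra.
have s2 : `|s - t| < e2 by lra.
move=> /(_ s2) h2 /(_ s1) h1.
have hM := bdk_sup BM x; have hN := bdk_sup BN x; have hm := mp x.
have lM := ler_norm M; have lN := ler_norm N; have nM := normr_ge0 M; have nN := normr_ge0 N.
have rm := le_trans rd dm; rewrite /K in rK.
move: h1 h2 hM hN rm rK lM lN nM nN hm; rewrite !ler_norml; clear.
move: (_^`() x) (_^`() x) (_^`() x) (_^`() x) (r^-1) (`|M|) (`|N|).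
move=> p q p1 q1 i M1 N1 /andP[? ?] /andP[? ?] /andP[? ?] /andP[? ?] ? ? ? ? ? ? ?.
by split; apply/andP; split; lra.
Qed.

End families.

(** * Affine variations *)

Section affine_variation.
Context {R : realType}.
Variable rho : R -> R.
Hypothesis grho : in_g rho.

(** The affine variation below and all its partial derivatives have this form, so
its regularity follows from [fam_continuous], [fam_ds] and [fam_dt]. *)
Definition fam (X : R -> R -> R) (p q : R -> R) (s t : R) : R -> R :=
  fun x => X t x + (p t + s * q t) * rho x.

(** What is required of the time profiles: a Taylor estimate with a uniform
constant. *)
Definition quad (p p' : R -> R) := continuous p /\ exists M : R, forall t t', `|p t' - p t - p' t * (t' - t)| <= M * (t' - t) ^+ 2.

Lemma quad_cst (c : R) : quad (fun=> c) (fun=> 0).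
Proof.
split; first by move=> x; exact: cst_continuous.
by exists 0 => t t'; rewrite subrr mul0r subrr normr0 mul0r.
Qed.

Lemma in_g_scale (c : R) : in_g (fun x => c * rho x).
Proof. exact: in_gZ. Qed.

Lemma small_scalar {T : Type} (FT : set_system T) {FF : Filter FT} k (c : T -> R) :
  (forall e : R, 0 < e -> \forall p \near FT, `|c p| <= e) ->
  small FT true k (fun p x => c p * rho^`() x).
Proof.
move=> c0; have [M B] := in_g_tame grho k.
by apply: (small_scal (M := M)) => //; apply: nearW.
Qed.

Lemma fam_continuous (J I : set R) (X : R -> R -> R) (p q : R -> R) : g_affine I X ->
  g_continuous_on I X -> continuous p -> continuous q ->
  g_continuous_on (J `*` I) (fun z : R * R => fam X p q z.1 z.2).
Proof.
move=> aX cX cp cq [s0 t0] [/= Js It].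
pose FT := within (J `*` I) (nbhs (s0, t0)).
have inI : \forall z \near FT, I z.2 by rewrite near_withinE; apply: nearW => z [].
pose c (z : R * R) := (p z.2 + z.1 * q z.2) - (p t0 + s0 * q t0).
have gd : \forall z \near FT, in_g (fun x => fam X p q z.1 z.2 x - fam X p q s0 t0 x).
  apply: filterS inI => z Iz; have [g1 _] := aX z.2 t0 Iz It.
  have := in_gD g1 (in_g_scale (c z)).
  rewrite (_ : (fun x => _) = (fun x => fam X p q z.1 z.2 x - fam X p q s0 t0 x)) //.
  by apply/funext => x; rewrite /fam /c; ring.
apply/(g_cvgP gd) => k.
have c0 e : 0 < e -> \forall z \near FT, `|c z| <= e.
  move=> e0; rewrite near_withinE.
  have C : (p z.2 + z.1 * q z.2) @[z --> (s0, t0)] --> p t0 + s0 * q t0.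
    have c2 : z.2 @[z --> (s0, t0)] --> t0 by exact: cvg_snd.
    have c1 : z.1 @[z --> (s0, t0)] --> s0 by exact: cvg_fst.
    apply: cvgD; first exact: (cvg_comp _ _ c2 (cp t0)).
    by apply: cvgM => //; exact: (cvg_comp _ _ c2 (cq t0)).
  move/cvgrPdist_le : C => /(_ e e0); apply: filterS => z ze _.
  by rewrite /c distrC.
have cX0 : small (pw I t0) true k (fun t => (fun x => X t x - X t0 x)^`()).
  apply: (g_cvgP _).1 (cX t0 It) k.
  by apply: filterS (near_pw_in I t0) => t It'; have [] := aX t t0 It' It.
have cX1 : small FT true k (fun z => (fun x => X z.2 x - X t0 x)^`()).
  move=> e e0; have [d d0 Hd] := near_pw_ex (cX0 e e0).
  have nz : \forall z \near FT, `|z.2 - t0| < d.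
    rewrite near_withinE.
    have c2 : z.2 @[z --> (s0, t0)] --> t0 by exact: cvg_snd.
    by move/cvgrPdist_lt : c2 => /(_ d d0); apply: filterS => z + _; rewrite distrC.
  by apply: filterS2 inI nz => z Iz zd; exact: Hd.
pose proof (smallD cX1 (small_scalar k c0)) as S2; apply: (small_eq _ S2).
apply: filterS inI => z Iz x; have [g1 _] := aX z.2 t0 Iz It.
have -> : (fun x => fam X p q z.1 z.2 x - fam X p q s0 t0 x) =
    (fun x => (X z.2 x - X t0 x) + c z * rho x).
  by apply/funext => y; rewrite /fam /c; ring.
by rewrite (D1E (D1D (in_g_D1 g1) (D1Z (c z) (in_g_D1 grho)))).
Qed.

Lemma fam_ds (J : set R) (X : R -> R -> R) (p q : R -> R) t :
  g_derivative_on J (fun s => fam X p q s t) (fun s => fam (fun _ _ => 0) q (fun=> 0) s t).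
Proof.
have E s : fam (fun _ _ => 0) q (fun=> 0) s t = (fun x => q t * rho x).
  by apply/funext => x; rewrite /fam; ring.
move=> s Js; rewrite E; split; first exact: in_g_scale.
have Z : \forall r \near pd J s, (fun x => (fam X p q r t x - fam X p q s t x) / (r - s) - q t * rho x) = (fun=> 0).
  apply: filterS (near_pd_neq J s) => r rs; apply/funext => x; rewrite /fam; field.
  exact: rs.
apply/g_cvgP; first by apply: filterS Z => r ->; exact: in_g0.
move=> k e e0; apply: filterS Z => r ->.
apply: bdk_eq0 => [|x]; first exact: ltW.
by rewrite derive1_cst.
Qed.

Lemma quad_small (I : set R) (p p' : R -> R) (t : R) : quad p p' -> forall e : R, 0 < e ->
  \forall r \near pd I t, `|(p r - p t) / (r - t) - p' t| <= e.
Proof.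
move=> [_ [M HM]] e e0.
have e1 : 0 < e / (`|M| + 1) by rewrite divr_gt0 // ltr_wpDl.
apply: filterS2 (near_pd_neq I t) (near_pd_small I t e1) => r rt re.
have -> : (p r - p t) / (r - t) - p' t = (p r - p t - p' t * (r - t)) / (r - t) by field.
rewrite normrM normfV ler_pdivrMr ?normr_gt0 //.
apply: le_trans (HM t r) _; rewrite -real_normK ?num_real // expr2 mulrA.
apply: ler_wpM2r => //; apply: le_trans (ler_wpM2r (normr_ge0 _) (ler_norm M)) _.
apply: le_trans (ler_wpM2l (normr_ge0 M) re) _.
by apply: mul_divr_le => //; exact: ltW.
Qed.

Lemma fam_dt (I : set R) (X X' : R -> R -> R) (p p' q q' : R -> R) (s : R) : g_affine I X ->
  g_derivative_on I X X' -> quad p p' -> quad q q' ->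
  g_derivative_on I (fam X p q s) (fam X' p' q' s).
Proof.
move=> aX dX qp qq t It; have [gX' CX] := dX t It.
split; first by apply: in_gD => //; exact: in_g_scale.
pose c r := ((p r - p t) / (r - t) - p' t) + s * ((q r - q t) / (r - t) - q' t).
have gX : \forall r \near pd I t, in_g (fun x => (X r x - X t x) / (r - t) - X' t x).
  apply: filterS (near_pd_in I t) => r Ir; apply: in_gB => //.
  have [g1 _] := aX r t Ir It; have := in_gZ (r - t)^-1 g1.
  by under eq_fun do rewrite mulrC.
have E r : (fun x => (fam X p q s r x - fam X p q s t x) / (r - t) - fam X' p' q' s t x) =
   (fun x => ((X r x - X t x) / (r - t) - X' t x) + c r * rho x).
  by apply/funext => x; rewrite /fam /c; ring.
apply/g_cvgP.
  by apply: filterS gX => r g1; rewrite E; apply: in_gD => //; exact: in_g_scale.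
move=> k.
pose proof ((g_cvgP gX).1 CX k) as S1.
have c0 e : 0 < e -> \forall r \near pd I t, `|c r| <= e.
  move=> e0; have e2 : 0 < e / 2 by rewrite divr_gt0.
  have e3 : 0 < e / 2 / (`|s| + 1) by rewrite divr_gt0 // ltr_wpDl.
  apply: filterS2 (quad_small I t qp e2) (quad_small I t qq e3) => r h1 h2.
  apply: le_trans (ler_normD _ _) _; rewrite [leRHS]splitr; apply: lerD => //.
  rewrite normrM; apply: le_trans (ler_wpM2l (normr_ge0 s) h2) _.
  by apply: mul_divr_le => //; exact: ltW.
pose proof (smallD S1 (small_scalar k c0)) as S2; apply: (small_eq _ S2).
apply: filterS gX => r g1 x; rewrite E.
by rewrite (D1E (D1D (in_g_D1 g1) (D1Z (c r) (in_g_D1 grho)))).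
Qed.

End affine_variation.

(** A curve is a family that does not depend on its parameter. *)
Lemma curve_bdk {R : realType} (a b : R) (k : nat) (V : R -> R -> R) : let D := `[a, b]%classic in
  (forall t, D t -> in_g (V t)) -> g_continuous_on D V ->
  exists2 r, 0 < r & forall t, D t -> bdk true k r^-1 ((V t)^`()).
Proof.
move=> D gV cV; have [c0 _] := quad_cst (0 : R).
have E s t : fam (fun=> 0) V (fun=> 0) (fun=> 0) s t = V t.
  by apply/funext => x; rewrite /fam mulr0 addr0.
have [] := @family_bound R 1 a b k (fam (fun=> 0) V (fun=> 0) (fun=> 0)) ltr01.
- by move=> s t _ Dt; rewrite E; exact: gV.
- exact: (fam_continuous (@in_g0 R) (in_g_affine gV) cV c0 c0).
move=> r r0 Hr; exists r; first exact: r0.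
by move=> t Dt; have [|_] := Hr 0 t _ Dt; rewrite ?E // normr0 ltW.
Qed.

(** * First variation of the energy *)

Section euler_lagrange.
Context {R : realType}.
Notation mu := (@lebesgue_measure R).
Variable alpha : R.

(** The Euler-Lagrange expression along a curve with position [p], velocity [v] and
acceleration [w].  It comes multiplied by [EL_weight p], which is positive. *)
Definition EL (p v w : R -> R) (x : R) : R :=
  p^`() x * w^`() x - (alpha + 1) / 2 * (v^`() x * v^`() x).

Definition EL_weight (p : R -> R) (x : R) : R := p^`() x `^ (- alpha - 1 - 1).

Lemma tame_EL p v w : in_Diff p -> in_g v -> in_g w -> tame true (EL p v w).
Proof.
move=> dp gv gw; have mv := in_g_tame gv; have mw := in_g_tame gw.
apply: tameB; first exact: (tameM (Diff_tame dp) mw).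
by apply: tameZ; exact: (tameM mv mv).
Qed.

Lemma tame_EL_weight p : in_Diff p -> tame false (EL_weight p).
Proof. by move=> dp; have [m m0 H] := Diff_ge dp; exact: (tame_powR _ m0 H (Diff_tame dp)). Qed.

Lemma EL_weight_gt0 p x : in_Diff p -> 0 < EL_weight p x.
Proof. by move=> dp; apply: powR_gt0; exact: Diff_gt0. Qed.

Lemma Rint_gt0 (f : R -> R) (x : R) : tame true f -> (forall y, 0 <= f y) -> 0 < f x -> 0 < Rint f.
Proof.
move=> mf f0 fx0; have [M /bdk0 BM] := mf 0%N.
have [F DF] := antiderivative_exists (tame_cont mf).
have cf := tame_cont mf.
have lt_F : F x < F (x + 1).
  rewrite lt_neqAle (D1_nondec DF f0) ?andbT; last by rewrite lerDl ler01.
  apply/negP => /eqP E.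
  have Fc y : x <= y <= x + 1 -> F y = F x.
    move=> /andP[xy yx]; apply/eqP; rewrite eq_le (D1_nondec DF f0 xy) andbT E.
    exact: (D1_nondec DF f0 yx).
  have := cf x; move/cvgrPdist_lt => /(_ (f x) fx0) [d /= d0 Hd].
  pose y := x + Num.min 1 (d / 2).
  have y1 : 0 < Num.min 1 (d / 2) by rewrite lt_min ltr01 divr_gt0.
  have [c [cxy Ec]] := D1_MVT x y DF.
  have xy : x <= y by rewrite /y lerDl ltW.
  have yx1 : y <= x + 1 by rewrite /y lerD2l ge_min lexx.
  have yd : y <= x + d / 2 by rewrite /y lerD2l ge_min lexx orbT.
  rewrite min_l // max_r // in cxy; have /andP[xc cy] := cxy.
  rewrite Fc ?xy // subrr in Ec.
  have fc : f c = 0.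
    move/esym/eqP : Ec; rewrite mulf_eq0 => /orP[/eqP//|].
    by rewrite /y addrAC subrr add0r gt_eqF.
  have cd : `|x - c| < d by rewrite distrC ger0_norm ?subr_ge0 //; lra.
  have : `|f x - f c| < f x := Hd c cd.
  by rewrite fc subr0 gtr0_norm // ltxx.
have I : mu.-integrable setT (EFin \o f) := bd_integrable BM.
have E : (\int[mu]_y (f y)%:E)%E = (Rint f)%:E.
  by rewrite /Rint /Rintegral fineK //; exact: integrable_fin_num.
have := (integral_leP (Rint f) cf f0 DF).1; rewrite E => /(_ (lexx _) x (x + 1)).
move=> H; apply: lt_le_trans (H _); last by rewrite lerDl ler01.
by rewrite subr_gt0.
Qed.

Lemma Rintegral0 (D : set R) : Rintegral mu D (fun=> 0) = 0.
Proof. by rewrite /Rintegral integral0. Qed.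

Lemma energy_eq (G : metric R) (a b : R) (p v p2 v2 : R -> R -> R) :
  (forall t, `[a, b]%classic t -> p t = p2 t) -> (forall t, `[a, b]%classic t -> v t = v2 t) ->
  energy G a b p v = energy G a b p2 v2.
Proof.
move=> Ep Ev; rewrite /energy; congr (_ * _); apply: eq_Rintegral => t /set_mem It.
by rewrite (Ep t It) (Ev t It).
Qed.

(** [energy_compare] between the path [phi] and its neighbours, which are at distance
[O(s)] by [variation_lip]. *)
Lemma energy_var (a b e : R) (phi phit phitt : R -> R -> R) (Phi Phit : R -> R -> R -> R) :
  a < b -> 0 < e -> let D := `[a, b]%classic in
  (forall t, D t -> in_Diff (phi t)) -> g_derivative_on D phi phit ->
  g_derivative_on D phit phitt -> g_continuous_on D phitt ->
  proper_variation a b e phi Phi Phit ->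
  exists d K, [/\ 0 < d, d < e & forall s, `|s| <= d ->
    let k t := Rint (fun x => EL_weight (phi t) x * EL (phi t) (phit t) (phitt t) x *
      ((Phi s t)^`() x - (phi t)^`() x)) in
    {within D, continuous k} /\
    `|energy (alpha_H1dot alpha) a b (Phi s) (Phit s) - energy (alpha_H1dot alpha) a b (Phi 0) (Phit 0)
      + Rintegral mu D k| <= K * s ^+ 2].
Proof.
move=> ab e0 D dphi dp dpp cpp PV.
have [[Phitt dPhitt] [d [d0 [de lip]]]] := variation_lip ab e0 PV.
have [dPhi _ dPhit E0 bdry] := PV.
have J0 : `]- e, e[%classic 0 by rewrite /= in_itv /= oppr_lt0 e0.
have E0t t : D t -> Phit 0 t = phit t.
  move=> Dt; have PF := pd_proper_cc ab Dt.
  have dp2 : g_derivative_on D (Phi 0) phit.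
    apply: g_derivative_eq dp; first by move=> r Dr; rewrite E0.
    by move=> r Dr.
  apply: (g_derivative_unique PF _ (dPhit 0 J0) dp2 Dt).
  by apply: Diff_affine => r Dr; exact: dPhi.
have [m m0 bounds] := curve_bounds dphi dp dpp.
have [K [K0 HK]] := energy_compare alpha m^-1 m0.
pose d' := Num.min d (Num.min (d * (m / 2)) d).
have d'0 : 0 < d' by rewrite !lt_min d0 mulr_gt0 // divr_gt0.
have [d'd d'm] : d' <= d /\ d' <= d * (m / 2).
  by have := lexx d'; rewrite {2}/d' !le_min => /andP[? /andP[]].
exists d', (K * d^-1 ^+ 2 * (b - a)); split=> [//||s sd k]; first exact: le_lt_trans d'd de.
have sd1 : `|s| <= d := le_trans sd d'd.
have Js : `]- e, e[%classic s.
  have : `|s| < e := le_lt_trans sd1 de.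
  by rewrite ltr_norml /= in_itv.
have [ea eb] := bdry s Js.
have mb t : D t -> forall x, m <= (phi t)^`() x <= m^-1 by move=> Dt x; have [] := bounds t Dt x.
have vb t : D t -> forall x, `|(phit t)^`() x| <= m^-1 by move=> Dt x; have [] := bounds t Dt x.
have sm : d^-1 * `|s| <= m / 2 by rewrite ler_pdivrMl //; exact: le_trans sd d'm.
have s1 : d^-1 * `|s| <= 1 by rewrite ler_pdivrMl // mulr1.
have B1 t : D t -> bd true (d^-1 * `|s|) (fun x => (Phi s t)^`() x - (phi t)^`() x).
  by move=> Dt; have [+ _] := lip s t sd1 Dt; rewrite E0.
have B2 t : D t -> bd true (d^-1 * `|s|) (fun x => (Phit s t)^`() x - (phit t)^`() x).
  by move=> Dt; have [_] := lip s t sd1 Dt; rewrite (E0t t Dt).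
have dPs t : D t -> in_Diff (Phi s t) by move=> Dt; exact: dPhi.
have [ck HH] := HK a b phi phit phitt (Phi s) (Phit s) (Phitt s) _ ab dphi dp dpp cpp
  dPs (dPhit s Js) (dPhitt s Js) ea eb mb vb sm s1 B1 B2.
split; first exact: ck.
rewrite (energy_eq (alpha_H1dot alpha) E0 E0t).
apply: le_trans HH _; rewrite exprMn real_normK ?num_real //.
by rewrite le_eqVlt; apply/orP; left; apply/eqP; ring.
Qed.

Lemma EL0_geodesic (I : set R) (phi phit phitt : R -> R -> R) :
  (forall t, I t -> in_Diff (phi t)) -> g_derivative_on I phi phit ->
  g_derivative_on I phit phitt -> g_continuous_on I phitt ->
  (forall t, I t -> forall x, EL (phi t) (phit t) (phitt t) x = 0) ->
  geodesic (alpha_H1dot alpha) I phi.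
Proof.
move=> dphi dp dpp cpp EL0 a b ab abI e Phi Phit e0 PV.
have dphi' t : `[a, b]%classic t -> in_Diff (phi t) by move=> /abI; exact: dphi.
have [d [K [d0 de H]]] := energy_var ab e0 dphi' (g_derivative_sub abI dp)
  (g_derivative_sub abI dpp) (g_continuous_sub abI cpp) PV.
apply: (is_derive_quad (d := d) (K := K) d0) => s sd; have [_] := H s sd.
rewrite mul0r subr0.
have -> : Rintegral mu `[a, b]%classic (fun t => Rint (fun x => EL_weight (phi t) x *
    EL (phi t) (phit t) (phitt t) x * ((Phi s t)^`() x - (phi t)^`() x))) = 0.
  rewrite -[RHS](Rintegral0 `[a, b]%classic).
  apply: eq_Rintegral => t /set_mem It; rewrite -[RHS](Rintegral0 setT).
  by apply: Rint_eq => x; rewrite (EL0 t (abI t It)) mulr0 mul0r.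
by rewrite addr0.
Qed.

End euler_lagrange.

(** * Geodesics and the Proudman-Johnson equation *)

Section geodesic_EL.
Context {R : realType}.
Notation mu := (@lebesgue_measure R).
Variable alpha : R.

Lemma Diff_perturb (p rho : R -> R) (c : R) : in_Diff p -> in_g rho ->
  (forall x, 0 < p^`() x + c * rho^`() x) -> in_Diff (fun x => p x + c * rho x).
Proof.
move=> [f [gf f1 pE]] gr pos.
have Dp := Diff_D1 (ex_intro _ f (And3 gf f1 pE)).
have Df := in_g_D1 gf; have Dr := in_g_D1 gr.
have Ep : p^`() = (fun x => 1 + f^`() x).
  by apply: D1E; rewrite (_ : p = fun x => x + f x); [exact: D1D D1_id Df|exact/funext].
exists (fun x => f x + c * rho x); split.
- by apply: in_gD => //; exact: in_gZ.
- by move=> x; rewrite (D1E (D1D Df (D1Z c Dr))); have := pos x; rewrite Ep; lra.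
by move=> x; rewrite pE addrA.
Qed.

Definition hat (a b t : R) : R := (t - a) * (b - t).
Definition hat1 (a b t : R) : R := a + b - 2 * t.

Lemma continuous_poly2 (p0 p1 p2 : R) : continuous (fun t : R => p0 + p1 * t + p2 * (t * t)).
Proof.
by apply: D1_continuous (D1D (D1D (D1_cst p0) (D1Z p1 (@D1_id R))) (D1Z p2 (D1M (@D1_id R) (@D1_id R)))).
Qed.

Lemma quad_hat (a b : R) : quad (hat a b) (hat1 a b).
Proof.
split.
  rewrite (_ : hat a b = (fun t => - (a * b) + (a + b) * t + -1 * (t * t))).
    exact: continuous_poly2.
  by apply/funext => t; rewrite /hat; ring.
exists 1 => t t'; rewrite mul1r.
have -> : hat a b t' - hat a b t - hat1 a b t * (t' - t) = - (t' - t) ^+ 2.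
  by rewrite /hat /hat1; ring.
by rewrite normrN ger0_norm // sqr_ge0.
Qed.

Lemma quad_hat1 (a b : R) : quad (hat1 a b) (fun=> -2).
Proof.
split.
  rewrite (_ : hat1 a b = (fun t => (a + b) + -2 * t + 0 * (t * t))).
    exact: continuous_poly2.
  by apply/funext => t; rewrite /hat1; ring.
exists 0 => t t'; rewrite mul0r.
have -> : hat1 a b t' - hat1 a b t - -2 * (t' - t) = 0 by rewrite /hat1; ring.
by rewrite normr0.
Qed.

Lemma g_derivative0 (D : set R) : g_derivative_on D (fun _ _ => 0 : R) (fun _ _ => 0).
Proof.
have H := @fam_ds R _ (@in_g0 R) D (fun _ _ => 0) (fun=> 0) (fun=> 0) 0.
have E : (fun s => fam (fun=> 0) (fun _ _ => 0) (fun=> 0) (fun=> 0) s 0) = (fun _ _ => 0 : R).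
  by apply/funext => s; apply/funext => x; rewrite /fam mulr0 addr0.
by rewrite E in H.
Qed.

Lemma affine0 (D : set R) : g_affine D (fun _ _ => 0 : R).
Proof. by apply: in_g_affine => t _; exact: in_g0. Qed.

Lemma continuous0 (D : set R) : g_continuous_on D (fun _ _ => 0 : R).
Proof.
apply: tcont_g_continuous => t Dt; first exact: in_g0.
by have [] := g_derivative_continuous (@affine0 D) (@g_derivative0 D) Dt.
Qed.

(** Its size is limited by the minimum of the Jacobian on the segment, for [Phi s t]
to remain increasing. *)
Lemma affine_proper_variation (a b : R) (phi phit phitt : R -> R -> R) (rho : R -> R) :
  a < b -> let D := `[a, b]%classic in
  (forall t, D t -> in_Diff (phi t)) -> g_derivative_on D phi phit ->
  g_derivative_on D phit phitt -> g_continuous_on D phitt -> in_g rho ->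
  exists2 e, 0 < e & proper_variation a b e phi (fam rho phi (fun=> 0) (hat a b))
     (fam rho phit (fun=> 0) (hat1 a b)).
Proof.
move=> ab D dphi dp dpp cpp grho.
have [m m0 bounds] := curve_bounds dphi dp dpp.
have [N /bdk0 BN] := in_g_tame grho 0%N; have N0 := bd_ge0 BN.
(* A bound for hat * rho'. *)
pose W := (b - a) ^+ 2 * N + 1.
have W0 : 0 < W by rewrite ltr_wpDl // mulr_ge0 // sqr_ge0.
have gp t : D t -> in_g (phit t) by move=> /dp[].
have gpp t : D t -> in_g (phitt t) by move=> /dpp[].
have aphi := Diff_affine dphi; have ap := in_g_affine gp; have app := in_g_affine gpp.
have cphi : g_continuous_on D phi.
  move=> t Dt; apply/(g_cvgP _).
    by apply: filterS (near_pw_in D t) => s Ds; apply: Diff_sub; exact: dphi.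
  have [_ C] := g_derivative_continuous aphi dp Dt.
  move=> k; apply: (small_eq _ (C k)).
  apply: filterS (near_pw_in D t) => s Ds x.
  by rewrite (D1E (D1B (Diff_D1 (dphi s Ds)) (Diff_D1 (dphi t Dt)))).
have cp : g_continuous_on D phit.
  apply: tcont_g_continuous => // t Dt.
  by have [] := g_derivative_continuous ap dpp Dt.
have q0 := quad_cst (R := R) 0; have q1 := quad_hat a b; have q2 := quad_hat1 a b.
have c0 := q0.1; have c1 := q1.1; have c2 := q2.1.
have c3 : continuous (fun _ : R => -2 : R) by have [] := quad_cst (R := R) (-2).
exists (m / W); first by rewrite divr_gt0.
pose J := `]- (m / W), m / W[%classic : set R.
split.
- move=> s t Js Dt.
  have -> : fam rho phi (fun=> 0) (hat a b) s t = fun x => phi t x + (s * hat a b t) * rho x.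
    by apply/funext => x; rewrite /fam add0r.
  apply: Diff_perturb => //; first exact: dphi.
  move=> x; have [/andP[mx _] _] := bounds t Dt x.
  have sW : `|s| < m / W by rewrite ltr_norml; move: Js; rewrite /= in_itv.
  have hW : `|hat a b t * rho^`() x| <= W.
    rewrite normrM; apply: le_trans (_ : (b - a) ^+ 2 * N <= _); last by rewrite lerDl.
    have [_ Nx _] := BN.
    apply: ler_pM => //; rewrite /hat normrM expr2.
    move: Dt; rewrite /D /= in_itv /= => /andP[at_ tb].
    by apply: ler_pM => //; rewrite ger0_norm ?subr_ge0 //; lra.
  have : `|s * hat a b t * rho^`() x| < m.
    rewrite -mulrA normrM; have [->|s0] := eqVneq s 0; first by rewrite normr0 mul0r.
    apply: le_lt_trans (ler_wpM2l (normr_ge0 s) hW) _.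
    by rewrite -ltr_pdivlMr.
  by rewrite ltr_norml => /andP[? _]; lra.
- split; first exact: (fam_continuous grho aphi cphi c0 c1).
  exists (fam rho (fun _ _ => 0) (hat a b) (fun=> 0)), (fam rho phit (fun=> 0) (hat1 a b)); split.
  + by move=> t Dt; exact: fam_ds.
  + by move=> s Js; exact: (fam_dt grho s aphi dp q0 q1).
  + split; first exact: (fam_continuous grho (@affine0 D) (@continuous0 D) c1 c0).
    exists (fam rho (fun _ _ => 0) (fun=> 0) (fun=> 0)), (fam rho (fun _ _ => 0) (hat1 a b) (fun=> 0)); split.
    * by move=> t Dt; exact: fam_ds.
    * by move=> s Js; exact: (fam_dt grho s (@affine0 D) (@g_derivative0 D) q1 q0).
    * split; last by [].
      exact: (fam_continuous grho (@affine0 D) (@continuous0 D) c0 c0).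
    split; last by [].
    exact: (fam_continuous grho (@affine0 D) (@continuous0 D) c2 c0).
  split; first exact: (fam_continuous grho ap cp c0 c2).
  exists (fam rho (fun _ _ => 0) (hat1 a b) (fun=> 0)), (fam rho phitt (fun=> 0) (fun=> -2)); split.
  + by move=> t Dt; exact: fam_ds.
  + by move=> s Js; exact: (fam_dt grho s ap dpp q0 q2).
  + split; last by [].
    exact: (fam_continuous grho (@affine0 D) (@continuous0 D) c2 c0).
  split; last by [].
  exact: (fam_continuous grho app cpp c0 c3).
- by move=> s Js; exact: (fam_dt grho s aphi dp q0 q1).
- by move=> t Dt; apply/funext => x; rewrite /fam mul0r addr0 mul0r addr0.
move=> s Js; split; apply/funext => x; rewrite /fam /hat; ring.
Qed.

(** If [B t0 = EL (t0)] is not zero, the first variation along [rho] with [rho' = B t0]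
and profile [hat] is the integral of [- hat * kap], where [kap t0] is the weighted
square norm of [B t0].  As [kap] is continuous it is positive on a short segment. *)
Lemma geodesic_EL0 (I : set R) (phi phit phitt : R -> R -> R) :
  is_interval I -> (exists p q, [/\ I p, I q & p < q]) ->
  (forall t, I t -> in_Diff (phi t)) -> g_derivative_on I phi phit ->
  g_derivative_on I phit phitt -> g_continuous_on I phitt ->
  geodesic (alpha_H1dot alpha) I phi ->
  forall t, I t -> forall x, EL alpha (phi t) (phit t) (phitt t) x = 0.
Proof.
move=> iI pq dphi dp dpp cpp geo t0 It0 x0.
apply/eqP/negPn/negP => EL_neq0.
have gp t : I t -> in_g (phit t) by move=> /dp[].
have gpp t : I t -> in_g (phitt t) by move=> /dpp[].
have aphi := Diff_affine dphi; have ap := in_g_affine gp; have app := in_g_affine gpp.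
pose B t := EL alpha (phi t) (phit t) (phitt t).
pose w t := EL_weight alpha (phi t).
have mB t : I t -> tame true (B t).
  by move=> It; apply: tame_EL; [exact: dphi|exact: gp|exact: gpp].
have mw t : I t -> tame false (w t) by move=> It; apply: tame_EL_weight; exact: dphi.
have mwB t It : tame true (fun x => w t x * B t x) := tameM (mw t It) (mB t It).
have mP t It := in_g_tame (gp t It); have mPP t It := in_g_tame (gpp t It).
have [rho [grho Drho]] := g_antiderivative (mB t0 It0).
pose kap t := Rint (fun x => w t x * B t x * B t0 x).
have mk t : I t -> tame true (fun x => w t x * B t x * B t0 x).
  by move=> It; exact: tameM (mwB t It) (mB t0 It0).
have tk t : I t -> tcont true I (fun t x => w t x * B t x * B t0 x) t.
  move=> It.
  have [tA mA] := tder_powR (- alpha - 1 - 1) dphi dp It.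
  have mtA : tame false (fun x => (- alpha - 1 - 1) * (phi t)^`() x `^ (- alpha - 1 - 1 - 1) * (phit t)^`() x).
    apply: (tameM (b1 := false) (b2 := false)); last exact: tame_false (mP t It).
    by apply: tameZ; have [_] := tder_powR (- alpha - 1 - 1 - 1) dphi dp It.
  have cw : tcont false I w t := tder_tcont mtA tA.
  have [_ cphi] := g_derivative_continuous aphi dp It.
  have [_ cP] := g_derivative_continuous ap dpp It.
  have [_ cPP] := g_continuous_tcont app cpp It.
  pose proof (cvgtoM (Diff_tame (dphi t It)) (mPP t It) (cvgto_false cphi) cPP) as T1.
  pose proof (cvgtoZ ((alpha + 1) / 2) (cvgtoM (mP t It) (mP t It) cP cP)) as T2.
  pose proof (cvgtoM (mw t It) (mB t It) cw (cvgtoB T1 T2)) as T3.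
  have T4 : cvgto (pw I t) true (fun=> B t0) (B t0) by exact: cvgto_cst.
  exact: (cvgtoM (mwB t It) (mB t0 It0) T3 T4).
have ck := Rint_within_continuous mk tk.
have k0 : 0 < kap t0.
  apply: (@Rint_gt0 _ _ x0); first exact: mk.
    move=> y; rewrite -mulrA; apply: mulr_ge0; last by rewrite -expr2 sqr_ge0.
    by apply: ltW; apply: EL_weight_gt0; exact: dphi.
  rewrite -mulrA; apply: mulr_gt0; first by apply: EL_weight_gt0; exact: dphi.
  by rewrite -expr2 exprn_even_gt0.
pose c := kap t0 / 2.
have c0 : 0 < c by rewrite divr_gt0.
have [d d0 Hd] : exists2 d, 0 < d & forall t, I t -> `|t - t0| < d -> c <= kap t.
  have /subspace_continuousP/(_ t0 It0)/cvgrPdist_le/(_ c c0) H := ck.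
  have [d d0 Hd] := near_pw_ex (P := fun t => `|kap t0 - kap t| <= c) H.
  exists d; first exact: d0.
  move=> t It td.
  have := Hd t It td; rewrite ler_norml => /andP[_].
  by rewrite /c; move: (kap t0) (kap t) => p q; clear; lra.
have PF := pd_proper iI pq It0.
have [a [b [ab abI Hab]]] : exists a b, [/\ a < b, `[a, b]%classic `<=` I &
    forall t, `[a, b]%classic t -> c <= kap t].
  have d2 : 0 < d / 2 by rewrite divr_gt0.
  have [s [[Is s0] sd]] := filter_ex (filterI (filterI (near_pd_in I t0) (near_pd_neq I t0)) (near_pd_small I t0 d2)).
  have [a [b [ab Ia Ib abd]]] : exists a b, [/\ a < b, I a, I b & forall t, a <= t <= b -> `|t - t0| <= d / 2].
    have [st|ts] := ltP s t0.
      exists s, t0; split=> // t /andP[st' tt].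
      by move: sd; rewrite !ler0_norm ?subr_le0 ?(ltW st) //; lra.
    exists t0, s; split=> [|//|//|t /andP[tt ts']].
      by rewrite lt_neqAle ts andbT eq_sym -subr_eq0.
    by move: sd; rewrite !ger0_norm ?subr_ge0 //; lra.
  have abI : `[a, b]%classic `<=` I.
    by move=> t; rewrite /= in_itv /=; exact: iI.
  exists a, b; split; [exact: ab|exact: abI|move=> t It].
  apply: (Hd t (abI t It)); move: It; rewrite /= in_itv /= => /abd td.
  by apply: le_lt_trans td _; rewrite ltr_pdivrMr ?ltr0n // ltr_pMr // ltr1n.
have dphi' t : `[a, b]%classic t -> in_Diff (phi t) by move=> /abI; exact: dphi.
have dp' := g_derivative_sub abI dp; have dpp' := g_derivative_sub abI dpp.
have cpp' := g_continuous_sub abI cpp.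
have [e e0 PV] := affine_proper_variation ab dphi' dp' dpp' cpp' grho.
have dE := geo a b ab abI e _ _ e0 PV.
have [d1 [K [d10 d1e HV]]] := energy_var alpha ab e0 dphi' dp' dpp' cpp' PV.
set E := fun s => _ in dE.
have chat : {within `[a, b]%classic, continuous (hat a b)}.
  by apply: continuous_subspaceT; exact: (quad_hat a b).1.
have ckap : {within `[a, b]%classic, continuous kap}.
  exact: continuous_subspaceW abI ck.
have chk := within_cM chat ckap.
pose L := Rintegral mu `[a, b]%classic (fun t => hat a b t * kap t).
have kE s t : `[a, b]%classic t -> Rint (fun x => EL_weight alpha (phi t) x *
    EL alpha (phi t) (phit t) (phitt t) x *
    ((fam rho phi (fun=> 0) (hat a b) s t)^`() x - (phi t)^`() x)) = s * (hat a b t * kap t).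
  move=> It; have [M /bdk0 BM] := mk t (abI t It) 0%N.
  rewrite mulrA -(RintZ (s * hat a b t) BM); apply: Rint_eq => x.
  have -> : fam rho phi (fun=> 0) (hat a b) s t = fun x => phi t x + (s * hat a b t) * rho x.
    by apply/funext => y; rewrite /fam add0r.
  rewrite (D1E (D1D (Diff_D1 (dphi' t It)) (D1Z _ Drho))) /w /B.
  move: (EL alpha (phi t0) _ _ x) => v.
  move: (EL_weight _ _ _) (EL _ _ _ _ _) (_^`() x) (hat a b t) => p q r u; ring.
have dEL : is_derive (0 : R) (1 : R) E (- L).
  apply: (is_derive_quad (d := d1) (K := K) d10) => s sd; have [_] := HV s sd.
  have -> : Rintegral mu `[a, b]%classic (fun t => Rint (fun x => EL_weight alpha (phi t) x *
    EL alpha (phi t) (phit t) (phitt t) x *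
    ((fam rho phi (fun=> 0) (hat a b) s t)^`() x - (phi t)^`() x))) = s * L.
    rewrite -(within_RintegralZ s chk).
    by apply: eq_Rintegral => t /set_mem It; exact: kE.
  by rewrite mulNr opprK [L * s]mulrC.
have L0 : L = 0.
  have E1 := @derive_val _ _ _ _ _ _ _ dE; have E2 := @derive_val _ _ _ _ _ _ _ dEL.
  by apply/eqP; rewrite -oppr_eq0 -E2 E1.
(* An antiderivative of hat, for the lower bound c (b - a) ^ 3 / 6 of L. *)
pose F (t : R) := (a + b) / 2 * (t * t) - a * b * t - 3^-1 * (t * t * t).
have DF : D1 F (hat a b).
  pose proof (D1B (D1B (D1Z ((a + b) / 2) (D1M (@D1_id R) (@D1_id R))) (D1Z (a * b) (@D1_id R)))
    (D1Z 3^-1 (D1M (D1M (@D1_id R) (@D1_id R)) (@D1_id R)))) as H.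
  by apply: D1_eq H _ => t; rewrite /hat; field.
have : c * ((b - a) ^+ 3 / 6) <= L.
  have -> : (b - a) ^+ 3 / 6 = Rintegral mu `[a, b]%classic (hat a b).
    have cF : {within `[a, b]%classic, continuous F}.
      by apply: continuous_subspaceT; exact: D1_continuous DF.
    rewrite (Rintegral_itv_FTC ab chat cF (fun t _ => DF t)).
    by rewrite /F; field.
  rewrite -(within_RintegralZ c chat).
  apply: le_Rintegral.
  - exact: measurable_itv.
  - by apply: within_integrable; exact: within_cZ.
  - exact: within_integrable chk.
  move=> t It; rewrite mulrC; apply: ler_wpM2l; last exact: Hab.
  by move: It; rewrite /hat /= in_itv /= => /andP[? ?]; rewrite mulr_ge0 // subr_ge0.
rewrite L0; apply/negP; rewrite -ltNge; apply: mulr_gt0; first exact: c0.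
by apply: divr_gt0; [rewrite exprn_gt0 // subr_gt0; exact: ab|rewrite ltr0n].
Qed.

Lemma interval_two_points (I : interval R) : [set` I]° !=set0 ->
  exists p q, [/\ [set` I] p, [set` I] q & p < q].
Proof.
move=> [x /= [d /= d0 Hd]]; exists x, (x + d / 2); split; last by rewrite ltrDl divr_gt0.
- by apply: Hd; rewrite /ball_ /= subrr normr0.
apply: Hd; rewrite /ball_ /= opprD addrA subrr sub0r normrN gtr0_norm ?divr_gt0 //; lra.
Qed.

(** The factor [phi_x ^ 2] in [lagrangian_residual] is positive and [phi] is onto. *)
Lemma EL0_PJ phi phit phitt u ut : in_Diff phi ->
  in_g phit -> in_g phitt -> in_g u -> in_g ut ->
  (forall x, phit x = u (phi x)) ->
  (forall x, phitt x = ut (phi x) + u^`() (phi x) * phit x) ->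
  (forall x, EL alpha phi phit phitt x = 0) <-> proudman_johnson alpha u ut.
Proof.
move=> dphi gp gpp gu gut E1 E2; rewrite (PJ_integrated alpha gu gut).
have H := lagrangian_residual alpha dphi gp gpp gu gut E1 E2.
split=> [H0 y|H0 x]; last by rewrite /EL H H0 mulr0.
have [psi K] := Diff_surj dphi.
have := H0 (psi y); rewrite /EL H K => /eqP; rewrite !mulf_eq0 orbb.
by rewrite gt_eqF ?Diff_gt0 //= => /eqP.
Qed.

Lemma euler_arnold_PJ : euler_arnold (alpha_H1dot alpha) (proudman_johnson alpha).
Proof.
move=> I phi phit u I0 [dphi [dp [phitt [gp dpp cpp]]]] Eu.
have pq := interval_two_points I0.
have iI : is_interval [set` I] by exact: interval_is_interval.
have C1 : C1_curve_g [set` I] phit phitt by split.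
have [ut [[gu du cut] Eut]] := eulerian_C1 dphi dp C1 Eu.
have gpp t : [set` I] t -> in_g (phitt t) by move=> /dpp[].
have gut t : [set` I] t -> in_g (ut t) by move=> /du[].
have key t : [set` I] t ->
    (forall x, EL alpha (phi t) (phit t) (phitt t) x = 0) <-> proudman_johnson alpha (u t) (ut t).
  move=> It; apply: EL0_PJ.
  - exact: dphi.
  - exact: gp.
  - exact: gpp.
  - exact: gu.
  - exact: gut.
  - by move=> x; rewrite -(Eu t It).
  exact: Eut.
split=> [geo|[ut2 [[gu2 du2 cut2] H2]]].
  exists ut; split; first by split.
  move=> t It; apply/(key t It); exact: (geodesic_EL0 iI pq dphi dp dpp cpp geo It).
apply: (EL0_geodesic dphi dp dpp cpp) => t It; apply/(key t It).
have PF := pd_proper iI pq It.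
have <- : ut2 t = ut t := g_derivative_unique PF (in_g_affine gu) du2 du It.
exact: H2.
Qed.

End geodesic_EL.

(** * Existence for alpha = 1 *)

Section exponential.
Context {R : realType}.
Implicit Types (h g : R -> R).

Lemma D1_exp g g' : D1 g g' -> D1 (fun x => expR (g x)) (fun x => g' x * expR (g x)).
Proof.
have De : D1 (@expR R) (@expR R) by move=> x; exact: is_derive_expR.
by move=> Dg; apply: D1_eq (D1_comp De Dg) _ => x; rewrite mulrC.
Qed.

Lemma tame_exp g : tame false g -> tame false (fun x => expR (g x)).
Proof.
move=> mg; have Dg := D1_exp (tame_D1 mg).
have [M /bdk0 BM] := mg 0%N; have [_ supM _] := BM.
have B0 : bd false (expR M) (fun x => expR (g x)).
  split=> // [|x]; first exact: D1_continuous Dg.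
  by rewrite gtr0_norm ?expR_gt0 // ler_expR; apply: le_trans (ler_norm _) (supM x).
elim=> [|k [N BN]]; first by exists (expR M).
have [L BL] := tame_derive mg k.
pose C := Num.max (expR M) (2 ^+ k * (L * N)).
exists C; apply: (bdkSI Dg); first by apply: bd_le B0; rewrite le_max lexx.
by apply: bdk_le (bdkM BL BN); rewrite le_max lexx orbT.
Qed.

Lemma expR_taylor (y : R) : `|expR y - 1 - y| <= expR `|y| * y ^+ 2.
Proof.
have De : D1 (@expR R) (@expR R) by move=> x; exact: is_derive_expR.
have [c [c0y Ec]] := D1_MVT 0 y (D1B De (@D1_id R)).
have [d [d0c Ed]] := D1_MVT 0 c De.
rewrite expR0 subr0 in Ed; rewrite expR0 !subr0 in Ec.
have -> : expR y - 1 - y = (expR c - 1) * y by rewrite -Ec; ring.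
rewrite Ed !normrM gtr0_norm ?expR_gt0 // -mulrA -real_normK ?num_real // expr2.
have cy : `|c| <= `|y| by have := between_le c0y; rewrite !subr0.
have dc : `|d| <= `|c| by have := between_le d0c; rewrite !subr0.
apply: ler_pM; [exact: expR_ge0|exact: mulr_ge0| |].
  by rewrite ler_expR; apply: le_trans (ler_norm _) _; exact: le_trans dc cy.
exact: ler_wpM2r.
Qed.

(** The derivative of the error at order [k + 1] is [h'] times [c] times a quotient
which is bounded at order [k]. *)
Lemma exp_quotient {T : Type} (FT : set_system T) {FF : Filter FT} (c : T -> R) h : tame true h ->
  (\forall p \near FT, c p != 0) -> (forall e : R, 0 < e -> \forall p \near FT, `|c p| <= e) ->
  cvgto FT true (fun p x => (expR (c p * h x) - 1) / c p) h.
Proof.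
move=> mh cn0 c0; have Dh := tame_D1 mh.
have DX (a : R) : D1 (fun x => (expR (a * h x) - 1) / a) (fun x => (a * h^`() x * expR (a * h x)) / a).
  apply: D1Zr; apply: D1_eq (D1B (D1_exp (D1Z a Dh)) (D1_cst 1)) _ => x.
  by rewrite subr0.
have S0 : small FT true 0 (fun p x => (expR (c p * h x) - 1) / c p - h x).
  move=> e e0; have [M /bdk0 BM] := mh 0%N; have [_ supM _] := BM; have M0 := bd_ge0 BM.
  have BMM : bd true (M * M) (fun x => h x * h x) := bdM BM BM.
  pose A := expR M * (M * M).
  have A0 : 0 <= A by rewrite mulr_ge0 ?expR_ge0 // mulr_ge0.
  have e1 : 0 < e / (A + 1) by rewrite divr_gt0 // ltr_wpDl.
  apply: filterS3 cn0 (c0 _ e1) (c0 1 ltr01) => p cp cpe cp1; split; last by [].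
  have B : bd true e (fun x => `|c p| * expR M * (h x * h x)).
    apply: (@bd_le _ true (`| `|c p| * expR M| * (M * M))); last exact: bdZ.
    rewrite normrM normr_id (gtr0_norm (expR_gt0 _)) -mulrA.
    apply: le_trans (ler_wpM2r A0 cpe) _; rewrite mulrC.
    by apply: mul_divr_le => //; exact: ltW.
  apply: bd_dom B => [|x].
    apply: D1_continuous (D1B (DX (c p)) Dh).
  have -> : (expR (c p * h x) - 1) / c p - h x = (expR (c p * h x) - 1 - c p * h x) / c p.
    by field.
  rewrite normrM normfV ler_pdivrMr ?normr_gt0 //.
  apply: le_trans (expR_taylor _) _.
  have -> : `|c p| * expR M * (h x * h x) * `|c p| = expR M * (c p * h x) ^+ 2.
    by rewrite exprMn -[c p ^+ 2]real_normK ?num_real //; ring.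
  apply: ler_wpM2r; first exact: sqr_ge0.
  rewrite ler_expR normrM; apply: le_trans (_ : 1 * M <= _); last by rewrite mul1r.
  by apply: ler_pM.
elim=> [|k IH]; first exact: S0.
have [M BM] := mh k.
have Bk : \forall p \near FT, bdk true k (1 + M) (fun x => (expR (c p * h x) - 1) / c p).
  apply: filterS (IH 1 ltr01) => p B; have := bdkD B BM.
  by apply: bdk_eq => x; rewrite subrK.
pose proof (small_scal c0 Bk) as S1.
pose proof (small_tameM (tame_derive mh) S1) as S2.
move=> e e0; apply: filterS3 (S0 e e0) (S2 e e0) cn0 => p /bdk0 B0 B1 cp.
apply: (bdkSI (D1B (DX (c p)) Dh) B0); apply: bdk_eq B1 => x.
by field.
Qed.

Lemma tder_exp (D : set R) h f t : tame true h -> tame false f ->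
  tder true D (fun s x => f x * expR (s * h x)) (fun x => f x * expR (t * h x) * h x) t.
Proof.
move=> mh mf.
pose proof (exp_quotient mh (near_pd_neq D t) (near_pd_small D t)) as Q.
have me : tame false (fun x => f x * expR (t * h x)).
  apply: (tameM (b1 := false) (b2 := false)) => //.
  by apply: tame_exp; apply: tameZ; exact: tame_false mh.
have CC : cvgto (pd D t) false (fun _ x => f x * expR (t * h x)) (fun x => f x * expR (t * h x)).
  exact: cvgto_cst.
pose proof (cvgtoM me mh CC Q) as H.
apply: (cvgto_ext H) => [s x|//].
have -> : s * h x = t * h x + (s - t) * h x by ring.
by rewrite expRD; ring.
Qed.

Lemma g_family_antiderivative (H : R -> R -> R) : (forall t, tame true (H t)) ->
  exists U : R -> R -> R, forall t, in_g (U t) /\ D1 (U t) (H t).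
Proof. by move=> mH; have [U HU] := choice (fun t => g_antiderivative (mH t)); exists U. Qed.

Lemma g_inj (u v : R -> R) : in_g u -> in_g v -> u^`() = v^`() -> u = v.
Proof.
move=> gu gv E; apply/funext => x; apply/eqP; rewrite -subr_eq0 -normr_le0.
apply: (in_g_sup (in_gB gu gv)).
rewrite (D1E (D1B (in_g_D1 gu) (in_g_D1 gv))) E.
by apply: (bdk0 (k := 0)); apply: bdk_eq0 => // y; rewrite subrr.
Qed.

(** [EL = 0] reads [(log phi_x)_tt = 0], so [phi_x = exp (t u0_x)], which never
degenerates; [phi] and its time derivatives are obtained by integration in [x]. *)
Lemma PJ1_existence (D : set R) (u0 : R -> R) : in_g u0 ->
  exists2 u, solution (proudman_johnson 1) D u & u 0 = u0.
Proof.
move=> gu0; have mh := in_g_tame gu0; set h := u0^`() in mh.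
have m0h := tame_false mh.
have tE t f mf := @tder_exp D h f t mh mf.
have mE t : tame false (fun x => expR (t * h x)) by apply: tame_exp; exact: tameZ.
have mE1 t : tame true (fun x => expR (t * h x) - 1).
  have D1E1 : D1 (fun x => expR (t * h x) - 1) (fun x => t * h^`() x * expR (t * h x)).
    apply: D1_eq (D1B (D1_exp (D1Z t (tame_D1 mh))) (D1_cst 1)) _ => x; by rewrite subr0.
  apply: (tame_I D1E1); last by exact: tameM (tameZ t (tame_derive mh)) (mE t).
  have [M /bdk0 BM] := mh 0%N; have [_ supM _] := BM.
  pose C := expR (`|t| * M) * `|t|.
  exists (`|C| * M); apply: bd_dom (bd_abs (bdZ C BM)) => [|x].
    exact: D1_continuous D1E1.
  have De : D1 (@expR R) (@expR R) by move=> y; exact: is_derive_expR.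
  have [c [c0 Ec]] := D1_MVT 0 (t * h x) De.
  rewrite expR0 subr0 in Ec; rewrite Ec normrM gtr0_norm ?expR_gt0 //.
  rewrite normrM [leRHS]normrM /C normrM normr_id (gtr0_norm (expR_gt0 (`|t| * M))) mulrA.
  apply: ler_wpM2r => //; apply: ler_wpM2r => //; rewrite ler_expR.
  apply: le_trans (ler_norm _) _; have := between_le c0; rewrite !subr0 => cl.
  by apply: le_trans cl _; rewrite normrM; exact: ler_wpM2l.
have mE2 t : tame true (fun x => h x * expR (t * h x)) := tameM mh (mE t).
have mE3 t : tame true (fun x => h x * h x * expR (t * h x)) := tameM (tameM mh mh) (mE t).
have [rho Hrho] := g_family_antiderivative mE1.
have [phit Hphit] := g_family_antiderivative mE2.
have [phitt Hphitt] := g_family_antiderivative mE3.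
pose phi t x := x + rho t x.
have grho t : in_g (rho t) := (Hrho t).1.
have gp t : in_g (phit t) := (Hphit t).1.
have gpp t : in_g (phitt t) := (Hphitt t).1.
have Erho t := D1E (Hrho t).2; have Ep t := D1E (Hphit t).2; have Epp t := D1E (Hphitt t).2.
have Ephi t : (phi t)^`() = (fun x => expR (t * h x)).
  by apply: D1E; apply: D1_eq (D1D (@D1_id R) (Hrho t).2) _ => x; rewrite addrC subrK.
have dphi t : in_Diff (phi t).
  exists (rho t); split=> // x; rewrite Erho.
  by have := expR_gt0 (t * h x); move: (expR _) => y; lra.
have m1 : tame false (fun _ : R => 1 : R) := tame_cst 1.
have drho : g_derivative_on D rho phit.
  apply: tder_g_derivative => // t Dt; rewrite Ep.
  apply: (cvgto_ext (tE t _ m1)) => [s x|x]; last by rewrite mul1r mulrC.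
  by rewrite !Erho; congr (_ / _); ring.
have dp : g_derivative_on D phi phit.
  move=> t Dt; have [_ C] := drho t Dt; split; first exact: gp.
  rewrite (_ : (fun s x => (phi s x - phi t x) / (s - t)) = fun s x => (rho s x - rho t x) / (s - t)).
    exact: C.
  by apply/funext => s; apply/funext => x; rewrite /phi; congr (_ / _); ring.
have dpp : g_derivative_on D phit phitt.
  apply: tder_g_derivative => // t Dt; rewrite Epp.
  apply: (cvgto_ext (tE t _ m0h)) => [s x|x]; last by ring.
  by rewrite !Ep.
have cpp : g_continuous_on D phitt.
  apply: tcont_g_continuous => // t Dt.
  have mhh : tame false (fun x => h x * h x) := tameM m0h m0h.
  have mtE : tame true (fun x => h x * h x * expR (t * h x) * h x) := tameM (mE3 t) mh.
  apply: (tder_tcont mtE).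
  apply: (cvgto_ext (tE t _ mhh)) => [s x|//].
  by rewrite !Epp.
have [psi Kpsi] := choice (fun t => Diff_surj (dphi t)).
have K t x : psi t (phi t x) = x.
  by have [m Hm] := Diff_diffeo (dphi t) (Kpsi t); exact: diffeoK Hm x.
pose u t y := phit t (psi t y).
have Eu : eulerian_velocity D phit phi u.
  by move=> t _; apply/funext => x; rewrite /u /= K.
have CC : C1_curve_g D phit phitt by split.
have [ut [C1 E2]] := eulerian_C1 (fun t _ => dphi t) dp CC Eu.
exists u.
  exists ut; split; first exact: C1.
  move=> t Dt; have [gu du _] := C1; have [gut _] := du t Dt.
  apply/(EL0_PJ 1 (dphi t) (gp t) (gpp t) (gu t Dt) gut _ (E2 t Dt)).
    by move=> x; rewrite /u K.
  move=> x; rewrite /EL Ephi Ep Epp; cbv beta; set p := expR _; set q := h x; by field.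
have rho0 : rho 0 = (fun=> 0).
  apply: g_inj => //; first exact: in_g0.
  by rewrite Erho (D1E (D1_cst 0)); apply/funext => y; rewrite mul0r expR0 subrr.
have phi0 z : phi 0 z = z by rewrite /phi rho0 addr0.
have phit0 : phit 0 = u0.
  apply: g_inj => //; rewrite Ep; apply/funext => z; by rewrite mul0r expR0 mulr1.
by apply/funext => y; rewrite /u phit0 -{1}[psi 0 y]phi0 Kpsi.
Qed.

End exponential.

(** * Uniqueness for alpha = 1 *)

Section uniqueness_PJ1.
Context {R : realType}.

(** [w - h v w_x] is [w] at the displaced point [x - h v], up to [O(h ^ 2)]: transport
does not increase the supremum. *)
Lemma transport_step (w w' w'' wt v : R -> R) (A N K h x : R) :
  D1 w w' -> D1 w' w'' -> (forall y, `|w'' y| <= A) -> (forall y, `|v y| <= A) ->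
  (forall y, `|w y| <= N) -> (forall y, `|wt y + v y * w' y| <= K * N) -> 0 <= h ->
  `|w x + h * wt x| <= N * (1 + h * K) + A ^+ 3 * h ^+ 2.
Proof.
move=> Dw Dw' A2 Av wN F h0.
have T := D1_taylor Dw Dw' A2 x (x - h * v x).
have A0 : 0 <= A := le_trans (normr_ge0 _) (Av x).
have -> : w x + h * wt x = w (x - h * v x) + h * (wt x + v x * w' x)
   - (w (x - h * v x) - w x - w' x * (x - h * v x - x)) by ring.
apply: le_trans (ler_normB _ _) _; apply: lerD.
  apply: le_trans (ler_normD _ _) _; rewrite [leRHS]mulrDr mulr1; apply: lerD; first exact: wN.
  rewrite normrM ger0_norm // mulrCA; apply: ler_wpM2l => //.
  by rewrite [leRHS]mulrC; exact: F.
apply: le_trans T _.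
have -> : x - h * v x - x = - (h * v x) by ring.
have -> : A ^+ 3 * h ^+ 2 = A * (h ^+ 2 * A ^+ 2) by ring.
rewrite sqrrN exprMn; apply: ler_wpM2l => //; apply: ler_wpM2l; first exact: sqr_ge0.
rewrite -real_normK ?num_real //; apply: lerXn2r; rewrite ?nnegrE //.
Qed.

(** Continuous induction on [sup |w| <= d exp ((K + 1) t)], where the unit of slack in
the rate absorbs the errors of the Euler steps; then [d] tends to [0]. *)
Lemma sup_gronwall (T K C : R) (w wt : R -> R -> R) : 0 <= T -> 0 <= K -> 0 <= C ->
  let D := `[0, T]%classic in
  (forall t, D t -> tame false (wt t)) -> (forall t, D t -> tder false D w (wt t) t) ->
  (forall t N, D t -> (forall x, `|w t x| <= N) -> forall h x, 0 <= h ->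
     `|w t x + h * wt t x| <= N * (1 + h * K) + C * h ^+ 2) ->
  (forall x, w 0 x = 0) -> forall x, w T x = 0.
Proof.
move=> T0 K0 C0 D mwt dw step w0.
pose E s := expR ((K + 1) * s).
have E0 s : 0 < E s by exact: expR_gt0.
have K1 : 0 <= K + 1 by rewrite addr_ge0.
have Emono r s : r <= s -> E r <= E s by move=> rs; rewrite ler_expR; exact: ler_wpM2l.
suff W (d : R) : 0 < d -> forall x, `|w T x| <= d * E T.
  move=> x; apply/eqP; rewrite -normr_le0; apply/ler_addgt0Pr => e e0; rewrite add0r.
  have ET : 0 < e / E T by rewrite divr_gt0.
  by have := W _ ET x; rewrite divfK // gt_eqF.
move=> d0; pose P s := forall x, `|w s x| <= d * E s.
have inD s : 0 <= s -> s <= T -> D s by move=> s0 sT; rewrite /D /= in_itv /= s0.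
apply: (@real_induction R P 0 T T0).
- by move=> x; rewrite w0 normr0; apply: mulr_ge0; exact: ltW.
- move=> s /andP[s0 sT] Ps.
  have Ds := inD s s0 (ltW sT).
  have d2 : 0 < d / 2 by rewrite divr_gt0.
  have [d1 d10 Hd1] := near_pd_ex (dw s Ds 0%N _ d2).
  (* Half of d for the difference quotient, half for the quadratic error. *)
  pose e := Num.min (d1 / 2) (d / 2 / (C + 1)).
  have e0 : 0 < e by rewrite lt_min !divr_gt0 // ltr_wpDl.
  have [ed1 eC] : e <= d1 / 2 /\ e <= d / 2 / (C + 1).
    by have := lexx e; rewrite {2}/e le_min => /andP[].
  exists e; first exact: e0.
  move=> r sr re rT x.
  pose h := r - s; have h0 : 0 < h by rewrite subr_gt0.
  have he : h <= e by rewrite /h lerBlDl.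
  have Dr : D r by apply: inD => //; apply: le_trans s0 (ltW sr).
  have hd1 : `|r - s| < d1.
    rewrite gtr0_norm //; apply: le_lt_trans he _; apply: le_lt_trans ed1 _.
    by rewrite ltr_pdivrMr // ltr_pMr // ltr1n.
  have rs : r != s by rewrite gt_eqF.
  have B := bdk_sup (Hd1 r Dr rs hd1) x.
  have -> : w r x = (w s x + h * wt s x) + h * ((w r x - w s x) / (r - s) - wt s x).
    by rewrite /h; field; rewrite gt_eqF // subr_gt0.
  apply: le_trans (ler_normD _ _) _.
  have S1 := step s _ Ds Ps h x (ltW h0).
  have S2 : `|h * ((w r x - w s x) / (r - s) - wt s x)| <= h * (d / 2).
    by rewrite normrM gtr0_norm //; apply: ler_wpM2l; [exact: ltW|exact: B].
  apply: le_trans (lerD S1 S2) _.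
  have S3 : C * h ^+ 2 <= h * (d / 2).
    rewrite expr2 mulrA mulrC; apply: ler_wpM2l; first exact: ltW.
    apply: le_trans (ler_wpM2l C0 (le_trans he eC)) _.
    by apply: mul_divr_le => //; exact: ltW.
  have Er : E r = E s * expR ((K + 1) * h) by rewrite /E -expRD /h; congr expR; ring.
  have S4 : d * E s * (1 + (K + 1) * h) <= d * E r.
    rewrite Er mulrA; apply: ler_wpM2l; last exact: expR_ge1Dx.
    by apply: mulr_ge0; exact: ltW.
  apply: le_trans S4.
  have S5 : d * h <= d * E s * h.
    apply: ler_wpM2r; first exact: ltW.
    rewrite ler_pMr //; rewrite /E -[leLHS]expR0 ler_expR mulr_ge0 //.
  move: S3 S5; move: (d * E s) (C * h ^+ 2) => p q; clear; lra.
move=> s /andP[s0 sT] IH x.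
have Ds := inD s (ltW s0) sT.
apply/ler_addgt0Pr => e e0.
have cw := tder_tcont (mwt s Ds) (dw s Ds).
have [d1 d10 Hd1] := near_pw_ex (cw 0%N e e0).
pose r := Num.max 0 (s - d1 / 2).
have d12 : 0 < d1 / 2 by rewrite divr_gt0.
have rs : r < s by rewrite gt_max s0 /= gtrBl.
have r0 : 0 <= r by rewrite le_max lexx.
have rd : `|r - s| < d1.
  have sr : s - d1 / 2 <= r by rewrite le_max lexx orbT.
  by rewrite ltr0_norm ?subr_lt0 //; move: sr d10; clear; lra.
have Dr := inD r r0 (le_trans (ltW rs) sT).
have B := bdk_sup (Hd1 r Dr rd) x.
have Pr := IH r (introT andP (conj r0 rs)) x.
have -> : w s x = w r x - (w r x - w s x) by ring.
apply: le_trans (ler_normB _ _) _; apply: lerD; last exact: B.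
apply: le_trans Pr _; apply: ler_wpM2l; first exact: ltW.
by apply: Emono; exact: ltW.
Qed.

(** The difference [w] of two solutions satisfies
[(w_t + v w_x - v_x w)_x = - w (u_xx + v_xx)], without derivatives of [w] on the
right, so that [w_t + v w_x] is bounded by a multiple of [sup |w|]. *)
Lemma PJ1_unique_segment (T : R) (u ut v vt : R -> R -> R) : 0 <= T ->
  let D := `[0, T]%classic in
  C1_curve_g D u ut -> C1_curve_g D v vt ->
  (forall t, D t -> proudman_johnson 1 (u t) (ut t)) ->
  (forall t, D t -> proudman_johnson 1 (v t) (vt t)) ->
  u 0 = v 0 -> v T = u T.
Proof.
move=> T0 D [gu du cut] [gv dv cvt] eu ev uv0.
have gut t : D t -> in_g (ut t) by move=> /du[].
have gvt t : D t -> in_g (vt t) by move=> /dv[].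
have cont (V Vt : R -> R -> R) : (forall t, D t -> in_g (V t)) -> g_derivative_on D V Vt -> g_continuous_on D V.
  move=> gV dV; apply: tcont_g_continuous; first exact: gV.
  by move=> t Dt; have [] := g_derivative_continuous (in_g_affine gV) dV Dt.
have [r1 r10 Bu] := curve_bdk 1 gu (cont u ut gu du).
have [r2 r20 Bv] := curve_bdk 1 gv (cont v vt gv dv).
pose A := r1^-1 + r2^-1.
have i1 : 0 < r1^-1 by rewrite invr_gt0.
have i2 : 0 < r2^-1 by rewrite invr_gt0.
have A0 : 0 <= A by rewrite addr_ge0 // ltW.
have A2 : r2^-1 <= A by rewrite lerDr ltW.
pose w t x := v t x - u t x; pose wt t x := vt t x - ut t x.
have gw t : D t -> in_g (w t) by move=> Dt; apply: in_gB; [exact: gv|exact: gu].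
have gwt t : D t -> in_g (wt t) by move=> Dt; apply: in_gB; [exact: gvt|exact: gut].
have K0 : 0 <= A + A by rewrite addr_ge0.
have A30 : 0 <= A ^+ 3 by rewrite exprn_ge0.
have main := @sup_gronwall T (A + A) (A ^+ 3) w wt T0 K0 A30.
suff W : forall x, w T x = 0.
  by apply/funext => x; apply/eqP; rewrite -subr_eq0; apply/eqP; exact: W.
apply: main.
- by move=> t Dt; apply: in_g_tameF; exact: gwt.
- move=> t Dt.
  have [t1 _] := g_derivative_tder (in_g_affine gv) dv Dt.
  have [t2 _] := g_derivative_tder (in_g_affine gu) du Dt.
  exact: difB t1 t2.
- move=> t N Dt wN h x h0.
  have Du := in_g_D1 (gu t Dt); have Dv := in_g_D1 (gv t Dt).
  have mu1 := in_g_tame (gu t Dt); have mv1 := in_g_tame (gv t Dt).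
  have Du1 := tame_D1 mu1; have Dv1 := tame_D1 mv1.
  have Dut := in_g_D1 (gut t Dt); have Dvt := in_g_D1 (gvt t Dt).
  have Dw : D1 (w t) (fun x => (v t)^`() x - (u t)^`() x) := D1B Dv Du.
  have Dw1 := D1B Dv1 Du1.
  have Bu1 := bdk0 (bdkS (Bu t Dt)); have Bv1 := bdk0 (bdkS (Bv t Dt)).
  have Bv0 := bdk0 (Bv t Dt).
  have [_ sv0 _] := Bv0; have [_ sv1 _] := Bv1; have [_ su1 _] := Bu1.
  apply: (transport_step (v := v t) x Dw Dw1) => // y.
  + apply: le_trans (ler_normB _ _) _; rewrite addrC; apply: lerD; [exact: su1|exact: sv1].
  + by apply: le_trans A2; exact: (in_g_sup (gv t Dt) Bv0).
  (* Q is in g, hence bounded by the L^1 norm of its derivative. *)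
  pose Q y := wt t y + (v t y * ((v t)^`() y - (u t)^`() y) - (v t)^`() y * w t y).
  have mw1 : tame true (fun y => (v t)^`() y - (u t)^`() y) := tameB mv1 mu1.
  have gQ : in_g Q.
    apply: in_gD; first exact: gwt.
    apply: in_gB; last exact: (in_gM mv1 (gw t Dt)).
    have := in_gM mw1 (gv t Dt); rewrite (_ : (fun y => _) = (fun y => v t y * ((v t)^`() y - (u t)^`() y))) //.
    by apply/funext => z; rewrite mulrC.
  have Eu := (PJ_integrated 1 (gu t Dt) (gut t Dt)).1 (eu t Dt).
  have Ev := (PJ_integrated 1 (gv t Dt) (gvt t Dt)).1 (ev t Dt).
  have DQ : D1 Q (fun y => - w t y * ((u t)^`()^`() y + (v t)^`()^`() y)).
    pose proof (D1D (D1B Dvt Dut) (D1B (D1M Dv Dw1) (D1M Dv1 Dw))) as H.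
    apply: D1_eq H _ => z; have := Eu z; have := Ev z; rewrite /w.
    move: ((v t)^`()^`() z) ((u t)^`()^`() z) ((v t)^`() z) ((u t)^`() z) (v t z) (u t z)
      ((vt t)^`() z) ((ut t)^`() z); clear.
    move=> v2 u2 v1 u1 v0 u0 a b; rewrite subrr mul0r !mul0r !addr0 => E1 E2.
    have -> : a = - (v0 * v2) by apply/eqP; rewrite -addr_eq0 E1.
    have -> : b = - (u0 * u2) by apply/eqP; rewrite -addr_eq0 E2.
    ring.
  have BQ : bd true (N * A) (Q^`()).
    rewrite (D1E DQ).
    have cw : continuous (fun y => - w t y) by exact: D1_continuous (D1N Dw).
    have Bw : bd false N (fun y => - w t y) by split=> // z; rewrite normrN.
    exact: (bdM Bw (bdD Bu1 Bv1)).
  have sQ := in_g_sup gQ BQ y.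
  have -> : wt t y + v t y * ((v t)^`() y - (u t)^`() y) = Q y + (v t)^`() y * w t y.
    by rewrite /Q; ring.
  apply: le_trans (ler_normD _ _) _; rewrite mulrDl; apply: lerD.
    by rewrite mulrC.
  rewrite normrM; apply: ler_pM => //.
  exact: le_trans (sv0 y) A2.
by move=> x; rewrite /w uv0 subrr.
Qed.

End uniqueness_PJ1.

(** * Blow-up for alpha <> 1 *)

Section blowup.
Context {R : realType}.

(** The derivative of the sigmoid [1 / (1 + exp (- x))]. *)
Lemma positive_tame_exists : exists q : R -> R, tame true q /\ 0 < q 0.
Proof.
pose sg (x : R) := (1 + expR (- x))^-1.
pose q (x : R) := sg x * (1 - sg x).
have sg0 x : 0 < sg x by rewrite invr_gt0.
have sg1 x : sg x <= 1 by rewrite invf_le1 // lerDl expR_ge0.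
have Dsg : D1 sg q.
  have H : D1 (fun x => 1 + expR (- x)) (fun x => 0 + - 1 * expR (- x)) :=
    D1D (D1_cst (1 : R)) (D1_exp (D1N (@D1_id R))).
  have n0 (x : R) : 1 + expR (- x) != 0 by rewrite gt_eqF.
  move=> x; have := D1V n0 H x.
  have -> // : - (0 + - 1 * expR (- x)) * ((1 + expR (- x))^-1 * (1 + expR (- x))^-1) = q x.
  by rewrite /q /sg; have := n0 x; move: (expR _) => e e1; field.
have Dq : D1 q (fun x => q x * (1 - 2 * sg x)).
  by apply: D1_eq (D1M Dsg (D1B (D1_cst 1) Dsg)) _ => x; rewrite /q; ring.
have q0 x : 0 <= q x by rewrite mulr_ge0 ?subr_ge0 // ltW.
have q1 x : q x <= 1.
  by rewrite -[leRHS]mulr1; apply: ler_pM; rewrite ?subr_ge0 ?(ltW (sg0 x)) // gerBl ltW.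
have Bsg : bd false 1 sg.
  by split=> // [|x]; [exact: D1_continuous Dsg|rewrite gtr0_norm].
have Bq : bd true 1 q.
  split=> [|x|_]; first exact: D1_continuous Dq.
    by rewrite ger0_norm.
  have cq := D1_continuous Dq.
  under eq_integral do rewrite ger0_norm //.
  apply/(integral_leP 1 cq q0 Dsg) => a b _.
  by apply: le_trans (_ : sg b <= _); rewrite // gerBl ltW.
have Msg k : exists M, bdk false k M sg.
  elim: k => [|k [M BM]]; first by exists 1.
  have Bc := bdk_cst k (1 : R).
  have BB := bdkM BM (bdkB Bc BM).
  exists (Num.max 1 (2 ^+ k * (M * (`|1| + M)))).
  apply: (bdkSI Dsg); first by apply: bd_le Bsg; rewrite le_max lexx.
  by apply: bdk_le BB; rewrite le_max lexx orbT.
exists q; split; last by rewrite mulr_gt0 // subr_gt0 invf_lt1 // ltrDl expR_gt0.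
elim=> [|k [M BM]]; first by exists 1.
have [N BN] := Msg k.
have BB := bdkM BM (bdkB (bdk_cst k (1 : R)) (bdkZ 2 BN)).
exists (Num.max 1 (2 ^+ k * (M * (`|1| + `|2| * N)))).
apply: (bdkSI Dq); first by apply: bd_le Bq; rewrite le_max lexx.
by apply: bdk_le BB; rewrite le_max lexx orbT.
Qed.

(** Following the characteristic from [x] to [y = x + h v x], the transport term
cancels to first order. *)
Lemma riccati_step (p p' p'' v v' pt : R -> R) (A c h x : R) :
  D1 p p' -> D1 p' p'' -> D1 v v' ->
  (forall y, `|p y| <= A) -> (forall y, `|p' y| <= A) -> (forall y, `|p'' y| <= A) ->
  (forall y, `|v y| <= A) -> (forall y, `|v' y| <= A) ->
  (forall y, pt y = c * (p y * p y) - v y * p' y) -> 0 <= c -> 0 <= h ->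
  exists y, p x + h * (c * (p x * p x)) - (2 * c + 3) * A ^+ 3 * h ^+ 2 <= p y + h * pt y.
Proof.
move=> Dp Dp' Dv pA p1A p2A vA v1A ptE c0 h0.
have A0 : 0 <= A := le_trans (normr_ge0 _) (pA x).
pose y := x + h * v x; exists y.
have Ey : y - x = h * v x by rewrite /y; ring.
have ly : `|y - x| <= h * A.
  by rewrite Ey normrM ger0_norm //; apply: ler_wpM2l.
have T := D1_taylor Dp Dp' p2A x y.
have L1 := D1_lip Dp p1A x y.
have L2 := D1_lip Dp' p2A x y.
have L3 := D1_lip Dv v1A x y.
have AhA : A * `|y - x| <= A * (h * A) by exact: ler_wpM2l.
have {}L1 := le_trans L1 AhA; have {}L2 := le_trans L2 AhA; have {}L3 := le_trans L3 AhA.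
have T2 : A * (y - x) ^+ 2 <= A ^+ 3 * h ^+ 2.
  have -> : A ^+ 3 * h ^+ 2 = A * (h ^+ 2 * A ^+ 2) by ring.
  rewrite Ey exprMn; apply: ler_wpM2l => //; apply: ler_wpM2l; first exact: sqr_ge0.
  by rewrite -real_normK ?num_real //; apply: lerXn2r; rewrite ?nnegrE // vA.
have {}T := le_trans T T2; rewrite Ey in T.
have P1 : `|c * ((p y - p x) * (p y + p x))| <= c * (A * (h * A) * (A + A)).
  rewrite normrM ger0_norm //; apply: ler_wpM2l => //; rewrite normrM.
  by apply: ler_pM => //; apply: le_trans (ler_normD _ _) _; apply: lerD.
have P2 : `|(v y - v x) * p' y| <= A * (h * A) * A.
  by rewrite normrM; apply: ler_pM.
have P3 : `|v x * (p' y - p' x)| <= A * (A * (h * A)).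
  by rewrite normrM; apply: ler_pM.
have S : `|pt y - pt x| <= (2 * c + 2) * A ^+ 3 * h.
  have -> : pt y - pt x = c * ((p y - p x) * (p y + p x)) - (v y - v x) * p' y - v x * (p' y - p' x).
    by rewrite !ptE; ring.
  apply: le_trans (ler_normB _ _) _.
  apply: le_trans (lerD (le_trans (ler_normB _ _) (lerD P1 P2)) P3) _.
  by rewrite le_eqVlt; apply/orP; left; apply/eqP; ring.
have S2 : `|h * (pt y - pt x)| <= (2 * c + 2) * A ^+ 3 * h ^+ 2.
  rewrite normrM ger0_norm // expr2 mulrA [leRHS]mulrC; exact: ler_wpM2l.
have E : p y + h * pt y = p x + h * (c * (p x * p x)) + (p y - p x - p' x * (h * v x))
   + h * (pt y - pt x).
  by rewrite [pt x]ptE; ring.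
rewrite E; move: T S2; rewrite !ler_norml => /andP[T _] /andP[S2 _].
have Ec : (2 * c + 3) * A ^+ 3 * h ^+ 2 = A ^+ 3 * h ^+ 2 + (2 * c + 2) * A ^+ 3 * h ^+ 2 by ring.
rewrite Ec; move: T S2; clear.
move: (p y - p x - _) (h * (pt y - pt x)) (A ^+ 3 * h ^+ 2) (_ * A ^+ 3 * h ^+ 2) => a b d e; lra.
Qed.

(** The barrier [m s = m0 / (1 - c m0 s / 2)] grows at half the rate of the equation,
which leaves room for the errors of the Euler steps.  It is compared with the
supremum of [p], in the form that some value exceeds [m s - e] for every [e]. *)
Lemma riccati_growth (T c C m0 : R) (p pt : R -> R -> R) : 0 <= T -> 0 < c -> 0 <= C -> 0 < m0 ->
  c / 2 * m0 * T < 1 -> let D := `[0, T]%classic in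
  (forall t, D t -> tame false (pt t)) -> (forall t, D t -> tder false D p (pt t) t) ->
  (forall t, D t -> forall h x, 0 <= h -> exists y,
     p t x + h * (c * (p t x * p t x)) - C * h ^+ 2 <= p t y + h * pt t y) ->
  (exists x, m0 <= p 0 x) ->
  forall e : R, 0 < e -> exists x, m0 / (1 - c / 2 * m0 * T) - e <= p T x.
Proof.
move=> T0 c0 C0 m00 cT D mpt dp step [xi xi0].
pose q s := 1 - c / 2 * m0 * s; pose m s := m0 / q s.
have cm : 0 < c / 2 * m0 by rewrite mulr_gt0 // divr_gt0.
have q_gt0 s : s <= T -> 0 < q s.
  move=> sT; rewrite subr_gt0; apply: le_lt_trans cT; apply: ler_wpM2l => //; exact: ltW.
have m_gt0 s : s <= T -> 0 < m s by move=> sT; apply: divr_gt0 => //; exact: q_gt0.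
have mono r s : r <= s -> s <= T -> m r <= m s.
  move=> rs sT; apply: ler_wpM2l; first exact: ltW.
  have rT := le_trans rs sT.
  rewrite lef_pV2 ?posrE; [|exact: q_gt0|exact: q_gt0].
  by rewrite /q lerD2l lerN2; apply: ler_wpM2l => //; exact: ltW.
have incr r s : r <= T -> s <= T -> m s - m r = c / 2 * (s - r) * m r * m s.
  move=> rT sT; rewrite /m; have := q_gt0 r rT; have := q_gt0 s sT; rewrite /q => h1 h2.
  by field; rewrite !gt_eqF //; lra.
pose P s := forall e : R, 0 < e -> exists x, m s - e <= p s x.
have inD s : 0 <= s -> s <= T -> D s by move=> s0 sT; rewrite /D /= in_itv /= s0.
suff : P T by [].
apply: (@real_induction R P 0 T T0).
- move=> e e0; exists xi; rewrite /m /q mulr0 subr0 divr1.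
  by apply: le_trans xi0; rewrite gerBl ltW.
- move=> s /andP[s0 sT] Ps.
  have Ds := inD s s0 (ltW sT); have ms := m_gt0 s (ltW sT).
  (* A quarter of the gain c (m s) ^ 2 is available for four errors. *)
  pose d := c * (m s * m s) / 16.
  have mm : 0 < m s * m s := mulr_gt0 ms ms.
  have d0 : 0 < d by apply: divr_gt0; [exact: mulr_gt0|rewrite ltr0n].
  have [d1 d10 Hd1] := near_pd_ex (dp s Ds 0%N _ d0).
  pose e := Num.min (d1 / 2) (Num.min (d / (C + 1)) ((c * m s)^-1 / 2)).
  have cms : 0 < c * m s by rewrite mulr_gt0.
  have e0 : 0 < e.
    rewrite !lt_min; apply/andP; split; first exact: divr_gt0.
    apply/andP; split; first by apply: divr_gt0 => //; exact: ltr_wpDl.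
    by apply: divr_gt0 => //; rewrite invr_gt0.
  have [ed1 eC em] : [/\ e <= d1 / 2, e <= d / (C + 1) & e <= (c * m s)^-1 / 2].
    by have := lexx e; rewrite {2}/e !le_min => /andP[? /andP[]].
  exists e; first exact: e0.
  move=> r sr re rT e' e'0.
  pose h := r - s; have h0 : 0 < h by rewrite subr_gt0.
  have he : h <= e by rewrite /h lerBlDl.
  have Dr : D r by apply: inD => //; apply: le_trans s0 (ltW sr).
  have hd1 : `|r - s| < d1.
    rewrite gtr0_norm //; apply: le_lt_trans he _; apply: le_lt_trans ed1 _.
    by rewrite ltr_pdivrMr // ltr_pMr // ltr1n.
  have rs : r != s by rewrite gt_eqF.
  have hd : 0 < h * d by exact: mulr_gt0.
  have [x0 Hx0] := Ps _ hd.
  have [y Hy] := step s Ds h x0 (ltW h0).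
  exists y.
  have B := bdk_sup (Hd1 r Dr rs hd1) y.
  have Ep : p r y = (p s y + h * pt s y) + h * ((p r y - p s y) / (r - s) - pt s y).
    by rewrite /h; field; rewrite gt_eqF // subr_gt0.
  have S1 : - (h * d) <= h * ((p r y - p s y) / (r - s) - pt s y).
    rewrite -mulrN; apply: ler_wpM2l; first exact: ltW.
    by move: B; rewrite ler_norml => /andP[].
  have S2 : C * h ^+ 2 <= h * d.
    rewrite expr2 mulrA mulrC; apply: ler_wpM2l; first exact: ltW.
    apply: le_trans (ler_wpM2l C0 (le_trans he eC)) _.
    by apply: mul_divr_le => //; exact: ltW.
  have chm : c * h * m s <= 2^-1.
    rewrite mulrAC; apply: le_trans (ler_wpM2l (ltW cms) (le_trans he em)) _.
    by rewrite mulrA divff ?mul1r // gt_eqF.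
  have hdm : h * d <= m s / 32.
    have -> : h * d = c * h * m s * (m s / 16) by rewrite /d; ring.
    apply: le_trans (ler_wpM2r _ chm) _; first by rewrite ltW // divr_gt0.
    by rewrite le_eqVlt; apply/orP; left; apply/eqP; field.
  have S3 : h * (c * (m s * m s)) - h * d <= h * (c * (p s x0 * p s x0)).
    have sq : (m s - h * d) * (m s - h * d) <= p s x0 * p s x0.
      have n0 : 0 <= m s - h * d by move: hdm ms; clear; lra.
      by apply: ler_pM.
    have Q1 : h * (c * ((m s - h * d) * (m s - h * d))) <= h * (c * (p s x0 * p s x0)).
      by apply: ler_wpM2l; [exact: ltW|apply: ler_wpM2l; [exact: ltW|]].
    apply: le_trans Q1.
    have -> : h * (c * ((m s - h * d) * (m s - h * d))) =
      h * (c * (m s * m s)) - 2 * (c * h * m s) * (h * d) + (c * h) * ((h * d) * (h * d)) by ring.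
    have Q2 : 2 * (c * h * m s) * (h * d) <= 1 * (h * d).
      by apply: ler_wpM2r; [exact: ltW|move: chm; clear; lra].
    have Q3 : 0 <= c * h * (h * d * (h * d)) by apply: mulr_ge0; apply: mulr_ge0; exact: ltW.
    by move: Q2 Q3; clear; lra.
  have S4 : m r <= m s + 3 / 4 * (h * (c * (m s * m s))).
    have I := incr s r (ltW sT) rT.
    have mr := m_gt0 r rT.
    have Z : m r * (1 - c * h * m s / 2) = m s.
      have : m r - m s = c * h * m s / 2 * m r by rewrite I -/h; ring.
      by move: (c * h * m s / 2) (m r) (m s) => z a b Eab; lra.
    have Z2 : m r <= 3 / 2 * m s.
      have : m r * (3 / 4) <= m s.
        rewrite -[leRHS]Z; apply: ler_wpM2l; first exact: ltW.
        by move: chm; move: (c * h * m s) => z; clear; lra.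
      by move: ms; move: (m r) (m s) => a b; clear; lra.
    have -> : m r = m s + c / 2 * h * m s * m r by rewrite -I; ring.
    rewrite lerD2l; apply: le_trans (ler_wpM2l _ Z2) _.
      by do 2! [apply: mulr_ge0; last exact: ltW]; rewrite divr_ge0 // ltW.
    by rewrite le_eqVlt; apply/orP; left; apply/eqP; field.
  have Ed : h * (c * (m s * m s)) = 16 * (h * d) by rewrite /d; field.
  rewrite Ep; move: S1 S2 S3 S4 Hx0 Hy hd e'0; rewrite Ed; clear.
  move: (h * (_ - pt s y)) (C * h ^+ 2) (h * (c * _)) (m r) (m s) (h * d) => a b g k l n.
  by move: (p s y + _) (p s x0) => f j; lra.
move=> s /andP[s0 sT] IH e e0.
have Ds := inD s (ltW s0) sT; have ms := m_gt0 s sT.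
have cp := tder_tcont (mpt s Ds) (dp s Ds).
have e3 : 0 < e / 3 by rewrite divr_gt0.
have [d1 d10 Hd1] := near_pw_ex (cp 0%N _ e3).
(* The increment of m on [s - g, s] is at most e / 3. *)
pose g := e / 3 / (c / 2 * m s * m s).
have g0 : 0 < g.
  apply: divr_gt0; first exact: e3.
  by apply: (mulr_gt0 _ ms); apply: (mulr_gt0 _ ms); apply: divr_gt0; rewrite ?ltr0n.
pose r := Num.max 0 (s - Num.min (d1 / 2) g).
have d12 : 0 < Num.min (d1 / 2) g by rewrite lt_min g0 divr_gt0.
have rs : r < s by rewrite gt_max s0 /= gtrBl.
have r0 : 0 <= r by rewrite le_max lexx.
have sr : s - r <= Num.min (d1 / 2) g by rewrite lerBlDl -lerBlDr le_max lexx orbT.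
have [sr1 sr2] : s - r <= d1 / 2 /\ s - r <= g by move: sr; rewrite le_min => /andP[].
have rd : `|r - s| < d1.
  by rewrite ltr0_norm ?subr_lt0 //; move: sr1 d10; clear; lra.
have rT := le_trans (ltW rs) sT.
have Dr := inD r r0 rT.
have [x Hx] := IH r (introT andP (conj r0 rs)) _ e3.
exists x; have := bdk_sup (Hd1 r Dr rd) x; rewrite ler_norml => /andP[_ B].
have I := incr r s rT sT.
have M1 : m s - m r <= e / 3.
  rewrite I; have mr := m_gt0 r rT.
  apply: le_trans (_ : c / 2 * g * m s * m s <= _).
    apply: ler_wpM2r; first exact: ltW.
    apply: ler_pM; [|exact: ltW| |exact: mono (ltW rs) sT].
    - by apply: mulr_ge0; [rewrite divr_ge0 // ltW|rewrite subr_ge0 ltW].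
    by apply: ler_wpM2l => //; rewrite divr_ge0 // ltW.
  rewrite /g le_eqVlt; apply/orP; left; apply/eqP; field.
  by rewrite !gt_eqF.
by move: B M1 Hx; move: (p r x) (p s x) (m r) (m s) => a b c' d'; clear; lra.
Qed.

(** The initial velocity is chosen such that [p = - sgn (1 - alpha) u_x] is positive
somewhere.  On the compact interval up to the explosion time of the barrier, [u_x]
is bounded along a solution; this contradicts [riccati_growth]. *)
Lemma PJ_blowup (alpha : R) : alpha != 1 -> ~ globally_well_posed (proudman_johnson alpha).
Proof.
move=> a1 GWP.
pose k := (1 - alpha) / 2.
have k0 : k != 0 by rewrite mulf_neq0 ?invr_neq0 // subr_eq0 eq_sym.
pose sg := Num.sg k.
have sg2 : sg * sg = 1 by rewrite -expr2 sqr_sg k0.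
have sgk : sg * k = `|k| by rewrite /sg [RHS]normrEsg.
have sg1 : `|sg| = 1 by rewrite normr_sg k0.
have [q0 [mq q00]] := positive_tame_exists.
have [rho [grho Drho]] := g_antiderivative mq.
have gu0 : in_g (fun x => - sg * rho x) by exact: in_gZ.
have [u [[ut [[gu du cut] eu]] u0E _]] := GWP _ gu0.
pose c := `|k|; have c0 : 0 < c by rewrite normr_gt0.
pose m0 := q0 0.
pose p t x := - sg * (u t)^`() x; pose pt t x := - sg * (ut t)^`() x.
pose Tm := 2 / (c * m0).
have cm : 0 < c * m0 by rewrite mulr_gt0.
have Tm0 : 0 < Tm by rewrite divr_gt0.
have sub (T : R) : `[0, T]%classic `<=` `[0, +oo[%classic.
  by move=> t; rewrite /= !in_itv /= => /andP[-> _].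
have guT t : `[0, Tm]%classic t -> in_g (u t) by move=> /sub; exact: gu.
have cu : g_continuous_on `[0, Tm]%classic u.
  apply: tcont_g_continuous; first exact: guT.
  move=> t Dt.
  by have [] := g_derivative_continuous (in_g_affine guT) (g_derivative_sub (@sub Tm) du) Dt.
have [r r0 Br] := curve_bdk 2 guT cu.
pose A := r^-1; have A0 : 0 < A by rewrite invr_gt0.
(* The time at which the barrier reaches A + 1 + m0, with A a bound for u_x. *)
pose T := Tm * (1 - m0 / (A + 1 + m0)).
have Am : 0 < A + 1 + m0 by rewrite !addr_gt0.
have lam : 0 < m0 / (A + 1 + m0) by rewrite divr_gt0.
have lam1 : m0 / (A + 1 + m0) <= 1.
  by rewrite ler_pdivrMr // mul1r lerDr addr_ge0 // ltW.
have T0 : 0 <= T by rewrite mulr_ge0 ?subr_ge0 // ltW.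
have TTm : T <= Tm by rewrite -[leRHS]mulr1; apply: ler_wpM2l; [exact: ltW|rewrite gerBl ltW].
have ET : 1 - c / 2 * m0 * T = m0 / (A + 1 + m0).
  rewrite /T /Tm; move: lam; move: (m0 / (A + 1 + m0)) => l _; field.
  by rewrite !gt_eqF.
have cT : c / 2 * m0 * T < 1 by rewrite -subr_gt0 ET.
pose D := `[0, T]%classic : set R.
have DTm t : D t -> `[0, Tm]%classic t.
  by rewrite /D /= !in_itv /= => /andP[-> tT]; apply: le_trans tT TTm.
have guD t : D t -> in_g (u t) by move=> /sub; exact: gu.
have duD := g_derivative_sub (@sub T) du.
have gutD t : D t -> in_g (ut t) by move=> /duD[].
have mut t : D t -> tame false (pt t).
  by move=> Dt; apply: tameZ; apply: tame_false; apply: in_g_tame; exact: gutD.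
have dp t : D t -> tder false D p (pt t) t.
  move=> Dt; have [_ t1] := g_derivative_tder (in_g_affine guD) duD Dt.
  exact: difZ (cvgto_false t1).
pose C := (2 * c + 3) * A ^+ 3.
have C0 : 0 <= C by rewrite mulr_ge0 ?exprn_ge0 ?addr_ge0 ?mulr_ge0 ?(ltW c0) // ltW.
have step t : D t -> forall h x, 0 <= h -> exists y,
     p t x + h * (c * (p t x * p t x)) - C * h ^+ 2 <= p t y + h * pt t y.
  move=> Dt h x h0; have B := Br t (DTm t Dt).
  have mu1 := in_g_tame (guD t Dt); have Du1 := tame_D1 mu1; have Du2 := tame_D1 (tame_derive mu1).
  have sB k' : `|- sg * k'| = `|k'| by rewrite normrM normrN sg1 mul1r.
  have s1 := bdk_sup B; have s2 := bdk_sup (bdkS B); have s3 := bdk_sup (bdkS (bdkS B)).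
  have E := (PJ_integrated alpha (guD t Dt) (gutD t Dt)).1 (eu t (@sub T t Dt)).
  apply: (riccati_step (v := u t) x (D1Z (- sg) Du1) (D1Z (- sg) Du2) (in_g_D1 (guD t Dt))) => //.
  - by move=> y; rewrite sB; exact: s1.
  - by move=> y; rewrite sB; exact: s2.
  - by move=> y; rewrite sB; exact: s3.
  - by move=> y; exact: (in_g_sup (guD t Dt) (bdk0 B)).
  - move=> y; rewrite /pt; have := E y; rewrite -/k /c -sgk.
    move: ((ut t)^`() y) ((u t)^`()^`() y) ((u t)^`() y) (u t y) => a b d e Ea.
    have -> : a = - (k * (d * d) + e * b) by apply/eqP; rewrite -addr_eq0 addrA Ea.
    have -> : sg * k * (- sg * d * (- sg * d)) = sg * sg * (sg * k * (d * d)) by ring.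
    by rewrite sg2; ring.
  exact: ltW.
have init : exists x, m0 <= p 0 x.
  exists 0; rewrite /p u0E (D1E (D1Z (- sg) Drho)).
  have -> : - sg * (- sg * q0 0) = sg * sg * m0 by rewrite /m0; ring.
  by rewrite sg2 mul1r.
have [x Hx] := riccati_growth T0 c0 C0 q00 cT mut dp step init ltr01.
have DT : D T by rewrite /D /= in_itv /= T0 lexx.
have := bdk_sup (Br T (DTm T DT)) x.
have -> : `|(u T)^`() x| = `|p T x| by rewrite /p normrM normrN sg1 mul1r.
move: Hx; rewrite ET invf_div mulrCA divff ?mulr1; last by rewrite gt_eqF.
move=> H1 H2; have := le_trans H1 (le_trans (ler_norm _) H2).
by rewrite -/A; move: q00; rewrite -/m0; clear; lra.
Qed.

Lemma PJ1_globally_well_posed : globally_well_posed (proudman_johnson (1 : R)).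
Proof.
move=> u0 gu0; have [u su u00] := PJ1_existence `[0, +oo[%classic gu0.
exists u; split; [exact: su|exact: u00|move=> v [vt [[gv dv cvt] ev]] v0 T T0].
have [ut [[gu du cut] eu]] := su.
have sub : `[0, T]%classic `<=` `[0, +oo[%classic.
  by move=> t; rewrite /= !in_itv /= => /andP[-> _].
have Cu : C1_curve_g `[0, T]%classic u ut.
  split; [by move=> t /sub; exact: gu|exact: g_derivative_sub du|exact: g_continuous_sub cut].
have Cv : C1_curve_g `[0, T]%classic v vt.
  split; [by move=> t /sub; exact: gv|exact: g_derivative_sub dv|exact: g_continuous_sub cvt].
apply: (PJ1_unique_segment T0 Cu Cv) => [t /sub|t /sub|]; [exact: eu|exact: ev|].
by rewrite u00 v0.
Qed.

End blowup.

Theorem theorem3p9 (R : realType) (alpha : R) :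
  euler_arnold (alpha_H1dot alpha) (proudman_johnson alpha) /\
  (globally_well_posed (proudman_johnson alpha) <-> alpha = 1%R).
Proof.
split; first exact: euler_arnold_PJ.
split=> [GWP|->]; last exact: PJ1_globally_well_posed.
by apply/eqP/negPn/negP => /PJ_blowup; apply.
Qed.
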